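(* Work on a word RAM with word size $w$, with sets being finite subsets of $\{0,1\}^w$. There is a randomized preprocessing of individual sets (using linear space) and a query algorithm such that, given $m$ preprocessed sets $S_1,\dots,S_m$ of total size $n=\sum_i|S_i|$, the algorithm computes $S_1\cap\dots\cap S_m$ in expected time $O(n \log^2 w/w + km)$, where $k=|S_1\cap\dots\cap S_m|$.
   Context: Each set is preprocessed independently of the others (all sets share one random hash function chosen at preprocessing). The expectation is over the randomness of the algorithm.
   Formalization: The time bound proved is O(n log² w/w + km + m): the extra term m for reading the m given sets is needed, as m singletons, all equal but one, have k=0 and n=m yet require Ω(m) time; sets and linear work space must fit in the 2^w addressable words. *)

(* Defs.v *)
From mathcomp Require Import all_boot all_order all_algebra.
From mathcomp Require Import reals exp.

Set Implicit Arguments.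
Unset Strict Implicit.
Unset Printing Implicit Defensive.

(* A word of w bits is identified with the number it denotes in binary, so
   {0,1}^w is 'I_(2 ^ w). *)
Definition word (w : nat) := 'I_(2 ^ w).

Fact pow2_gt0 w : 0 < 2 ^ w. Proof. by rewrite expn_gt0. Qed.

Definition trunc w (x : nat) : word w := Ordinal (ltn_pmod x (pow2_gt0 w)).

Definition memory w := word w -> word w.

(* Word RAM with unit-cost instructions.  Registers and code positions are
   natural numbers; a program can only name finitely many of them.  The same
   program is run for every word size: constants are truncated to w bits. *)
Inductive binop := Add | Sub | Mul | Div | And | Or | Xor | Shl | Shr.

Inductive instr :=
  | Const of nat & nat                  (* rd, constant *)
  | Op of binop & nat & nat & nat       (* operation, rd, rx, ry *)
  | Read of nat & nat                   (* rd := mem[ra] *)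
  | Write of nat & nat                  (* mem[ra] := rx *)
  | JumpLt of nat & nat & nat           (* rx, ry, target *)
  | JumpEq of nat & nat & nat.          (* rx, ry, target *)

Definition program := seq instr.

(* Sub wraps around modulo 2^w; division by 0 yields 0. *)
Definition eval_op w (o : binop) (x y : word w) : word w :=
  trunc w match o with
  | Add => x + y
  | Sub => x + (2 ^ w - y)
  | Mul => x * y
  | Div => x %/ y
  | And => Nat.land x y
  | Or => Nat.lor x y
  | Xor => Nat.lxor x y
  | Shl => x * 2 ^ y
  | Shr => x %/ 2 ^ y
  end.

Record state w := State { pc : nat; reg : nat -> word w; mem : memory w }.

Definition upd (T : eqType) (U : Type) (f : T -> U) (a : T) (v : U) : T -> U :=
  fun x => if x == a then v else f x.

Definition exec w (i : instr) (st : state w) : state w :=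
  let: State p r M := st in
  match i with
  | Const d n => State p.+1 (upd r d (trunc w n)) M
  | Op o d x y => State p.+1 (upd r d (eval_op o (r x) (r y))) M
  | Read d a => State p.+1 (upd r d (M (r a))) M
  | Write a x => State p.+1 r (upd M (r a) (r x))
  | JumpLt x y l => State (if (r x < r y)%N then l else p.+1) r M
  | JumpEq x y l => State (if r x == r y then l else p.+1) r M
  end.

Definition step w (P : program) (st : state w) : state w :=
  if onth P (pc st) is Some i then exec i st else st.

Definition run w (P : program) (t : nat) (st : state w) : state w :=
  iter t (step P) st.

(* The machine halts by leaving its code. *)
Definition halted w (P : program) (st : state w) : bool := size P <= pc st.

Definition halts_in w (P : program) (st : state w) (t : nat) (st' : state w) :
    Prop :=
  [/\ run P t st = st', halted P st' &
      forall t', t' < t -> ~~ halted P (run P t' st)].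

(* At no time is a cell outside [a, a + len) modified. *)
Definition confined w (P : program) (st : state w) (a len : nat) : Prop :=
  forall t (b : word w), ~~ (a <= b < a + len) ->
    mem (run P t st) b = mem st b.

Definition stored w (M : memory w) (a : nat) (D : seq (word w)) : Prop :=
  a + size D <= 2 ^ w /\
  forall i, i < size D -> M (trunc w (a + i)) = nth (trunc w 0) D i.

(* Output convention: register 0 holds the length, register 1 the address. *)
Definition output w (st : state w) (D : seq (word w)) : Prop :=
  reg st 0 = size D :> nat /\ stored (mem st) (reg st 1) D.

Definition init_regs w (l : seq (word w)) : nat -> word w :=
  nth (trunc w 0) l.

(* The random choice of the hash function is a string of s independent uniform
   words, shared by the preprocessing of all sets and by the queries; s does
   not depend on w. *)
Definition seed w s := s.-tuple (word w).

(* Initial configuration for preprocessing one set, listed by X. *)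
Definition pre_start w s (rho : seed w s) (X : seq (word w)) : state w :=
  State 0 (init_regs [:: trunc w (size X); trunc w s])
    (fun a => nth (trunc w 0) (rho ++ X) a).

Definition preprocessed w s (pre : program) (rho : seed w s)
    (S : {set word w}) (D : seq (word w)) : Prop :=
  exists X t st', [/\ perm_eq X (enum S),
    halts_in pre (pre_start rho X) t st' & output st' D].

(* Whatever the seed and the listing of the set, preprocessing halts, and the
   cells it writes and its output all lie among the first c * (|S| + 1). *)
Definition linear_space_preprocessing (s c : nat) (pre : program) : Prop :=
  forall w (rho : seed w s) (S : {set word w}) (X : seq (word w)),
    0 < w -> c * (#|S| + 1) <= 2 ^ w -> perm_eq X (enum S) ->
    confined pre (pre_start rho X) 0 (c * (#|S| + 1)) /\
    exists t st' D, [/\ halts_in pre (pre_start rho X) t st', output st' D &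
      reg st' 1 + size D <= c * (#|S| + 1)].

(* A query: m in register 0, then the addresses of the array of the m handles,
   of the seed, and of the work space.  A handle is the address of a
   preprocessed set. *)
Record query w := Query {
  qmem : memory w; handles_at : word w; seed_at : word w; work_at : word w }.

Definition query_start w (m : nat) (q : query w) : state w :=
  State 0 (init_regs [:: trunc w m; handles_at q; seed_at q; work_at q])
    (qmem q).

(* The preprocessed sets lie anywhere in memory; the len cells of work space
   have arbitrary contents and do not meet the input. *)
Definition query_for w s (pre : program) (rho : seed w s) (len m : nat)
    (S : 'I_m -> {set word w}) (q : query w) : Prop :=
  let apart (a l : nat) := (a + l <= work_at q) || (work_at q + len <= a) in
  exists (p : 'I_m -> word w) (D : 'I_m -> seq (word w)),
  [/\ forall i, [/\ preprocessed pre rho (S i) (D i),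
                    stored (qmem q) (p i) (D i) & apart (p i) (size (D i))],
      stored (qmem q) (handles_at q) [seq p i | i <- enum 'I_m] /\
        apart (handles_at q) m,
      stored (qmem q) (seed_at q) rho /\ apart (seed_at q) s &
      work_at q + len <= 2 ^ w].

Definition expectation (R : realType) (T : finType) (f : T -> nat) : R :=
  ((\sum_x (f x)%:R) / #|T|%:R)%R.

(* Main.v *)
(* A hash function splits a set of n elements into W buckets, where W is a power
   of two of order n / Q + 1 and Q = blocks w is of order w / ell^2, ell ~ log w.
   The elements of a bucket are hashed to slots (by a random polynomial of degree
   below ell, evaluated at signatures of 4 ell bits), at most ell to a slot, and
   their signatures are packed into one word in two layouts: one repeats every
   signature ell times, the other repeats every slot ell times.  A constant
   number of word operations on the first layout of one bucket and the second
   layout of another then compares all pairs of signatures in equal slots.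

   As the numbers of buckets are powers of two, the buckets of every set refine
   those of the smallest set.  For every bucket of the smallest set, the query
   compares it with the refining buckets of each other set and keeps the elements
   whose signatures are found in all sets; these candidates are checked by
   lookups in chained hash tables.  A set with more than w times as many buckets
   as the smallest one is searched by lookups from the start, and so is every
   bucket with an overfull slot.  The latter cost O(W) in expectation: heavy
   buckets by Chebyshev's inequality, the others by ell-wise independence of the
   polynomial.  Wrong candidates need a collision of signatures and are rare.

   The total is O(m + sum_i W_i + k m), and sum_i W_i = O(m + n ell^2 / w). *)
From Stdlib Require Import PeanoNat.
Require Import Defs.
From mathcomp Require Import all_boot all_order all_algebra.
From mathcomp Require Import reals exp.
From mathcomp Require Import zify ring lra.

Set Implicit Arguments.
Unset Strict Implicit.
Unset Printing Implicit Defensive.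


(** * A structured language on top of the word RAM *)

Inductive expr :=
  | Lit of nat
  | Ones                                (* the word 2 ^ w - 1 *)
  | Var of nat
  | Bin of binop & expr & expr
  | Get of expr.

Inductive cond := Lt of expr & expr | Eq of expr & expr.

Inductive cmd :=
  | Skip
  | Assign of nat & expr
  | Put of expr & expr
  | Seq of cmd & cmd
  | If of cond & cmd & cmd
  | While of cond & cmd.

Definition binval (o : binop) (x y : nat) : nat :=
  match o with
  | Add => x + y
  | Defs.Sub => x - y
  | Mul => x * y
  | Div => x %/ y
  | And => Nat.land x y
  | Or => Nat.lor x y
  | Xor => Nat.lxor x y
  | Shl => x * 2 ^ y
  | Shr => x %/ 2 ^ y
  end.

Definition binsafe (w : nat) (o : binop) (x y : nat) : bool :=
  match o with
  | Add => x + y < 2 ^ w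
  | Defs.Sub => y <= x
  | Mul => x * y < 2 ^ w
  | Shl => x * 2 ^ y < 2 ^ w
  | _ => true
  end.

Definition store := nat -> nat.

Definition put (f : store) (a v : nat) : store :=
  fun x => if x == a then v else f x.

Fixpoint ev (w : nat) (e : expr) (r M : store) : nat :=
  match e with
  | Lit n => n
  | Ones => 2 ^ w - 1
  | Var x => r x
  | Bin o a b => binval o (ev w a r M) (ev w b r M)
  | Get a => M (ev w a r M)
  end.

Fixpoint safe (w : nat) (e : expr) (r M : store) : bool :=
  match e with
  | Lit n => n < 2 ^ w
  | Ones | Var _ => true
  | Bin o a b =>
      [&& safe w a r M, safe w b r M & binsafe w o (ev w a r M) (ev w b r M)]
  | Get a => safe w a r M
  end.

Definition evc (w : nat) (c : cond) (r M : store) : bool :=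
  match c with
  | Lt a b => ev w a r M < ev w b r M
  | Eq a b => ev w a r M == ev w b r M
  end.

Definition safec (w : nat) (c : cond) (r M : store) : bool :=
  match c with Lt a b | Eq a b => safe w a r M && safe w b r M end.

(* [bs w ok c r M t r' M']: started with registers r and memory M, c stops
   with r' and M' after t elementary commands; no operation overflows and all
   writes go to addresses in ok. *)
Inductive bs (w : nat) (ok : pred nat) :
    cmd -> store -> store -> nat -> store -> store -> Prop :=
  | BsSkip r M : bs w ok Skip r M 0 r M
  | BsAssign x e r M : safe w e r M ->
      bs w ok (Assign x e) r M 1 (put r x (ev w e r M)) M
  | BsPut a e r M : safe w a r M -> safe w e r M -> ok (ev w a r M) ->
      bs w ok (Put a e) r M 1 r (put M (ev w a r M) (ev w e r M))
  | BsSeq c1 c2 r M t1 r1 M1 t2 r2 M2 :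
      bs w ok c1 r M t1 r1 M1 -> bs w ok c2 r1 M1 t2 r2 M2 ->
      bs w ok (Seq c1 c2) r M (t1 + t2) r2 M2
  | BsIf c c1 c2 r M t r1 M1 : safec w c r M ->
      bs w ok (if evc w c r M then c1 else c2) r M t r1 M1 ->
      bs w ok (If c c1 c2) r M t.+1 r1 M1
  | BsWhileT c c1 r M t1 r1 M1 t2 r2 M2 : safec w c r M -> evc w c r M ->
      bs w ok c1 r M t1 r1 M1 -> bs w ok (While c c1) r1 M1 t2 r2 M2 ->
      bs w ok (While c c1) r M (t1 + t2).+1 r2 M2
  | BsWhileF c c1 r M : safec w c r M -> ~~ evc w c r M ->
      bs w ok (While c c1) r M 1 r M.

(** * Compilation *)

(* Registers from tmp on hold intermediate results. *)
Definition tmp := 90.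

Fixpoint comp_e (d : nat) (e : expr) : program :=
  match e with
  | Lit n => [:: Const (tmp + d) n]
  | Ones => [:: Const (tmp + d) 0; Const (tmp + d.+1) 1;
                Op Defs.Sub (tmp + d) (tmp + d) (tmp + d.+1)]
  | Var x => [:: Op Or (tmp + d) x x]
  | Bin o a b => comp_e d a ++ comp_e d.+1 b ++
                 [:: Op o (tmp + d) (tmp + d) (tmp + d.+1)]
  | Get a => rcons (comp_e d a) (Read (tmp + d) (tmp + d))
  end.

(* Jumps to l if the condition holds, falls through otherwise. *)
Definition comp_c (c : cond) (l : nat) : program :=
  match c with
  | Lt a b => comp_e 0 a ++ comp_e 1 b ++ [:: JumpLt tmp tmp.+1 l]
  | Eq a b => comp_e 0 a ++ comp_e 1 b ++ [:: JumpEq tmp tmp.+1 l]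
  end.

Definition goto (l : nat) := JumpEq 0 0 l.

Fixpoint comp (o : nat) (c : cmd) : program :=
  match c with
  | Skip => [::]
  | Assign x e => rcons (comp_e 0 e) (Op Or x tmp tmp)
  | Put a e => comp_e 0 a ++ comp_e 1 e ++ [:: Write tmp tmp.+1]
  | Seq c1 c2 =>
      let p1 := comp o c1 in p1 ++ comp (o + size p1) c2
  | If c c1 c2 =>
      let s := size (comp_c c 0) in
      let p2 := comp (o + s) c2 in
      let o1 := o + s + (size p2).+1 in
      let p1 := comp o1 c1 in
      comp_c c o1 ++ p2 ++ goto (o1 + size p1) :: p1
  | While c c1 =>
      let s := size (comp_c c 0) in
      let p1 := comp (o + s.+1) c1 in
      comp_c c (o + s.+1) ++ goto (o + s.+1 + (size p1).+1) :: rcons p1 (goto o)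
  end.

Fixpoint wf_e (e : expr) : bool :=
  match e with
  | Lit _ | Ones => true
  | Var x => x < tmp
  | Bin _ a b => wf_e a && wf_e b
  | Get a => wf_e a
  end.

Definition wf_c (c : cond) : bool :=
  match c with Lt a b | Eq a b => wf_e a && wf_e b end.

Fixpoint wf (c : cmd) : bool :=
  match c with
  | Skip => true
  | Assign x e => (x < tmp) && wf_e e
  | Put a e => wf_e a && wf_e e
  | Seq c1 c2 => wf c1 && wf c2
  | If c c1 c2 => [&& wf_c c, wf c1 & wf c2]
  | While c c1 => wf_c c && wf c1
  end.

Lemma size_comp_c c l l' : size (comp_c c l) = size (comp_c c l').
Proof. by case: c => a b; rewrite !size_cat. Qed.

Lemma land_le x y : Nat.land x y <= x.
Proof. apply/leP; exact: Nat.land_le_l. Qed.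

Lemma pow_expn m n : Nat.pow m n = m ^ n.
Proof. by elim: n => //= n ->; rewrite expnS. Qed.

Lemma divE x y : Nat.div x y = x %/ y.
Proof.
case: y => [|y]; first by rewrite divn0.
apply/esym/(Nat.div_unique _ _ _ (x %% y.+1)).
  by apply/ltP; rewrite ltn_mod.
by rewrite {1}(divn_eq x y.+1) mulnC.
Qed.

Lemma modE x y : Nat.modulo x y = x %% y.
Proof.
case: y => [|y]; first by rewrite modn0.
apply/esym/(Nat.mod_unique _ _ (x %/ y.+1)).
  by apply/ltP; rewrite ltn_mod.
by rewrite {1}(divn_eq x y.+1) mulnC.
Qed.

Lemma testbitE x k : Nat.testbit x k = odd (x %/ 2 ^ k).
Proof.
rewrite Nat.testbit_eqb pow_expn divE modE.
by rewrite modn2; case: odd.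
Qed.

Lemma testbit_ge n x k : x < 2 ^ n -> n <= k -> Nat.testbit x k = false.
Proof.
move=> xn nk; rewrite testbitE divn_small //.
by apply: leq_trans xn _; rewrite leq_exp2l.
Qed.

Lemma testbit_lt n x :
  (forall k, n <= k -> Nat.testbit x k = false) -> x < 2 ^ n.
Proof.
move=> H; case: (posnP x) => [-> | x0]; first by rewrite expn_gt0.
have hx : 2 ^ trunc_log 2 x <= x < 2 ^ (trunc_log 2 x).+1.
  exact: trunc_log_bounds.
case: (leqP n (trunc_log 2 x)) => [le | lt].
  have := H _ le; rewrite testbitE.
  have -> : x %/ 2 ^ trunc_log 2 x = 1; last by [].
  apply/eqP; rewrite eqn_leq -ltnS ltn_divLR ?expn_gt0 // -expnS.
  by rewrite divn_gt0 ?expn_gt0 // andbC.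
by case/andP: hx => _ h; apply: leq_trans h _; rewrite leq_exp2l.
Qed.

Lemma lor_lt n x y : x < 2 ^ n -> y < 2 ^ n -> Nat.lor x y < 2 ^ n.
Proof.
move=> hx hy; apply: testbit_lt => k nk.
by rewrite Nat.lor_spec (testbit_ge hx nk) (testbit_ge hy nk).
Qed.

Lemma lxor_lt n x y : x < 2 ^ n -> y < 2 ^ n -> Nat.lxor x y < 2 ^ n.
Proof.
move=> hx hy; apply: testbit_lt => k nk.
by rewrite Nat.lxor_spec (testbit_ge hx nk) (testbit_ge hy nk).
Qed.

Lemma eval_opE w (o : binop) (x y : word w) :
  binsafe w o x y -> eval_op o x y = binval o x y :> nat.
Proof.
have [hx hy] := (ltn_ord x, ltn_ord y).
case: o => /= h; try by rewrite modn_small.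
- have -> : x + (2 ^ w - y) = x - y + 2 ^ w by lia.
  by rewrite modnDr modn_small // (leq_ltn_trans (leq_subr _ _)).
- by rewrite modn_small // (leq_ltn_trans (leq_div _ _)).
- by rewrite modn_small // (leq_ltn_trans (land_le _ _)).
- by rewrite modn_small // lor_lt.
- by rewrite modn_small // lxor_lt.
- by rewrite modn_small // (leq_ltn_trans (leq_div _ _)).
Qed.

(** * Correctness of the compiler *)

Section Compiler.
Variables (w : nat) (ok : pred nat) (P : program).

Definition agree (st : state w) (r M : store) : Prop :=
  (forall x, x < tmp -> reg st x = r x :> nat) /\
  (forall a : word w, Defs.mem st a = M a :> nat).

Definition code_at (o : nat) (p : program) : Prop :=
  forall i, i < size p -> onth P (o + i) = onth p i.

Inductive reach : state w -> nat -> state w -> Prop :=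
  | ReachRefl st : reach st 0 st
  | ReachStep st t st' : pc st < size P ->
      (forall b : word w, ~~ ok b -> Defs.mem (step P st) b = Defs.mem st b) ->
      reach (step P st) t st' -> reach st t.+1 st'.

Lemma reach_trans st1 t1 st2 t2 st3 :
  reach st1 t1 st2 -> reach st2 t2 st3 -> reach st1 (t1 + t2) st3.
Proof.
elim=> // st t st' h1 h2 _ IH /IH h; rewrite addSn.
by apply: ReachStep h1 h2 h.
Qed.

Lemma reach_run st t st' : reach st t st' ->
  [/\ run P t st = st', forall t', t' < t -> pc (run P t' st) < size P &
    forall t' (b : word w), t' <= t -> ~~ ok b ->
      Defs.mem (run P t' st) b = Defs.mem st b].
Proof.
elim=> [{}st | {}st {}t {}st' h1 h2 _ [IH1 IH2 IH3]].
  by split=> // t' b; rewrite leqn0 => /eqP->.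
split=> [| [|t'] // | [|t'] // b tt' nb]; rewrite /run iterSr //.
- by move=> tt'; apply: IH2.
- by rewrite IH3 // h2.
Qed.

Lemma code_at_cat o p1 p2 :
  code_at o (p1 ++ p2) <-> code_at o p1 /\ code_at (o + size p1) p2.
Proof.
split=> [H | [H1 H2] i].
  split=> i hi.
    by rewrite H ?size_cat ?ltn_addr // onth_cat hi.
  by rewrite -addnA H ?size_cat ?ltn_add2l // onth_cat ltnNge leq_addr /= addKn.
rewrite size_cat onth_cat => hi; case: ltnP => h; first exact: H1.
by rewrite -H2 ?ltn_subLR // -addnA subnKC.
Qed.

Lemma code_at_cons o i p :
  code_at o (i :: p) <-> onth P o = Some i /\ code_at o.+1 p.
Proof.
split=> [H | [H1 H2] [|j] hj]; last by rewrite addnS -addSn H2.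
  by split=> [|j hj]; [have := H 0 isT; rewrite addn0 | rewrite addSnnS H].
by rewrite addn0.
Qed.

Lemma onth_lt o i : onth P o = Some i -> o < size P.
Proof. by move=> h; rewrite -onthTE h. Qed.

Lemma stepE (st : state w) i :
  onth P (pc st) = Some i -> step P st = exec i st.
Proof. by rewrite /step => ->. Qed.

(* Temporaries below tmp + d are preserved. *)
Lemma comp_e_ok e d o (st : state w) r M :
  wf_e e -> code_at o (comp_e d e) -> pc st = o -> agree st r M ->
  safe w e r M ->
  exists st', [/\ reach st (size (comp_e d e)) st',
    pc st' = o + size (comp_e d e), agree st' r M,
    reg st' (tmp + d) = ev w e r M :> nat &
    forall x, x < tmp + d -> reg st' x = reg st x].
Proof.
elim: e d o st => [n | | x | p a IHa b IHb | a IHa] d o st /= wfe.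
- move=> /code_at_cons[h _] pcE [ag1 ag2] sf.
  rewrite -pcE in h; have := stepE h; case: st pcE ag1 ag2 h => /= p r0 M0 -> ag1 ag2 h hs.
  eexists; split; first apply: ReachStep (ReachRefl _).
  + exact: onth_lt h.
  + by rewrite hs.
  + by rewrite hs /= addn1.
  + rewrite hs; split=> //= x hx; rewrite /upd; case: eqP hx => [-> | _]; last exact: ag1.
    by rewrite ltnNge leq_addr.
  + by rewrite hs /= /upd eqxx /= modn_small.
  + by rewrite hs /= => x hx; rewrite /upd; case: eqP hx => // ->; rewrite ltnn.
- move=> /code_at_cons[h1] /code_at_cons[h2] /code_at_cons[h3 _] pcE [ag1 ag2] _.
  case: st pcE ag1 ag2 => /= p r0 M0 -> ag1 ag2.
  have p2 : 0 < 2 ^ w by rewrite expn_gt0.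
  have s1 r1 : step P (State o r1 M0) = State o.+1 (upd r1 (tmp + d) (trunc w 0)) M0.
    by rewrite /step [pc _]/= h1.
  have s2 r1 : step P (State o.+1 r1 M0) = State o.+2 (upd r1 (tmp + d.+1) (trunc w 1)) M0.
    by rewrite /step [pc _]/= h2.
  have s3 r1 : step P (State o.+2 r1 M0) = State o.+3 (upd r1 (tmp + d)
      (eval_op Defs.Sub (r1 (tmp + d)) (r1 (tmp + d.+1)))) M0.
    by rewrite /step [pc _]/= h3.
  eexists; split.
  + apply: ReachStep; [exact: onth_lt h1 | by rewrite s1 |]; rewrite s1.
    apply: ReachStep; [exact: onth_lt h2 | by rewrite s2 |]; rewrite s2.
    apply: ReachStep; [exact: onth_lt h3 | by rewrite s3 |]; rewrite s3.
    exact: ReachRefl.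
  + by rewrite /= addn3.
  + split=> //= y hy; rewrite /upd.
    have /negbTE-> : y != tmp + d by lia.
    have /negbTE-> : y != tmp + d.+1 by lia.
    exact: ag1.
  + rewrite /= /upd !eqxx addnS.
    have /negbTE-> : tmp + d != (tmp + d).+1 by lia.
    rewrite /= mod0n add0n; case: (posnP w) => [-> | w0].
      by rewrite modn1.
    have w1 : 2 ^ 1 <= 2 ^ w by rewrite leq_exp2l.
    by rewrite (modn_small w1) modn_small //; lia.
  + move=> y hy /=; rewrite /upd.
    have /negbTE-> : y != tmp + d by lia.
    by have /negbTE-> : y != tmp + d.+1 by lia.
- move=> /code_at_cons[h _] pcE [ag1 ag2] _.
  rewrite -pcE in h; have := stepE h; case: st pcE ag1 ag2 h => /= p r0 M0 -> ag1 ag2 h hs.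
  eexists; split; first apply: ReachStep (ReachRefl _).
  + exact: onth_lt h.
  + by rewrite hs.
  + by rewrite hs /= addn1.
  + rewrite hs; split=> //= y hy; rewrite /upd; case: eqP hy => [-> | _]; last exact: ag1.
    by rewrite ltnNge leq_addr.
  + by rewrite hs /= /upd eqxx eval_opE //= Nat.lor_diag ag1.
  + by rewrite hs /= => y hy; rewrite /upd; case: eqP hy => // ->; rewrite ltnn.
- case/andP: wfe => wa wb /code_at_cat[ca] /code_at_cat[cb] /code_at_cons[h _] pcE ag /and3P[sa sb sp].
  have [st1 [re1 pc1 ag1 v1 f1]] := IHa _ _ _ wa ca pcE ag sa.
  have [st2 [re2 pc2 ag2 v2 f2]] := IHb _ _ _ wb cb pc1 ag1 sb.
  rewrite -pc2 in h; have := stepE h; case: st2 pc2 ag2 v2 f2 re2 h => /= p2 r2 M2 pc2 [ag2 ag2'] v2 f2 re2 h hs.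
  eexists; split.
  + rewrite !size_cat; apply: reach_trans re1 _; apply: reach_trans re2 _.
    by apply: ReachStep (ReachRefl _); [exact: onth_lt h | rewrite hs].
  + by rewrite hs /= pc2 !size_cat /= addn1 !addnS addnA.
  + rewrite hs; split=> //= y hy; rewrite /upd; case: eqP hy => [-> | _]; last exact: ag2.
    by rewrite ltnNge leq_addr.
  + rewrite hs /= /upd eqxx eval_opE v2 f2 ?v1 //; rewrite ?addnS //.
  + rewrite hs /= => y hy; rewrite /upd; case: eqP hy => [-> | _ hy]; first by rewrite ltnn.
    by rewrite f2 ?f1 // addnS ltnS ltnW.
- rewrite -cats1 => /code_at_cat[ca] /code_at_cons[h _] pcE ag sf.
  have [st1 [re1 pc1 ag1 v1 f1]] := IHa _ _ _ wfe ca pcE ag sf.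
  rewrite -pc1 in h; have := stepE h; case: st1 pc1 ag1 v1 f1 re1 h => /= p1 r1 M1 pc1 [ag1 ag1'] v1 f1 re1 h hs.
  eexists; split.
  + rewrite size_cat; apply: reach_trans re1 _.
    by apply: ReachStep (ReachRefl _); [exact: onth_lt h | rewrite hs].
  + by rewrite hs /= pc1 size_cat /= addn1 addnS.
  + rewrite hs; split=> //= y hy; rewrite /upd; case: eqP hy => [-> | _]; last exact: ag1.
    by rewrite ltnNge leq_addr.
  + by rewrite hs /= /upd eqxx -v1 ag1'.
  + rewrite hs /= => y hy; rewrite /upd; case: eqP hy => [-> | _ hy]; first by rewrite ltnn.
    exact: f1.
Qed.

Lemma comp_c_ok c l o (st : state w) r M :
  wf_c c -> code_at o (comp_c c l) -> pc st = o -> agree st r M ->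
  safec w c r M ->
  exists st', [/\ reach st (size (comp_c c l)) st',
    pc st' = (if evc w c r M then l else o + size (comp_c c l)) & agree st' r M].
Proof.
case: c => a b /= /andP[wa wb] /code_at_cat[ca] /code_at_cat[cb] /code_at_cons[h _] pcE ag /andP[sa sb].
- have [st1 [re1 pc1 ag1 v1 f1]] := comp_e_ok wa ca pcE ag sa.
  have [st2 [re2 pc2 ag2 v2 f2]] := comp_e_ok wb cb pc1 ag1 sb.
  rewrite -pc2 in h; have := stepE h; case: st2 pc2 ag2 v2 f2 re2 h => /= p2 r2 M2 pc2 [ag2 ag2'] v2 f2 re2 h hs.
  eexists; split.
  + rewrite !size_cat; apply: reach_trans re1 _; apply: reach_trans re2 _.
    by apply: ReachStep (ReachRefl _); [exact: onth_lt h | rewrite hs].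
  + rewrite hs /= pc2 !size_cat /= f2 //; move: v1 v2; rewrite addn0 addn1 => -> ->.
    by case: ifP => // _; rewrite addn1 !addnS addnA.
  + by rewrite hs.
- have [st1 [re1 pc1 ag1 v1 f1]] := comp_e_ok wa ca pcE ag sa.
  have [st2 [re2 pc2 ag2 v2 f2]] := comp_e_ok wb cb pc1 ag1 sb.
  rewrite -pc2 in h; have := stepE h; case: st2 pc2 ag2 v2 f2 re2 h => /= p2 r2 M2 pc2 [ag2 ag2'] v2 f2 re2 h hs.
  eexists; split.
  + rewrite !size_cat; apply: reach_trans re1 _; apply: reach_trans re2 _.
    by apply: ReachStep (ReachRefl _); [exact: onth_lt h | rewrite hs].
  + rewrite hs /= pc2 !size_cat /= f2 //; move: v1 v2; rewrite addn0 addn1 => <- <-.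
    by rewrite -val_eqE; case: ifP => // _; rewrite addn1 !addnS addnA.
  + by rewrite hs.
Qed.

Lemma goto_ok l (st : state w) r M :
  onth P (pc st) = Some (goto l) -> agree st r M ->
  exists st', [/\ reach st 1 st', pc st' = l & agree st' r M].
Proof.
move=> h ag; have hs := stepE h; case: st h ag hs => /= p r0 M0 h ag hs.
eexists; split; first apply: ReachStep (ReachRefl _).
- exact: onth_lt h.
- by rewrite hs.
- by rewrite hs /= eqxx.
- by rewrite hs.
Qed.

Lemma comp_ok c r M t r' M' : bs w ok c r M t r' M' ->
  forall K o (st : state w), wf c -> code_at o (comp o c) ->
  size (comp o c) < K -> pc st = o -> agree st r M ->
  exists T st', [/\ reach st T st', T <= K * t, pc st' = o + size (comp o c) &
    agree st' r' M'].
Proof.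
elim=> {c r M t r' M'}.
- move=> r M K o st _ _ _ pcE ag.
  by exists 0, st; split; rewrite ?addn0 //; apply: ReachRefl.
- move=> x e r M sf K o st /= /andP[wx we]; rewrite -cats1 => /code_at_cat[ce] /code_at_cons[h _] szK pcE ag.
  have [st1 [re1 pc1 ag1 v1 f1]] := comp_e_ok we ce pcE ag sf.
  rewrite -pc1 in h; have := stepE h; case: st1 pc1 ag1 v1 f1 re1 h => /= p1 r1 M1 pc1 [ag1 ag1'] v1 f1 re1 h hs.
  eexists _, _; split.
  + apply: reach_trans re1 _.
    by apply: ReachStep (ReachRefl _); [exact: onth_lt h | rewrite hs].
  + by rewrite muln1 addn1 ltnW //; move: szK; rewrite size_cat addn1.
  + by rewrite hs /= pc1 size_cat /= addn1 addnS.
  + rewrite hs; split=> //= y hy; rewrite /upd /put; case: eqP => [_ | _]; last exact: ag1.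
    by rewrite eval_opE //= Nat.lor_diag -v1 addn0.
- move=> a e r M sa se oka K o st /= /andP[wa we] /code_at_cat[ca] /code_at_cat[ce] /code_at_cons[h _] szK pcE ag.
  have [st1 [re1 pc1 ag1 v1 f1]] := comp_e_ok wa ca pcE ag sa.
  have [st2 [re2 pc2 ag2 v2 f2]] := comp_e_ok we ce pc1 ag1 se.
  rewrite -pc2 in h; have := stepE h; case: st2 pc2 ag2 v2 f2 re2 h => /= p2 r2 M2 pc2 [ag2 ag2'] v2 f2 re2 h hs.
  have {}v1 : r2 tmp = ev w a r M :> nat by rewrite f2 // -v1 addn0.
  eexists _, _; split.
  + apply: reach_trans re1 _; apply: reach_trans re2 _.
    apply: ReachStep (ReachRefl _); [exact: onth_lt h | rewrite hs /= => b nb].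
    by rewrite /upd; case: eqP nb => // ->; rewrite v1 oka.
  + by rewrite muln1 ltnW //; move: szK; rewrite !size_cat.
  + by rewrite hs /= pc2 !size_cat /= addn1 !addnS addnA.
  + rewrite hs; split=> //= b; rewrite /upd /put -val_eqE /= v1; by case: eqP.
- move=> c1 c2 r M t1 r1 M1 t2 r2 M2 _ IH1 _ IH2 K o st /= /andP[w1 w2] /code_at_cat[h1 h2].
  rewrite size_cat => szK pcE ag.
  have [|T1 [st1 [re1 le1 pc1 ag1]]] := IH1 K _ _ w1 h1 _ pcE ag.
    by apply: leq_ltn_trans szK; apply: leq_addr.
  have [|T2 [st2 [re2 le2 pc2 ag2]]] := IH2 K _ _ w2 h2 _ pc1 ag1.
    by apply: leq_ltn_trans szK; apply: leq_addl.
  exists (T1 + T2), st2; split=> //; first exact: reach_trans re1 re2.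
    by rewrite mulnDr leq_add.
  by rewrite pc2 addnA.
- move=> c c1 c2 r M t r1 M1 sf _ IH K o st /= /and3P[wc w1 w2].
  set s := size (comp_c c 0); set p2 := comp (o + s) c2.
  set o1 := o + s + (size p2).+1; set p1 := comp o1 c1.
  have sE l : size (comp_c c l) = s by apply: size_comp_c.
  move=> /code_at_cat[cc]; rewrite sE => /code_at_cat[h2] /code_at_cons[hg h1].
  rewrite !size_cat /= sE => szK pcE ag.
  have [st1 [re1 pc1 ag1]] := comp_c_ok wc cc pcE ag sf; rewrite sE in re1 pc1.
  case: (evc w c r M) pc1 IH => pc1 IH.
  + have h1' : code_at o1 p1 by rewrite /o1 addnS.
    have [|T2 [st2 [re2 le2 pc2 ag2]]] := IH K _ _ w1 h1' _ pc1 ag1.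
      by rewrite -/p1; lia.
    exists (s + T2), st2; split=> //; first exact: reach_trans re1 re2.
      by rewrite mulnS leq_add // ltnW // (leq_ltn_trans _ szK) // leq_addr.
    by rewrite pc2 /o1 -/p1; lia.
  + have [|T2 [st2 [re2 le2 pc2 ag2]]] := IH K _ _ w2 h2 _ pc1 ag1.
      by rewrite -/p2; lia.
    have [|st3 [re3 pc3 ag3]] := goto_ok (l := o1 + size p1) _ ag2; first by rewrite pc2.
    exists (s + (T2 + 1)), st3; split=> //.
      by apply: reach_trans re1 _; apply: reach_trans re2 re3.
      by rewrite mulnS; lia.
    by rewrite pc3 /o1; lia.
- move=> c c1 r M t1 r1 M1 t2 r2 M2 sf cT _ IH1 _ IH2 K o st /= wf1.
  move=> cat szK pcE ag.
  have := cat; have /andP[wc w1] := wf1.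
  set s := size (comp_c c 0); set p1 := comp (o + s.+1) c1.
  have sE l : size (comp_c c l) = s by apply: size_comp_c.
  move=> /code_at_cat[cc]; rewrite sE => /code_at_cons[hg]; rewrite -cats1 => /code_at_cat[h1] /code_at_cons[hg' _].
  have [st1 [re1 pc1 ag1]] := comp_c_ok wc cc pcE ag sf; rewrite sE cT in re1 pc1.
  have szE : size (comp_c c (o + s.+1) ++ goto (o + s.+1 + (size p1).+1) :: rcons p1 (goto o)) = s + (size p1).+2.
    by rewrite size_cat /= size_rcons sE.
  rewrite -addnS in h1.
  have [|T1 [st2 [re2 le2 pc2 ag2]]] := IH1 (K - s - 2) _ _ w1 h1 _ pc1 ag1.
    by move: szK; rewrite szE -/p1; lia.
  have [|st3 [re3 pc3 ag3]] := goto_ok (l := o) _ ag2; first by rewrite -hg' pc2 -/p1; congr onth; lia.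
  have [T2 [st4 [re4 le4 pc4 ag4]]] := IH2 K o st3 wf1 cat szK pc3 ag3.
  exists (s + (T1 + (1 + T2))), st4; split=> //.
    by apply: reach_trans re1 _; apply: reach_trans re2 _; apply: reach_trans re3 re4.
  have : T1 <= K * t1 by apply: leq_trans le2 _; rewrite leq_mul2r; lia.
    by move: szK; rewrite szE mulnS mulnDr; lia.
  by rewrite pc4 /= cats1.
- move=> c c1 r M sf cF K o st /= /andP[wc w1].
  set s := size (comp_c c 0); set p1 := comp (o + s.+1) c1.
  have sE l : size (comp_c c l) = s by apply: size_comp_c.
  move=> /code_at_cat[cc]; rewrite sE => /code_at_cons[hg _].
  rewrite size_cat /= size_rcons sE => szK pcE ag.
  have [st1 [re1 pc1 ag1]] := comp_c_ok wc cc pcE ag sf; rewrite sE (negbTE cF) in re1 pc1.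
  have [|st3 [re3 pc3 ag3]] := goto_ok (l := o + s.+1 + (size p1).+1) _ ag1; first by rewrite pc1.
  exists (s + 1), st3; split=> //; first exact: reach_trans re1 re3.
    by rewrite muln1; lia.
  by rewrite pc3; lia.
Qed.

End Compiler.

Lemma compile_correct w (a len : nat) c r M t r' M' (st : state w) :
  wf c -> bs w (fun b => a <= b < a + len) c r M t r' M' ->
  pc st = 0 -> agree st r M ->
  exists T st', [/\ halts_in (comp 0 c) st T st', T <= (size (comp 0 c)).+1 * t,
    agree st' r' M' & confined (comp 0 c) st a len].
Proof.
move=> wfc h pc0 ag.
have cat : code_at (comp 0 c) 0 (comp 0 c) by move=> i.
have [T [st' [re le pcE ag']]] := comp_ok h wfc cat (ltnSn _) pc0 ag.
have [h1 h2 h3] := reach_run re.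
have hlt : halted (comp 0 c) st' by rewrite /halted pcE.
exists T, st'; split=> //.
  by split=> // t' /h2; rewrite /halted -ltnNge.
move=> t' b nb; case: (leqP t' T) => [le' | lt]; first exact: h3.
rewrite -(subnK (ltnW lt)) /run iterD -[iter T _ _]/(run _ T st) h1.
have -> : iter (t' - T) (step (comp 0 c)) st' = st'.
  elim: (t' - T) => //= k ->.
  by rewrite /step; case E: onth => [i|] //; move: (onth_lt E); rewrite ltnNge -/(halted _ _) hlt.
by have := h3 _ _ (leqnn _) nb; rewrite h1.
Qed.


(** * Weakest preconditions *)

Definition assertion := nat -> store -> store -> Prop.

Definition For (x : nat) (e : expr) (c : cmd) : cmd :=
  Seq (Assign x (Lit 0))
    (While (Lt (Var x) e) (Seq c (Assign x (Bin Add (Var x) (Lit 1))))).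

Fixpoint writes (c : cmd) : seq nat :=
  match c with
  | Skip | Put _ _ => [::]
  | Assign x _ => [:: x]
  | Seq c1 c2 | If _ c1 c2 => writes c1 ++ writes c2
  | While _ c1 => writes c1
  end.

Definition keeps (ws : seq nat) (r r' : store) : Prop :=
  forall x, x \notin ws -> r' x = r x.

Fixpoint pure (c : cmd) : bool :=
  match c with
  | Put _ _ => false
  | Seq c1 c2 | If _ c1 c2 => pure c1 && pure c2
  | While _ c1 => pure c1
  | _ => true
  end.

Definition store_at : store -> nat -> nat -> store := put.

Section WP.
Variables (w : nat) (ok : pred nat).
Implicit Types (Q : assertion) (r M : store).

Definition wp c Q r M : Prop :=
  exists t r' M', bs w ok c r M t r' M' /\ Q t r' M'.

Definition outside M M' : Prop := forall a, ~~ ok a -> M' a = M a.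

Lemma bs_frame c r M t r' M' : bs w ok c r M t r' M' ->
  [/\ keeps (writes c) r r', outside M M' & pure c -> M' = M].
Proof.
elim=> {c r M t r' M'} //=.
- by move=> x e r M _; split=> // y; rewrite inE /put => /negbTE->.
- move=> a e r M _ _ oka; split=> // b; rewrite /put; case: eqP => // ->.
  by rewrite oka.
- move=> c1 c2 r M t1 r1 M1 t2 r2 M2 _ [k1 o1 p1] _ [k2 o2 p2].
  split=> [x | a na | /andP[/p1 <- /p2 //]]; last by rewrite o2 ?o1.
  by rewrite mem_cat negb_or => /andP[h1 h2]; rewrite k2 ?k1.
- move=> c c1 c2 r M t r1 M1 _ _ [k o p].
  split=> [x | // | /andP[pu1 pu2]]; last by apply: p; case: evc.
  by rewrite mem_cat negb_or => /andP[h1 h2]; apply: k; case: evc.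
- move=> c c1 r M t1 r1 M1 t2 r2 M2 _ _ _ [k1 o1 p1] _ [k2 o2 p2].
  split=> [x h | a na | pu]; first by rewrite k2 ?k1.
    by rewrite o2 ?o1.
  by rewrite p2 ?p1.
Qed.

Lemma wp_conseq c Q Q' r M : wp c Q r M ->
  (forall t r' M', keeps (writes c) r r' -> outside M M' ->
    (pure c -> M' = M) -> Q t r' M' -> Q' t r' M') -> wp c Q' r M.
Proof.
case=> t [r' [M' [h q]]] imp; exists t, r', M'; split=> //.
by have [k o p] := bs_frame h; apply: imp.
Qed.

Lemma wp_skip Q r M : Q 0 r M -> wp Skip Q r M.
Proof. by move=> q; exists 0, r, M; split=> //; apply: BsSkip. Qed.

Lemma wp_assign x e Q r M :
  safe w e r M -> Q 1 (put r x (ev w e r M)) M -> wp (Assign x e) Q r M.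
Proof.
by move=> s q; exists 1, (put r x (ev w e r M)), M; split=> //; apply: BsAssign.
Qed.

Lemma wp_put a e Q r M : safe w a r M -> safe w e r M -> ok (ev w a r M) ->
  Q 1 r (store_at M (ev w a r M) (ev w e r M)) -> wp (Put a e) Q r M.
Proof. by move=> s1 s2 o q; do 3!eexists; split; first exact: BsPut. Qed.

Lemma wp_seq c1 c2 Q r M :
  wp c1 (fun t1 r1 M1 => wp c2 (fun t2 r2 M2 => Q (t1 + t2) r2 M2) r1 M1) r M ->
  wp (Seq c1 c2) Q r M.
Proof.
move=> [t1 [r1 [M1 [h1 [t2 [r2 [M2 [h2 q]]]]]]]].
by exists (t1 + t2), r2, M2; split=> //; apply: BsSeq h1 h2.
Qed.

Lemma wp_if c c1 c2 Q r M : safec w c r M ->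
  (evc w c r M -> wp c1 (fun t => Q t.+1) r M) ->
  (~~ evc w c r M -> wp c2 (fun t => Q t.+1) r M) ->
  wp (If c c1 c2) Q r M.
Proof.
move=> s hT hF; case E: (evc w c r M).
  have [t [r1 [M1 [h q]]]] := hT E; exists t.+1, r1, M1; split=> //.
  by apply: BsIf => //; rewrite E.
have [|t [r1 [M1 [h q]]]] := hF _; first by rewrite E.
by exists t.+1, r1, M1; split=> //; apply: BsIf => //; rewrite E.
Qed.

(* The first argument of the invariant bounds the number of iterations left,
   the second is the time spent. *)
Lemma wp_while (I : nat -> assertion) c c1 Q r0 M0 :
  (exists k, I k 0 r0 M0) ->
  (forall k t r M, I k t r M -> keeps (writes c1) r0 r -> outside M0 M ->
    (pure c1 -> M = M0) ->
    [/\ safec w c r M,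
      evc w c r M -> 0 < k /\ wp c1 (fun t' => I k.-1 (t + t').+1) r M &
      ~~ evc w c r M -> Q t.+1 r M]) ->
  wp (While c c1) Q r0 M0.
Proof.
move=> [k h] step.
have gen : forall t r M, I k t r M -> keeps (writes c1) r0 r ->
    outside M0 M -> (pure c1 -> M = M0) ->
    wp (While c c1) (fun t' => Q (t + t')) r M; last exact: gen h _ _ _.
elim: k {h} => [|k IH] t r M h kp o p; have [s hT hF] := step _ _ _ _ h kp o p.
  have E : ~~ evc w c r M by apply/negP => /hT[].
  exists 1, r, M; split; first exact: BsWhileF.
  by rewrite addn1; apply: hF.
case E: (evc w c r M); last first.
  exists 1, r, M; split; first by apply: BsWhileF; rewrite ?E.
  by rewrite addn1; apply: hF; rewrite E.
have [_ [t1 [r1 [M1 [h1 i1]]]]] := hT E.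
have [k1 o1 p1] := bs_frame h1.
have [|||t2 [r2 [M2 [h2 q]]]] := IH _ _ _ i1.
- by move=> x hx; rewrite k1 ?kp.
- by move=> a ha; rewrite o1 ?o.
- by move=> pu; rewrite p1 ?p.
exists (t1 + t2).+1, r2, M2; split; first exact: BsWhileT h2.
by rewrite addnS addnA -addSn.
Qed.

Lemma wp_for (n : nat) (I : nat -> assertion) x e c Q r0 M0 :
  n < 2 ^ w -> 0 < w ->
  I 0 0 (put r0 x 0) M0 ->
  (forall k t r M, I k t r M -> k <= n -> r x = k ->
     keeps (x :: writes c) r0 r -> outside M0 M -> (pure c -> M = M0) ->
     [/\ safe w e r M, ev w e r M = n &
       k < n -> wp c (fun t' r' M' =>
         r' x = k /\ I k.+1 (t + t' + 2) (put r' x k.+1) M') r M]) ->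
  (forall t r M, I n t r M -> r x = n ->
     keeps (x :: writes c) r0 r -> outside M0 M -> (pure c -> M = M0) ->
     Q t.+2 r M) ->
  wp (For x e c) Q r0 M0.
Proof.
move=> nw w0 i0 step fin.
have w1 : 1 < 2 ^ w by rewrite -(expn0 2) ltn_exp2l.
apply: wp_seq; apply: wp_assign => /=; first exact: ltnW.
apply: (@wp_while (fun k t r M => [/\ k <= n, r x = n - k & I (n - k) t r M])).
  by exists n; split; rewrite ?subnn // /put eqxx.
move=> k t r M [kn rx ik] kp o p.
have kp' : keeps (x :: writes c) r0 r.
  move=> y; rewrite inE negb_or => /andP[yx yc].
  by rewrite kp /= ?mem_cat ?inE ?negb_or ?yc // /put (negbTE yx).
have p' : pure c -> M = M0 by move=> pc; apply: p; rewrite /= pc.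
have [s ee hs] := step _ _ _ _ ik (leq_subr _ _) rx kp' o p'.
split=> /=; first by rewrite s.
  rewrite rx ee => lt; have k0 : 0 < k by lia.
  split=> //; apply: wp_seq.
  have [t1 [r1 [M1 [h1 [rx1 i1]]]]] := hs lt.
  exists t1, r1, M1; split=> //; apply: wp_assign => /=.
    by rewrite w1 rx1 /= addn1; apply: leq_ltn_trans nw.
  rewrite rx1 addn1; have -> : n - k.-1 = (n - k).+1 by lia.
  split; [lia | by rewrite /put eqxx |].
  by have -> : (t + (t1 + 1)).+1 = t + t1 + 2 by lia.
rewrite rx ee -leqNgt => le; have k0 : n - k = n by lia.
by rewrite k0 in ik rx; rewrite add1n; apply: fin ik rx kp' o p'.
Qed.

End WP.


(** * Words packed with equally wide fields *)

Definition packed (n g : nat) (f : nat -> nat) : nat :=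
  \sum_(k < n) f k * 2 ^ (g * k).

Lemma testbit_split g a b k : a < 2 ^ g ->
  Nat.testbit (a + 2 ^ g * b) k =
  if k < g then Nat.testbit a k else Nat.testbit b (k - g).
Proof.
move=> ha; rewrite !testbitE; case: ltnP => h.
  have gE : g = k + (g - k).-1.+1 by lia.
  have -> : a + 2 ^ g * b = (2 ^ (g - k).-1 * b).*2 * 2 ^ k + a.
    by rewrite {1}gE expnD expnS -mul2n addnC; congr (_ + _); nia.
  by rewrite divnMDl ?expn_gt0 // oddD odd_double.
have kE : k = g + (k - g) by lia.
rewrite {1}kE expnD divnMA; have -> // : (a + 2 ^ g * b) %/ 2 ^ g = b.
by rewrite addnC mulnC divnMDl ?expn_gt0 // divn_small // addn0.
Qed.

Section BitOp.
Variables (op : nat -> nat -> nat) (ob : bool -> bool -> bool).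
Hypothesis op_spec :
  forall x y k, Nat.testbit (op x y) k = ob (Nat.testbit x k) (Nat.testbit y k).
Hypothesis ob0 : ob false false = false.

Lemma bitop_lt n x y : x < 2 ^ n -> y < 2 ^ n -> op x y < 2 ^ n.
Proof.
move=> hx hy; apply: testbit_lt => k nk.
by rewrite op_spec (testbit_ge hx nk) (testbit_ge hy nk).
Qed.

Lemma bitop_split g a b c d : a < 2 ^ g -> c < 2 ^ g ->
  op (a + 2 ^ g * b) (c + 2 ^ g * d) = op a c + 2 ^ g * op b d.
Proof.
move=> ha hc; apply: Nat.bits_inj => k.
rewrite op_spec !testbit_split ?bitop_lt //.
by case: ifP; rewrite op_spec.
Qed.

Lemma packed_bitop n g f h :
  (forall k, k < n -> f k < 2 ^ g) -> (forall k, k < n -> h k < 2 ^ g) ->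
  op (packed n g f) (packed n g h) = packed n g (fun k => op (f k) (h k)).
Proof.
have shift m F : packed m.+1 g F = F 0 + 2 ^ g * packed m g (fun k => F k.+1).
  rewrite /packed big_ord_recl muln0 muln1; congr (_ + _).
  rewrite big_distrr; apply: eq_bigr => i _ /=.
  by rewrite /bump add1n mulnS expnD mulnCA.
elim: n f h => [|n IH] f h hf hh.
  rewrite /packed !big_ord0; apply: Nat.bits_inj => k.
  by rewrite op_spec Nat.bits_0 ob0.
rewrite !shift bitop_split ?hf ?hh // IH // => k hk; by [apply: hf | apply: hh].
Qed.

End BitOp.

Definition packed_land := packed_bitop Nat.land_spec (erefl : false && false = _).
Definition packed_lxor := packed_bitop Nat.lxor_spec (erefl : xorb false false = _).
Definition packed_lor := packed_bitop Nat.lor_spec (erefl : false || false = _).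

Lemma packedS n g f : packed n.+1 g f = packed n g f + f n * 2 ^ (g * n).
Proof. by rewrite /packed big_ord_recr. Qed.

Lemma eq_packed n g f h :
  (forall k, k < n -> f k = h k) -> packed n g f = packed n g h.
Proof. by move=> e; apply: eq_bigr => i _; rewrite e. Qed.

Lemma packed_lt n g f : (forall k, k < n -> f k < 2 ^ g) ->
  packed n g f < 2 ^ (g * n).
Proof.
elim: n => [|n IH] h; first by rewrite /packed big_ord0 muln0.
rewrite packedS mulnS expnD.
have h1 := IH (fun k hk => h k (ltnW hk)).
have h2 : f n * 2 ^ (g * n) <= (2 ^ g).-1 * 2 ^ (g * n).
  by rewrite leq_mul2r -ltnS prednK ?expn_gt0 // h ?orbT.
have : 2 ^ g * 2 ^ (g * n) = (2 ^ g).-1 * 2 ^ (g * n) + 2 ^ (g * n).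
  by rewrite -mulSnr prednK ?expn_gt0.
lia.
Qed.

Lemma packed_add n g f h :
  packed n g f + packed n g h = packed n g (fun k => f k + h k).
Proof. by rewrite /packed -big_split; apply: eq_bigr => i _; rewrite mulnDl. Qed.

Lemma packed_sub n g f h : (forall k, k < n -> h k <= f k) ->
  packed n g f - packed n g h = packed n g (fun k => f k - h k).
Proof.
move=> le; rewrite -[packed n g f]/(packed n g (fun k => f k)).
rewrite (@eq_packed _ _ f (fun k => (f k - h k) + h k)).
  by rewrite -packed_add addnK.
by move=> k hk; rewrite subnK ?le.
Qed.

Lemma packed_mull c n g f : c * packed n g f = packed n g (fun k => c * f k).
Proof. by rewrite /packed big_distrr; apply: eq_bigr => i _ /=; rewrite mulnA. Qed.

Lemma packed_upd n g f k0 d : k0 < n ->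
  packed n g (fun k => f k + (k == k0) * d) = packed n g f + d * 2 ^ (g * k0).
Proof.
move=> lt; rewrite -packed_add; congr (_ + _).
rewrite /packed (bigD1 (Ordinal lt)) //= eqxx mul1n big1 ?addn0 // => i /eqP ne.
by case: eqP => // e; case: ne; apply: val_inj.
Qed.

Lemma packed_digit n g f k : (forall j, j < n -> f j < 2 ^ g) -> k < n ->
  (packed n g f %/ 2 ^ (g * k)) %% 2 ^ g = f k.
Proof.
elim: n => // n IH h; rewrite packedS ltnS leq_eqVlt => /orP[/eqP-> | lt].
  rewrite addnC divnMDl ?expn_gt0 // divn_small ?addn0 ?modn_small ?h //.
  by apply: packed_lt => j hj; apply: h; apply: ltnW.
have -> : g * n = g * k + (g + g * (n - k.+1)).
  by rewrite -mulnS -mulnDr; congr (g * _); lia.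
rewrite [_ ^ (g * k + _)]expnD mulnCA addnC mulnC divnMDl ?expn_gt0 //.
rewrite [2 ^ (g + _)]expnD mulnCA [2 ^ g * _]mulnC modnMDl IH //.
by move=> j hj; apply: h; apply: ltnW.
Qed.

Lemma packed_nest V b g f :
  packed V (b * g) (fun s => packed b g (f s)) =
  packed (V * b) g (fun k => f (k %/ b) (k %% b)).
Proof.
case: (posnP b) => [-> | b0].
  by rewrite muln0 /packed big_ord0 big1 // => i _; rewrite big_ord0.
elim: V => [|V IH]; first by rewrite mul0n /packed !big_ord0.
rewrite packedS IH mulSnr /packed big_split_ord /=; congr (_ + _).
rewrite big_distrl; apply: eq_bigr => i _ /=.
rewrite divnMDl // divn_small // addn0 modnMDl modn_small //.
by rewrite -mulnA -expnD; congr (_ * _ ^ _); lia.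
Qed.

Lemma packed_ones n g : 0 < g ->
  packed n g (fun=> 1) = (2 ^ (g * n)).-1 %/ (2 ^ g).-1.
Proof.
move=> g0; have g1 : 0 < (2 ^ g).-1.
  by rewrite -ltnS prednK ?expn_gt0 // -{1}(expn0 2) ltn_exp2l.
apply/eqP; rewrite eqn_div //; last first.
  by rewrite expnM [X in _ %| X]predn_exp dvdn_mulr.
elim: n => [|n IH]; first by rewrite /packed big_ord0 muln0.
move/eqP: IH; rewrite packedS mul1n mulnDl mulnS expnD => ->.
have := expn_gt0 2 g; have := expn_gt0 2 (g * n).
by set a := 2 ^ g; set b := 2 ^ (g * n) => /=; nia.
Qed.

Lemma land_pow2 P y : y < 2 ^ P -> Nat.land (2 ^ P + y) (2 ^ P) = 2 ^ P.
Proof.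
move=> h; rewrite -{1 2}[2 ^ P]muln1 addnC -{2}[2 ^ P * 1]add0n.
rewrite (bitop_split Nat.land_spec (erefl : false && false = _)) ?expn_gt0 //.
by rewrite Nat.land_0_r muln1.
Qed.

Lemma land_pow2_lt P y : y < 2 ^ P -> Nat.land y (2 ^ P) = 0.
Proof.
move=> h; rewrite -[2 ^ P]muln1 -[_ * 1]add0n -[y]addn0 -{1}[0](muln0 (2 ^ P)).
rewrite (bitop_split Nat.land_spec (erefl : false && false = _)) ?expn_gt0 //.
by rewrite Nat.land_0_r muln0.
Qed.

Section Match.
Variables (Q b g G : nat).
Hypotheses (g0 : 0 < g) (GE : G = b * g + 1).

Let hi := 2 ^ g.-1.

Definition field_tops :=
  packed Q G (fun=> packed b g (fun=> hi)).
Definition block_tops := packed Q G (fun=> 2 ^ G.-1).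
Definition block_fill := packed Q G (fun=> (2 ^ G.-1).-1).

Definition match_word (x y : nat) : nat :=
  Nat.land (Nat.land (field_tops - Nat.lxor x y) field_tops + block_fill)
    block_tops.

(* Where two fields agree their xor is 0, and only then does subtracting it
   from the top bit of the field leave that bit set.  Adding 2^(G-1) - 1 to a
   block then carries into its spare top bit iff some field is marked. *)
Lemma match_wordE fa fb :
  (forall k q, k < Q -> q < b -> fa k q < hi) ->
  (forall k q, k < Q -> q < b -> fb k q < hi) ->
  match_word (packed Q G (fun k => packed b g (fa k)))
    (packed Q G (fun k => packed b g (fb k))) =
  packed Q G (fun k => has (fun q => fa k q == fb k q) (iota 0 b) * 2 ^ G.-1).
Proof.
move=> ha hb.
have gG : 2 ^ g = hi + hi by rewrite -(prednK g0) expnS mul2n -addnn.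
have hi0 : 0 < hi by rewrite expn_gt0.
have G1 : G.-1 = g * b by rewrite GE addn1 mulnC.
have GG : 2 ^ G = 2 ^ G.-1 + 2 ^ G.-1 by rewrite GE addn1 expnS mul2n -addnn.
have blk f : (forall q, q < b -> f q < 2 ^ g) -> packed b g f < 2 ^ G.-1.
  by move=> hf; rewrite G1; apply: packed_lt.
have blk' f : (forall q, q < b -> f q < 2 ^ g) -> packed b g f < 2 ^ G.
  by move/blk=> h; rewrite GG; lia.
have lx k q : k < Q -> q < b -> Nat.lxor (fa k q) (fb k q) < hi.
  by move=> hk hq; apply: lxor_lt; [apply: ha | apply: hb].
rewrite /match_word /field_tops packed_lxor; try by
  move=> k hk; apply: blk' => q hq; rewrite gG ltn_addr // ?ha ?hb.
rewrite [X in _ - X](@eq_packed _ _ _ (fun k => packed b g (fun q => Nat.lxor (fa k q) (fb k q)))); last first.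
  by move=> k hk; rewrite packed_lxor // => q hq; rewrite gG ltn_addr // ?ha ?hb.
have le k : k < Q -> packed b g (fun q => Nat.lxor (fa k q) (fb k q)) <= packed b g (fun=> hi).
  move=> hk; apply: leq_sum => q _; rewrite leq_mul2r ltnW ?orbT //.
  exact: lx.
rewrite packed_sub //.
rewrite (@eq_packed _ _ _ (fun k => packed b g (fun q => hi - Nat.lxor (fa k q) (fb k q)))); last first.
  by move=> k hk; rewrite packed_sub // => q hq; rewrite ltnW // lx.
rewrite packed_land; first last.
- by move=> k hk; apply: blk' => q hq; rewrite gG; lia.
- by move=> k hk; apply: blk' => q hq; rewrite gG; lia.
rewrite (@eq_packed _ _ _ (fun k => packed b g (fun q => (fa k q == fb k q) * hi))); last first.
  move=> k hk; rewrite packed_land; first last.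
  - by move=> q hq; rewrite gG; lia.
  - by move=> q hq; rewrite gG; lia.
  apply: eq_packed => q hq.
  case: eqP => [-> | ne]; first by rewrite Nat.lxor_nilpotent subn0 mul1n Nat.land_diag.
  rewrite mul0n land_pow2_lt //.
  have : Nat.lxor (fa k q) (fb k q) <> 0 by move/Nat.lxor_eq.
  by rewrite -/hi; lia.
rewrite /block_fill packed_add /block_tops packed_land; first last.
- by move=> k hk; rewrite GG; have := expn_gt0 2 G.-1; lia.
- move=> k hk; rewrite GG.
  have : packed b g (fun q => (fa k q == fb k q) * hi) < 2 ^ G.-1.
    by apply: blk => q hq; rewrite gG; case: eqP; lia.
  by lia.
apply: eq_packed => k hk.
have lt : packed b g (fun q => (fa k q == fb k q) * hi) < 2 ^ G.-1.
  by apply: blk => q hq; rewrite gG; case: eqP; lia.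
have p0 := expn_gt0 2 G.-1.
case: hasP => [[q] | no].
  rewrite mem_iota add0n => /andP[_ hq] /eqP e.
  have pos : 0 < packed b g (fun q => (fa k q == fb k q) * hi).
    rewrite /packed (bigD1 (Ordinal hq)) //= e eqxx mul1n addn_gt0.
    by rewrite muln_gt0 hi0 expn_gt0.
  rewrite mul1n; set z := packed _ _ _ in lt pos *.
  have -> : z + (2 ^ G.-1).-1 = 2 ^ G.-1 + z.-1 by lia.
  by rewrite land_pow2 //; lia.
rewrite mul0n; have -> : packed b g (fun q => (fa k q == fb k q) * hi) = 0.
  rewrite /packed big1 // => q _; case: eqP => // e; case: no.
  by exists (nat_of_ord q); rewrite ?mem_iota ?e //=.
by rewrite add0n land_pow2_lt //; lia.
Qed.

Lemma match_word_safe fa fb :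
  (forall k q, k < Q -> q < b -> fa k q < hi) ->
  (forall k q, k < Q -> q < b -> fb k q < hi) ->
  Nat.lxor (packed Q G (fun k => packed b g (fa k)))
    (packed Q G (fun k => packed b g (fb k))) <= field_tops /\
  field_tops + block_fill < 2 ^ (G * Q).
Proof.
move=> ha hb.
have gG : 2 ^ g = hi + hi by rewrite -(prednK g0) expnS mul2n -addnn.
have hi0 : 0 < hi by rewrite expn_gt0.
have G1 : G.-1 = g * b by rewrite GE addn1 mulnC.
have GG : 2 ^ G = 2 ^ G.-1 + 2 ^ G.-1 by rewrite GE addn1 expnS mul2n -addnn.
have blk f : (forall q, q < b -> f q < 2 ^ g) -> packed b g f < 2 ^ G.-1.
  by move=> hf; rewrite G1; apply: packed_lt.
split.
  rewrite /field_tops packed_lxor.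
  - apply: leq_sum => k _; rewrite leq_mul2r packed_lxor.
    + apply/orP; right; apply: leq_sum => q _; rewrite leq_mul2r ltnW ?orbT //.
      by apply: lxor_lt; [apply: ha | apply: hb].
    + by move=> q hq; rewrite gG ltn_addr // ha.
    + by move=> q hq; rewrite gG ltn_addr // hb.
  - move=> k hk; rewrite GG ltn_addr // blk // => q hq.
    by rewrite gG ltn_addr // ha.
  - move=> k hk; rewrite GG ltn_addr // blk // => q hq.
    by rewrite gG ltn_addr // hb.
rewrite packed_add; apply: packed_lt => k hk.
have : packed b g (fun=> hi) < 2 ^ G.-1 by apply: blk => q _; rewrite gG; lia.
by rewrite GG; have := expn_gt0 2 G.-1; lia.
Qed.

Definition top_bits (s : seq nat) : nat := \sum_(k <- s) 2 ^ (G * k + G.-1).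

Lemma packed_top_bits (c : nat -> bool) :
  packed Q G (fun k => c k * 2 ^ G.-1) =
  top_bits [seq k <- iota 0 Q | c k].
Proof.
rewrite /top_bits big_filter /packed.
have -> : iota 0 Q = index_iota 0 Q by rewrite /index_iota subn0.
rewrite -(big_mkord xpredT (fun k => c k * 2 ^ G.-1 * 2 ^ (G * k))).
rewrite [RHS]big_mkcond; apply: eq_bigr => k _.
by case: (c k); rewrite ?mul0n // mul1n -expnD addnC.
Qed.

Lemma top_bits_pop k s : sorted ltn (k :: s) ->
  Nat.land (top_bits (k :: s)) (top_bits (k :: s) - 1) = top_bits s.
Proof.
move=> so.
have G0 : 0 < G by rewrite GE addn1.
set P := G * k + G.-1.
have /dvdnP[y ys] : 2 ^ P.+1 %| top_bits s.
  rewrite /top_bits big_seq; apply: (big_ind (fun x => 2 ^ P.+1 %| x)) => //.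
    by move=> x y; apply: dvdn_add.
  move=> j js; apply: dvdn_exp2l.
  have lt : k < j by move: so => /= /(order_path_min ltn_trans)/allP/(_ j js).
  have : G * k.+1 <= G * j by rewrite leq_mul2l lt orbT.
  by rewrite /P; lia.
have e1 : top_bits (k :: s) = 2 ^ P.+1 * y + 2 ^ P.
  by rewrite /top_bits big_cons -/(top_bits s) ys -/P addnC mulnC.
have p0 := expn_gt0 2 P.
rewrite e1 ys -addnBA //.
have lt1 : 2 ^ P < 2 ^ P.+1 by rewrite ltn_exp2l.
have lt2 : 2 ^ P - 1 < 2 ^ P.+1 by lia.
rewrite [_ + 2 ^ P]addnC [_ + (2 ^ P - 1)]addnC.
rewrite (bitop_split Nat.land_spec (erefl : false && false = _) y y lt1 lt2).
have -> : Nat.land (2 ^ P) (2 ^ P - 1) = 0.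
  by rewrite Nat.land_comm land_pow2_lt // subn1 prednK.
by rewrite add0n Nat.land_diag mulnC.
Qed.

End Match.


(** * A prime between 2^r and 2^(2r) *)

Lemma central_bin_ge n : 2 ^ n <= 'C(n.*2, n).
Proof.
elim: n => // n IH; apply: (@leq_trans (2 * 'C(n.*2, n))).
  by rewrite expnS leq_mul2l.
rewrite doubleS [X in _ <= X]binS mul2n -addnn.
by apply: leq_add; rewrite ?leq_bin2l // binS leq_addl.
Qed.

Lemma central_bin_pfactor n p : 0 < n -> prime p ->
  p ^ logn p 'C(n.*2, n) <= n.*2.
Proof.
move=> n0 pp; have p1 := prime_gt1 pp; have p0 := prime_gt0 pp.
have nn : n <= n.*2 by rewrite -addnn leq_addl.
have C0 : 0 < 'C(n.*2, n) by rewrite bin_gt0.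
suff le : logn p 'C(n.*2, n) <= trunc_log p n.*2.
  apply: (@leq_trans (p ^ trunc_log p n.*2)); first by rewrite leq_exp2l.
  by apply: trunc_logP => //; rewrite double_gt0.
have := bin_fact nn; have -> : n.*2 - n = n by lia.
move/(congr1 (logn p)); rewrite !lognM ?muln_gt0 ?fact_gt0 // !logn_fact //.
set T := trunc_log p n.*2.
have lt k : T < k -> n.*2 %/ p ^ k = 0.
  move=> tk; rewrite divn_small //.
  apply: leq_trans (trunc_log_ltn _ p1) _; by rewrite leq_exp2l.
have ext m : m <= n.*2 -> \sum_(1 <= k < m.+1) m %/ p ^ k =
    \sum_(1 <= k < n.*2.+1) m %/ p ^ k.
  move=> le; rewrite [RHS](@big_cat_nat _ _ _ m.+1) //=.
  rewrite [X in _ = _ + X](_ : _ = 0) ?addn0 //.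
  rewrite big_nat big1 // => k /andP[mk _].
  by rewrite divn_small // (leq_trans mk) // ltnW // ltn_expl.
rewrite (ext n nn) => e.
have : \sum_(1 <= k < n.*2.+1) n.*2 %/ p ^ k <=
    \sum_(1 <= k < n.*2.+1) (n %/ p ^ k + n %/ p ^ k + (k <= T)).
  apply: leq_sum => k _; case: (leqP k T) => [_ | /lt-> //].
  have d0 : 0 < p ^ k by rewrite expn_gt0 p0.
  rewrite -addnn {1 2}(divn_eq n (p ^ k)).
  set q := n %/ _; set r := n %% _.
  have rl : r < p ^ k by rewrite ltn_mod.
  have -> : q * p ^ k + r + (q * p ^ k + r) = (q + q) * p ^ k + (r + r) by lia.
  rewrite divnMDl // leq_add2l -ltnS ltn_divLR //; lia.
rewrite !big_split /= => le.
have : \sum_(1 <= k < n.*2.+1) (k <= T : nat) <= T.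
  have -> : \sum_(1 <= k < n.*2.+1) (k <= T : nat) = minn n.*2 T.
    elim: (n.*2) => [|m IH]; first by rewrite big_geq // min0n.
    by rewrite big_nat_recr //= IH; lia.
  exact: geq_minr.
lia.
Qed.

Lemma exists_prime r : 5 <= r -> exists2 p, 2 ^ r < p <= 2 ^ (2 * r) & prime p.
Proof.
move=> r5; set K := 2 ^ r.
have rK : 4 * r < K.
  rewrite /K; elim: r r5 {K} => // r IH; rewrite leq_eqVlt => /orP[/eqP<- // | h].
  by rewrite expnS; have := IH h; lia.
set n := 2 ^ (2 * r).-1.
have n0 : 0 < n by rewrite expn_gt0.
have nE : n.*2 = 2 ^ (2 * r) by rewrite -mul2n -expnS prednK //; lia.
case: (boolP (has (fun p => prime p && (K < p)) (iota 0 n.*2.+1))).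
  case/hasP=> p; rewrite mem_iota ltnS nE => /andP[_ h1] /andP[h2 h3].
  by exists p => //; rewrite h3.
move/hasPn=> no; exfalso.
have C0 : 0 < 'C(n.*2, n) by rewrite bin_gt0 -addnn leq_addl.
have small p : p \in primes 'C(n.*2, n) -> p < K.+1.
  rewrite mem_primes C0 => /andP[pp pd]; rewrite ltnS leqNgt; apply/negP => Kp.
  have le : p <= n.*2.
    apply: leq_trans (central_bin_pfactor n0 pp).
    by rewrite -{1}(expn1 p) leq_exp2l ?prime_gt1 // logn_gt0 mem_primes pp C0.
  have := no p; rewrite mem_iota ltnS le pp Kp; by move/(_ isT).
have : 'C(n.*2, n) <= n.*2 ^ K.
  rewrite {1}(prod_prime_decomp C0) prime_decompE big_map /=.
  have sz : size (primes 'C(n.*2, n)) <= K.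
    have := @uniq_leq_size _ (primes 'C(n.*2, n)) (iota 1 K) (primes_uniq _).
    rewrite size_iota; apply=> p hp; rewrite mem_iota add1n small // andbT.
    by move: hp; rewrite mem_primes => /andP[/prime_gt0].
  apply: (@leq_trans (n.*2 ^ size (primes 'C(n.*2, n)))); last first.
    by rewrite leq_pexp2l // double_gt0.
  have : all prime (primes 'C(n.*2, n)) by apply: all_prime_primes.
  elim: (primes _) => [_ | p s IH /= /andP[pp ps]]; first by rewrite big_nil.
  by rewrite big_cons expnS leq_mul ?IH ?central_bin_pfactor.
rewrite leqNgt => /negP; apply; apply: leq_trans (central_bin_ge n).
rewrite nE -expnM ltn_exp2l // /n.
have -> : (2 * r).-1 = r + r.-1 by lia.
have KE : K = 2 * 2 ^ r.-1 by rewrite -expnS prednK //; lia.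
by rewrite expnD -/K mulnC ltn_pmul2l ?expn_gt0 //; lia.
Qed.


(** * Hash functions and the preprocessed representation of a set *)

(* Locked, because simplification would try to evaluate it. *)
Definition pow2above (k : nat) : nat := locked (2 ^ up_log 2 k.+1).

Lemma pow2aboveE k : pow2above k = 2 ^ up_log 2 k.+1.
Proof. by rewrite /pow2above -lock. Qed.

(* Toeplitz hashing over GF(2): bit j of the value is the inner product of x
   with the bits j, j + 1, ... of s. *)
Fixpoint toeplitz (w n x s : nat) : nat :=
  if n is n'.+1 then
    Nat.lxor (if odd x then s %% 2 ^ w else 0) (toeplitz w n' (x %/ 2) (s %/ 2))
  else 0.

(* The polynomial over Z/p whose coefficients are the n lowest base-p digits
   of c, evaluated at x. *)
Fixpoint poly_hash (p n c x : nat) : nat :=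
  if n is n'.+1 then
    (poly_hash p n' c x * x + (c %/ p ^ n') %% p) %% p
  else 0.

Section Params.
Variable w : nat.

Definition ell := up_log 2 w.+1.
Definition sig_bits := 4 * ell.
Definition field := sig_bits + 2.
Definition block := ell * field + 1.
Definition slots := (w - 1) %/ (ell * block).
Definition blocks := slots * ell.
Fact modulus_subproof : exists p, prime p && (2 ^ sig_bits < p).
Proof. by have [p lt pp] := prime_above (2 ^ sig_bits); exists p; rewrite pp. Qed.

Definition modulus : nat := ex_minn modulus_subproof.

Definition buckets (n : nat) := pow2above ((64 * n) %/ blocks).
Definition classes (n : nat) := pow2above n.

Section Seed.
Variable rho : nat -> nat.

Definition hash (k x : nat) : nat := toeplitz w w x (rho k + 2 ^ w * rho k.+1).

Definition sig (x : nat) : nat := hash 2 x %% 2 ^ sig_bits.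
Definition slot (x : nat) : nat :=
  poly_hash modulus ell (rho 4) (sig x) %% slots.

Definition bucket (n : nat) (X : seq nat) (u : nat) : seq nat :=
  [seq x <- X | hash 0 x %% n == u].

Definition in_slot (Z : seq nat) (s : nat) : seq nat :=
  [seq x <- Z | slot x == s].

Definition full (Z : seq nat) : bool :=
  has (fun s => ell < size (in_slot Z s)) (iota 0 slots).

(* Entry q of slot s: a signature shifted by 2, or 0 if there is none. *)
Definition entry (Z : seq nat) (s q : nat) : nat :=
  if q < size (in_slot Z s) then (sig (nth 0 (in_slot Z s) q)).+2 else 0.

Definition local_index (Z : seq nat) (s q : nat) : nat :=
  if q < size (in_slot Z s) then index (nth 0 (in_slot Z s) q) Z else 0.

(* Block s * ell + q belongs to entry q of slot s.  In word_a it repeats that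
   entry, in word_b it lists all entries of the slot; empty entries are 0 in
   the former and 1 in the latter. *)
Definition word_a (Z : seq nat) : nat :=
  packed slots (ell * block) (fun s =>
    packed ell block (fun q => packed ell field (fun=> entry Z s q))).

Definition word_b (Z : seq nat) : nat :=
  packed slots (ell * block) (fun s =>
    packed ell block (fun=>
      packed ell field (fun q => maxn 1 (entry Z s q)))).

Definition word_n (Z : seq nat) : nat :=
  packed slots (ell * block) (fun s => packed ell block (local_index Z s)).

Definition sorted_by_bucket (X : seq nat) (n k : nat) : seq nat :=
  flatten [seq bucket n X u | u <- iota 0 k].

(* One plus the last position in Y of an element of class v, 0 if none. *)
Definition last_pos (n v : nat) (Y : seq nat) : nat :=
  size Y - find (fun x => hash 5 x %% n == v) (rev Y).

Definition rank (n : nat) (Y : seq nat) (j : nat) : nat :=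
  let x := nth 0 Y j in
  count (fun y => (hash 0 y %% n == hash 0 x %% n) && (slot y == slot x))
    (take j Y).

Definition header := 11.
Definition elements_at (n : nat) := header + 5 * (buckets n).+1.
Definition heads_at (n : nat) := elements_at n + 5 * n.
Definition total_size (n : nat) := heads_at n + classes n.

Definition header_of (n : nat) : seq nat :=
  [:: n; buckets n; classes n; elements_at n; heads_at n;
      field_tops blocks ell field block; block_fill blocks block;
      block_tops blocks block; 2 ^ block.-1; w; 2 ^ block].

Definition bucket_ok (get : nat -> nat) (a b : nat) (Z : seq nat) : Prop :=
  [/\ get (a + 3) = b, get (a + 4) = full Z &
    ~~ full Z ->
    [/\ get a = word_a Z, get (a + 1) = word_b Z & get (a + 2) = word_n Z]].

Definition element_ok (get : nat -> nat) (a n c : nat) (Y : seq nat) (j : nat) :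
    Prop :=
  let x := nth 0 Y j in
  [/\ get a = x, get (a + 1) = hash 5 x,
      rank n Y j < ell ->
        get (a + 2) = 2 ^ (block * (slot x * ell + rank n Y j) + block.-1),
      get (a + 3) = last_pos c (hash 5 x %% c) (take j Y) &
      get (a + 4) = slot x].

Record represents (X : seq nat) (get : nat -> nat) : Prop := Represents {
  rep_header : forall k, k < header ->
    get k = nth 0 (header_of (size X)) k;
  rep_bucket : forall u, u < buckets (size X) ->
    bucket_ok get (header + 5 * u)
      (size (sorted_by_bucket X (buckets (size X)) u))
      (bucket (buckets (size X)) X u);
  rep_end : get (header + 5 * buckets (size X) + 3) = size X;
  rep_element : forall j, j < size X ->
    element_ok get (elements_at (size X) + 5 * j) (buckets (size X))
      (classes (size X))
      (sorted_by_bucket X (buckets (size X)) (buckets (size X))) j;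
  rep_head : forall v, v < classes (size X) ->
    get (heads_at (size X) + v) = last_pos (classes (size X)) v
      (sorted_by_bucket X (buckets (size X)) (buckets (size X))) }.

End Seed.
End Params.

Lemma in_slotE w rho Z s : in_slot w rho Z s = [seq x <- Z | slot w rho x == s].
Proof. by []. Qed.

(** * Numerical facts *)

Lemma pow2above_gt k : k < pow2above k.
Proof. by rewrite pow2aboveE; apply: (@up_logP 2 k.+1). Qed.

Lemma pow2above_le k : pow2above k <= k.*2.+1.
Proof.
case: k => [|k]; first by rewrite pow2aboveE up_log1.
have := @up_log_gtn 2 k.+2 isT isT; rewrite pow2aboveE.
have : 0 < up_log 2 k.+2 by rewrite up_log_gt0.
by case: up_log => // e _; rewrite expnS /=; lia.
Qed.

Lemma pow2above_gt0 k : 0 < pow2above k.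
Proof. by rewrite pow2aboveE expn_gt0. Qed.

(* Word sizes for which all parameters make sense. *)
Definition large (w : nat) : bool := (16 <= ell w) && (100 * ell w ^ 3 <= w).

Lemma large_eventually : exists w0, forall w, w0 <= w -> large w.
Proof.
have cube l : 4 <= l -> l.+1 ^ 3 <= 2 * l ^ 3.
  by move=> h; rewrite !expnS !expn0 !muln1; nia.
have [l0 [l04 h0]] : exists l0, 16 <= l0 /\ forall l, l0 <= l -> 100 * l ^ 3 <= 2 ^ l.-1.
  have base k : k ^ 4 <= 16 * 16 ^ k.
    elim: k => // k; rewrite [16 ^ k.+1]expnS; case: (leqP 4 k) => [k4 | ].
      by rewrite !expnS !expn0 !muln1; nia.
    by case: k => [|[|[|[|]]]].
  exists (4 * (100 * (64 * 64))); split=> // l.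
  set C := 100 * (64 * 64) => hl.
  have lq : l = 4 * (l %/ 4) + l %% 4 by lia.
  have q4 : C <= l %/ 4 by lia.
  have := base (l %/ 4); rewrite -[16]/(2 ^ 4) -expnM => h.
  apply: (@leq_trans (2 ^ (4 * (l %/ 4)) %/ 2)); last first.
    rewrite -[X in _ %/ X]/(2 ^ 1) -expnB //; last lia.
    by rewrite leq_exp2l //; lia.
  rewrite leq_divRL //; move: h; set q := l %/ 4 in lq q4 *.
  have : l <= 4 * q + 3 by lia.
  rewrite /C in q4; move=> lle h.
  have : 100 * l ^ 3 * 2 * 16 <= q ^ 4.
    have : l ^ 3 <= (5 * q) ^ 3 by rewrite leq_exp2r //; lia.
    rewrite expnMn; rewrite -[5 ^ 3]/125 [q ^ 4]expnS.
    by set q3 := q ^ 3; nia.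
  by lia.
exists (2 ^ l0) => w hw; rewrite /large.
have w1 : 1 < w.+1 by have := expn_gt0 2 l0; lia.
have /andP[b1 b2] := up_log_bounds (isT : 1 < 2) w1.
have l0l : l0 < ell w.
  by rewrite -(@ltn_exp2l 2) // (leq_trans _ b2) // ltnS.
rewrite (leq_trans l04) ?(ltnW l0l) //= -ltnS.
by apply: leq_ltn_trans b1; apply: h0; apply: ltnW.
Qed.

Section Large.
Variable w : nat.
Hypothesis lw : large w.
Local Notation L := (ell w).

Lemma ell_ge16 : 16 <= L. Proof. by case/andP: lw. Qed.
Lemma ell_cube : 100 * (L * (L * L)) <= w.
Proof. by case/andP: lw => _; rewrite !expnS expn0 muln1. Qed.
Lemma lt_w_ell : w < 2 ^ L. Proof. by apply: (@up_logP 2 w.+1). Qed.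
Lemma ell_log : 2 ^ L.-1 <= w.
Proof.
have w1 : 1 < w.+1 by have := ell_cube; have := ell_ge16; nia.
by have /andP[b1 _] := up_log_bounds (isT : 1 < 2) w1.
Qed.

Lemma w_gt0 : 0 < w. Proof. by have := ell_cube; have := ell_ge16; nia. Qed.

Lemma blockE : block w = L * field w + 1. Proof. by []. Qed.

Lemma block_le : block w <= 5 * (L * L).
Proof. by rewrite /block /field /sig_bits; have := ell_ge16; nia. Qed.

Lemma ell_block_lt : 2 * (L * block w) < w.
Proof. by have := ell_cube; have := block_le; have := ell_ge16; nia. Qed.

Lemma slots_gt0 : 0 < slots w.
Proof.
rewrite /slots divn_gt0; first by have := ell_block_lt; lia.
by rewrite muln_gt0 /block addn1 andbT; have := ell_ge16; lia.
Qed.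

Lemma slots_block : slots w * (L * block w) < w.
Proof.
have le : slots w * (L * block w) <= w - 1 by apply: leq_divM.
apply: leq_ltn_trans le _; have := w_gt0; lia.
Qed.

Lemma blocks_block : block w * blocks w < w.
Proof. by rewrite /blocks mulnC -mulnA; apply: slots_block. Qed.

Lemma blocks_gt0 : 0 < blocks w.
Proof. by rewrite muln_gt0 slots_gt0; have := ell_ge16; lia. Qed.

Lemma blocks_lt : blocks w < w.
Proof.
by apply: leq_ltn_trans blocks_block; rewrite leq_pmull // /block addn1.
Qed.

Lemma slots_lt : slots w < w.
Proof. by apply: leq_ltn_trans blocks_lt; rewrite leq_pmulr //; have := ell_ge16; lia. Qed.

Lemma blocks_ge : w <= 10 * (L * L) * blocks w.
Proof.
have lt : w - 1 < (slots w).+1 * (L * block w).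
  by apply: ltn_ceil; rewrite muln_gt0 /block addn1 andbT; have := ell_ge16; lia.
have l2 : w <= 2 * (slots w * (L * block w)).
  by have := ell_block_lt; rewrite mulSn in lt; lia.
apply: leq_trans l2 _.
have -> : 10 * (L * L) * blocks w = 2 * (slots w * (L * (5 * (L * L)))).
  by rewrite /blocks; lia.
by rewrite !leq_mul2l block_le !orbT.
Qed.

Lemma modulus_prime : prime (modulus w).
Proof. by rewrite /modulus; case: ex_minnP => p /andP[]. Qed.

Lemma modulus_gt : 2 ^ sig_bits w < modulus w.
Proof. by rewrite /modulus; case: ex_minnP => p /andP[]. Qed.

Lemma modulus_le : modulus w <= 2 ^ (8 * L).
Proof.
have := @exists_prime (sig_bits w); case; first by rewrite /sig_bits; have := ell_ge16; lia.
move=> p /andP[h1 h2] pp; rewrite /modulus; case: ex_minnP => q _ /(_ p).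
rewrite pp h1 => /(_ isT) le; apply: leq_trans le (leq_trans h2 _).
by rewrite leq_exp2l // /sig_bits; lia.
Qed.

Lemma modulus_sq : modulus w * modulus w < 2 ^ w.
Proof.
apply: (@leq_ltn_trans (2 ^ (8 * L) * 2 ^ (8 * L))).
  by apply: leq_mul; apply: modulus_le.
by rewrite -expnD ltn_exp2l //; have := ell_cube; have := ell_ge16; nia.
Qed.

Lemma modulus_pow : modulus w ^ L <= 2 ^ w.
Proof.
apply: (@leq_trans ((2 ^ (8 * L)) ^ L)).
  by rewrite leq_exp2r ?modulus_le //; have := ell_ge16; lia.
by rewrite -expnM leq_exp2l //; have := ell_cube; have := ell_ge16; nia.
Qed.

Lemma slots_le_modulus : slots w <= modulus w.
Proof.
apply: ltnW; apply: ltn_trans slots_lt _; apply: ltn_trans lt_w_ell _.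
by apply: leq_ltn_trans modulus_gt; rewrite leq_exp2l // /sig_bits; lia.
Qed.

End Large.


(** * Incremental computation of the representation *)

Lemma packed_const n g c : packed n g (fun=> c) = c * packed n g (fun=> 1).
Proof. by rewrite packed_mull; apply: eq_packed => k _; rewrite muln1. Qed.

Lemma packed_ones_gt0 n g : 0 < n -> 0 < packed n g (fun=> 1).
Proof. by case: n => // n _; rewrite packedS mul1n addn_gt0 expn_gt0 orbT. Qed.

Section Incremental.
Variables (w : nat) (rho : nat -> nat).
Hypothesis lw : large w.
Local Notation L := (ell w).
Local Notation slot := (slot w rho).
Local Notation sig := (sig w rho).
Local Notation in_slot := (in_slot w rho).
Local Notation hash := (hash w rho).

Lemma sig_lt x : sig x < 2 ^ sig_bits w.
Proof. by rewrite ltn_mod expn_gt0. Qed.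

Lemma slot_lt x : slot x < slots w.
Proof. by rewrite ltn_mod slots_gt0. Qed.

Lemma toeplitz_lt n x s : toeplitz w n x s < 2 ^ w.
Proof.
elim: n x s => [|n IH] x s /=; first by rewrite expn_gt0.
by apply: lxor_lt => //; case: odd; rewrite ?ltn_mod expn_gt0.
Qed.

Lemma hash_lt k x : hash k x < 2 ^ w.
Proof. exact: toeplitz_lt. Qed.

Lemma poly_hash_lt p m c x : 0 < p -> poly_hash p m c x < p.
Proof. by case: m => //= m p0; rewrite ltn_mod. Qed.

Lemma in_slot_rcons Z x s :
  in_slot (rcons Z x) s = if slot x == s then rcons (in_slot Z s) x else in_slot Z s.
Proof. by rewrite in_slotE filter_rcons. Qed.

Lemma full_rcons Z x :
  full w rho (rcons Z x) = full w rho Z || (L <= size (in_slot Z (slot x))).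
Proof.
rewrite /full; apply/hasP/orP => [[s s1] | [/hasP[s s1 s2] | le]].
- rewrite in_slot_rcons; case: eqP => [<- | _ h]; last by left; apply/hasP; exists s.
  by rewrite size_rcons ltnS; right.
- exists s => //; rewrite in_slot_rcons; case: eqP => // _.
  by rewrite size_rcons ltnW.
- exists (slot x); first by rewrite mem_iota slot_lt.
  by rewrite in_slot_rcons eqxx size_rcons.
Qed.

Lemma entry_rcons Z x s q :
  entry w rho (rcons Z x) s q = entry w rho Z s q +
    (s == slot x) * ((q == size (in_slot Z s)) * (sig x).+2).
Proof.
rewrite /entry in_slot_rcons eq_sym; case: eqP => [-> | _]; last by rewrite addn0.
rewrite size_rcons nth_rcons ltnS leq_eqVlt; case: ltngtP => //= _.
  by rewrite addn0.
by rewrite !mul1n.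
Qed.

Lemma local_index_rcons Z x s q : x \notin Z ->
  local_index w rho (rcons Z x) s q = local_index w rho Z s q +
    (s == slot x) * ((q == size (in_slot Z s)) * size Z).
Proof.
move=> xZ.
have idx q' : q' < size (in_slot Z s) ->
    index (nth 0 (in_slot Z s) q') (rcons Z x) = index (nth 0 (in_slot Z s) q') Z.
  move=> h; rewrite -cats1 index_cat.
  by have := mem_nth 0 h; rewrite mem_filter => /andP[_ ->].
rewrite /local_index in_slot_rcons eq_sym; case: eqP => [e | _].
  rewrite size_rcons nth_rcons ltnS leq_eqVlt; case: ltngtP => //= [h | _].
    by rewrite addn0 idx.
  by rewrite !mul1n -cats1 index_cat (negbTE xZ) /= eqxx addn0.
by rewrite addn0; case: ifP => // /idx.
Qed.

Lemma entry_lt Z s q : entry w rho Z s q < 2 ^ (field w).-1.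
Proof.
have -> : (field w).-1 = (sig_bits w).+1 by rewrite /field addn2.
rewrite expnS; have := sig_lt; have := expn_gt0 2 (sig_bits w).
have : 2 ^ 1 <= 2 ^ sig_bits w.
  by rewrite leq_exp2l // /sig_bits; have := ell_ge16 lw; lia.
by move=> h1 h2 sl; rewrite /entry; case: ifP => [_ | _]; [have := sl (nth 0 (in_slot Z s) q) |]; lia.
Qed.

Lemma field_gt0 : 0 < field w. Proof. by rewrite /field addn2. Qed.

Lemma field_pow : 2 ^ (field w).-1 < 2 ^ field w.
Proof. by rewrite ltn_exp2l // ltn_predL field_gt0. Qed.

Lemma fields_lt f : (forall q, q < L -> f q < 2 ^ field w) ->
  packed L (field w) f < 2 ^ block w.
Proof.
move=> h; apply: leq_trans (packed_lt h) _.
by rewrite leq_exp2l // /block mulnC leq_addr.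
Qed.

Lemma words_lt f :
  (forall s q, s < slots w -> q < L -> f s q < 2 ^ block w) ->
  packed (slots w) (L * block w) (fun s => packed L (block w) (f s)) < 2 ^ w.
Proof.
move=> h; apply: (@leq_trans (2 ^ (L * block w * slots w))).
  apply: packed_lt => s hs; rewrite mulnC; apply: packed_lt => q hq.
  exact: h.
by rewrite leq_exp2l // mulnC ltnW // slots_block.
Qed.

Lemma word_a_lt Z : word_a w rho Z < 2 ^ w.
Proof.
apply: words_lt => s q _ _; apply: fields_lt => q' _.
exact: ltn_trans (entry_lt _ _ _) field_pow.
Qed.

Lemma maxn_entry_lt Z s q : maxn 1 (entry w rho Z s q) < 2 ^ (field w).-1.
Proof.
rewrite gtn_max entry_lt andbT -{1}(expn0 2) ltn_exp2l // /field addn2 /=.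
by rewrite /sig_bits; have := ell_ge16 lw; lia.
Qed.

Lemma word_b_lt Z : word_b w rho Z < 2 ^ w.
Proof.
apply: words_lt => s q _ _; apply: fields_lt => q' _.
exact: ltn_trans (maxn_entry_lt _ _ _) field_pow.
Qed.

Lemma words_upd f s0 q0 d : s0 < slots w -> q0 < L ->
  packed (slots w) (L * block w) (fun s => packed L (block w) (fun q =>
    f s q + (s == s0) * ((q == q0) * d))) =
  packed (slots w) (L * block w) (fun s => packed L (block w) (f s)) +
  d * 2 ^ (block w * (s0 * L + q0)).
Proof.
move=> hs hq.
rewrite (@eq_packed _ _ _ (fun s => packed L (block w) (f s) +
   (s == s0) * (d * 2 ^ (block w * q0)))); last first.
  move=> s _; case: (s =P s0) => [_ | _].
    by rewrite mul1n -packed_upd //; apply: eq_packed => q _; rewrite mul1n.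
  by rewrite mul0n addn0; apply: eq_packed => q _; rewrite addn0.
rewrite packed_upd // -mulnA -expnD; congr (_ + _ * _ ^ _).
by rewrite mulnDr addnC; congr (_ + _); lia.
Qed.

Lemma word_a_rcons Z x : size (in_slot Z (slot x)) < L ->
  word_a w rho (rcons Z x) = word_a w rho Z +
    (sig x + 2) * packed L (field w) (fun=> 1) *
    2 ^ (block w * (slot x * L + size (in_slot Z (slot x)))).
Proof.
move=> h; rewrite -words_upd ?slot_lt //; apply: eq_packed => s _.
apply: eq_packed => q _; rewrite !(packed_const _ _ (entry _ _ _ _ _)) entry_rcons mulnDl.
congr (_ + _); case: eqP => // ->; rewrite !mul1n addn2.
by case: eqP => //; rewrite !mul1n.
Qed.

Lemma word_n_rcons Z x : size (in_slot Z (slot x)) < L -> x \notin Z ->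
  word_n w rho (rcons Z x) = word_n w rho Z +
    size Z * 2 ^ (block w * (slot x * L + size (in_slot Z (slot x)))).
Proof.
move=> h xZ; rewrite -words_upd ?slot_lt //; apply: eq_packed => s _.
apply: eq_packed => q _; rewrite local_index_rcons //.
by congr (_ + _); case: eqP => // ->.
Qed.

Lemma word_b_rcons Z x : size (in_slot Z (slot x)) < L ->
  word_b w rho (rcons Z x) = word_b w rho Z +
    (sig x + 1) * 2 ^ (field w * size (in_slot Z (slot x))) *
    packed L (block w) (fun=> 1) * 2 ^ (block w * (slot x * L)).
Proof.
move=> h; have -> : block w * (slot x * L) = L * block w * slot x by lia.
rewrite -packed_upd ?slot_lt //; apply: eq_packed => s _.
rewrite !(packed_const L (block w) (packed _ _ _)) mulnA -mulnDl; congr (_ * _).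
case: (s =P slot x) => [-> | ne]; last first.
  rewrite mul0n addn0; apply: eq_packed => q _; rewrite entry_rcons.
  by case: eqP ne => // _ _; rewrite addn0.
rewrite mul1n -packed_upd //; apply: eq_packed => q _; rewrite entry_rcons eqxx mul1n.
case: eqP => [-> | _]; last by rewrite !addn0.
by rewrite /entry ltnn !mul1n maxn0; lia.
Qed.

Lemma size_not_full Z : ~~ full w rho Z -> size Z <= blocks w.
Proof.
move/hasPn=> nf.
have -> : size Z = \sum_(s < slots w) size (in_slot Z s).
  elim: Z {nf} => [|x Z IH]; first by rewrite big1.
  rewrite /= (bigD1 (Ordinal (slot_lt x))) //= eqxx /= addSn; congr _.+1.
  rewrite IH (bigD1 (Ordinal (slot_lt x))) //=; congr (_ + _).
  apply: eq_bigr => s; rewrite -val_eqE /= eq_sym => /negbTE h.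
  by rewrite in_slotE /= h.
rewrite /blocks -[slots w in X in _ <= X]card_ord -sum_nat_const.
apply: leq_sum => s _; rewrite leqNgt; apply: nf.
by rewrite mem_iota add0n /=.
Qed.

Lemma local_index_lt Z s q : ~~ full w rho Z ->
  local_index w rho Z s q < 2 ^ block w.
Proof.
move=> nf; have b0 := expn_gt0 2 (block w).
rewrite /local_index; case: ifP => // h.
have := mem_nth 0 h; rewrite mem_filter -index_mem => /andP[_ lt].
apply: leq_trans lt (leq_trans (size_not_full nf) _).
apply: leq_trans (ltnW (blocks_lt lw)) _; apply: leq_trans (ltnW (lt_w_ell w)) _.
by rewrite leq_exp2l // /block; have := field_gt0; have := ell_ge16 lw; nia.
Qed.

Lemma word_n_lt Z : ~~ full w rho Z -> word_n w rho Z < 2 ^ w.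
Proof. by move=> nf; apply: words_lt => s q _ _; apply: local_index_lt. Qed.

Lemma word_a_nil : word_a w rho [::] = 0.
Proof.
rewrite /word_a /packed big1 // => s _; rewrite big1 // => q _.
by rewrite big1.
Qed.

Lemma word_n_nil : word_n w rho [::] = 0.
Proof. by rewrite /word_n /packed big1 // => s _; rewrite big1. Qed.

Lemma blocks_ones :
  packed (slots w) (L * block w) (fun=> packed L (block w) (fun=> 1)) =
  packed (blocks w) (block w) (fun=> 1).
Proof. by rewrite (packed_nest _ _ _ (fun _ _ => 1)). Qed.

Lemma word_b_nil : word_b w rho [::] =
  packed (blocks w) (block w) (fun=> 1) * packed L (field w) (fun=> 1).
Proof.
rewrite mulnC -blocks_ones packed_mull; apply: eq_packed => s _.
by rewrite packed_mull; apply: eq_packed => q _; rewrite muln1.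
Qed.

Lemma full_nil : full w rho [::] = false.
Proof. by apply/hasP => -[s _]. Qed.

Lemma last_pos_rcons n v Y x :
  last_pos w rho n v (rcons Y x) =
  if hash 5 x %% n == v then (size Y).+1 else last_pos w rho n v Y.
Proof.
by rewrite /last_pos rev_rcons /= size_rcons; case: eqP => // _; rewrite subSS.
Qed.

Lemma rank_rcons n Y x : rank w rho n (rcons Y x) (size Y) =
  count (fun y => (hash 0 y %% n == hash 0 x %% n) && (slot y == slot x)) Y.
Proof. by rewrite /rank nth_rcons ltnn eqxx -cats1 take_size_cat. Qed.

Lemma rank_rcons_lt n Y x j : j < size Y ->
  rank w rho n (rcons Y x) j = rank w rho n Y j.
Proof.
by move=> h; rewrite /rank nth_rcons h -cats1 takel_cat // ltnW.
Qed.

Lemma element_ok_rcons get a n c Y x j : j < size Y ->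
  element_ok w rho get a n c Y j -> element_ok w rho get a n c (rcons Y x) j.
Proof.
move=> h; rewrite /element_ok nth_rcons h rank_rcons_lt //.
by rewrite -cats1 takel_cat // ltnW.
Qed.

Lemma sorted_by_bucketS X n k :
  sorted_by_bucket w rho X n k.+1 =
  sorted_by_bucket w rho X n k ++ bucket w rho n X k.
Proof.
by rewrite /sorted_by_bucket -addn1 iotaD map_cat flatten_cat /= cats0.
Qed.

Lemma mem_sorted_by_bucket X n k x :
  (x \in sorted_by_bucket w rho X n k) = (x \in X) && (hash 0 x %% n < k).
Proof.
elim: k => [|k IH]; first by rewrite andbF.
rewrite sorted_by_bucketS mem_cat IH mem_filter ltnS [in RHS]leq_eqVlt.
by case: (x \in X) => //=; rewrite ?andbF // andbT orbC.
Qed.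

Lemma perm_sorted_by_bucket X n : 0 < n ->
  perm_eq (sorted_by_bucket w rho X n n) X.
Proof.
move=> n0; apply/permP => p.
have -> k : count p (sorted_by_bucket w rho X n k) =
    count (fun x => p x && (hash 0 x %% n < k)) X.
  elim: k => [|k IH].
    apply/esym/eqP; rewrite -leqn0 leqNgt -has_count; apply/hasP => -[x _].
    by rewrite ltn0 andbF.
  rewrite sorted_by_bucketS count_cat IH count_filter -count_predUI.
  rewrite [X in _ + X](_ : _ = 0) ?addn0; last first.
    apply/eqP; rewrite -leqn0 leqNgt -has_count; apply/hasP => -[x _ /=].
    by case: eqP => [-> | _]; rewrite ?ltnn ?andbF.
  apply: eq_count => x /=; rewrite ltnS [in RHS]leq_eqVlt.
  by case: (p x); rewrite //= orbC.
by apply: eq_count => x; rewrite /= ltn_mod n0 andbT.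
Qed.

Lemma size_sorted_by_bucket X n k : 0 < n -> k <= n ->
  size (sorted_by_bucket w rho X n k) <= size X.
Proof.
move=> n0 kn; rewrite -(perm_size (perm_sorted_by_bucket X n0)).
rewrite -(subnKC kn) {2}/sorted_by_bucket iotaD map_cat flatten_cat size_cat.
exact: leq_addr.
Qed.

Lemma rank_new X n u Z x : (forall y, y \in Z -> hash 0 y %% n = u) ->
  hash 0 x %% n = u ->
  rank w rho n (rcons (sorted_by_bucket w rho X n u ++ Z) x)
    (size (sorted_by_bucket w rho X n u ++ Z)) = size (in_slot Z (slot x)).
Proof.
move=> Zu xu; rewrite rank_rcons count_cat xu size_filter.
rewrite (_ : count _ (sorted_by_bucket _ _ _ _ _) = 0) ?add0n.
  by apply: eq_in_count => y /Zu ->; rewrite eqxx.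
apply/eqP; rewrite -leqn0 leqNgt -has_count; apply/hasP => -[y].
by rewrite mem_sorted_by_bucket => /andP[_ lt] /andP[/eqP e]; rewrite e ltnn in lt.
Qed.

Lemma element_ok_ext get get' a n c Y j :
  (forall k, k < 5 -> get' (a + k) = get (a + k)) ->
  element_ok w rho get a n c Y j -> element_ok w rho get' a n c Y j.
Proof.
by move=> e; rewrite /element_ok !e // -(addn0 a) e // addn0.
Qed.

Lemma bucket_ok_ext get get' a b Z :
  (forall k, k < 5 -> get' (a + k) = get (a + k)) ->
  bucket_ok w rho get a b Z -> bucket_ok w rho get' a b Z.
Proof.
by move=> e; rewrite /bucket_ok !e // -(addn0 a) e // addn0.
Qed.

End Incremental.


(** * The preprocessing program *)

(* A number stands for the register of that index, #k for the constant k. *)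
Declare Scope prog_scope.
Delimit Scope prog_scope with prog.
Bind Scope prog_scope with expr.
Bind Scope prog_scope with cmd.
Coercion Var : nat >-> expr.
Notation "# n" := (Lit n%N) (at level 0, n at level 0, format "# n") : prog_scope.
Notation "x + y" := (Bin Add x y) : prog_scope.
Notation "x - y" := (Bin Defs.Sub x y) : prog_scope.
Notation "x * y" := (Bin Mul x y) : prog_scope.
Notation "x / y" := (Bin Div x y) : prog_scope.
Notation "x 'shl' y" := (Bin Shl x y) (at level 45) : prog_scope.
Notation "x 'mod' y" := (Bin Defs.Sub x (Bin Mul (Bin Div x y) y))
  (at level 40, only parsing) : prog_scope.
Notation "x ::= e" := (Assign x%N e%prog) (at level 70) : prog_scope.
Notation "c ;; d" := (Seq c%prog d%prog)
  (at level 85, right associativity, format "'[v' c ;; '/' d ']'") : prog_scope.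

Definition pow2above_cmd (k y e : nat) : cmd :=
 (y ::= #1 ;; e ::= #0 ;;
  While (Lt y (k + #1)) (y ::= y + y ;; e ::= e + #1))%prog.

Lemma modn_sub x y : x - x %/ y * y = x %% y.
Proof. by rewrite {1}(divn_eq x y) addKn. Qed.

Lemma wp_pow2above w ok k y e r M :
  uniq [:: k; y; e] -> (r k).*2.+1 < 2 ^ w ->
  wp w ok (pow2above_cmd k y e) (fun t r' M' =>
    r' y = pow2above (r k) /\ r' e = up_log 2 (r k).+1) r M.
Proof.
rewrite /= !inE negb_or -andbA => /and4P[/negbTE ky /negbTE ke /negbTE ye _] lt.
have ey : (e == y) = false by rewrite eq_sym.
apply/wp_seq/wp_assign => /=; first lia.
apply/wp_seq/wp_assign => /=; first lia.
apply: (@wp_while _ _ (fun j t r' M' => [/\ r' k = r k, r' y = 2 ^ r' e,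
    r' e + j = up_log 2 (r k).+1 & True])).
  exists (up_log 2 (r k).+1); rewrite /put !eqxx ky ke ye.
  by rewrite add0n.
move=> j t r' M' [rk ry re _] _ _ _; split=> /=.
- by rewrite rk; lia.
- rewrite rk addn1 ry => hlt; have j0 : 0 < j.
    rewrite lt0n; apply/eqP => j0; move: hlt; rewrite j0 addn0 in re.
    by rewrite re ltnNge up_logP.
  split=> //; apply/wp_seq/wp_assign => /=.
    by rewrite ry; lia.
  apply: wp_assign => /=.
    rewrite /put ey; have : r' e < 2 ^ r' e by apply: ltn_expl.
    by lia.
  split=> //; rewrite /put ?eqxx ?ky ?ke ?ye ?ey ?eqxx.
  + by [].
  + by rewrite ry addn1 expnS mul2n addnn.
  + by rewrite addn1; lia.
- rewrite rk addn1 ry -leqNgt => hle; have : up_log 2 (r k).+1 <= r' e.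
    by apply: up_log_min.
  by move=> le; rewrite pow2aboveE; have -> : r' e = up_log 2 (r k).+1 by lia.
Qed.

Definition toeplitz_cmd (k : nat) : cmd :=
 (50 ::= 37 ;; 51 ::= Get #k ;; 52 ::= Get (#k + #1) ;; 49 ::= #0 ;;
  For 53 10
   (49 ::= Bin Xor 49 (51 * (50 mod #2)) ;;
    51 ::= 51 / #2 + (52 mod #2) * (#1 shl (10 - #1)) ;;
    52 ::= 52 / #2 ;;
    50 ::= 50 / #2))%prog.

Lemma wp_toeplitz w ok k r M :
  99 < 2 ^ w -> k < 99 -> r 10 = w -> r 37 < 2 ^ w -> M k < 2 ^ w ->
  M k.+1 < 2 ^ w ->
  wp w ok (toeplitz_cmd k) (fun t r' M' =>
    r' 49 = toeplitz w w (r 37) (M k + 2 ^ w * M k.+1)) r M.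
Proof.
move=> w99 k99 rw x0 m0 m1.
have w0 : 0 < w by move: w99; case: (w).
have [w1 w2] : 1 < 2 ^ w /\ 2 < 2 ^ w by split; lia.
have wE : 2 ^ w = 2 * 2 ^ w.-1 by rewrite -expnS prednK.
apply/wp_seq/wp_assign => //=.
apply/wp_seq/wp_assign => /=; first by lia.
apply/wp_seq/wp_assign => /=; first by lia.
apply/wp_seq/wp_assign => /=; first by lia.
rewrite addn1.
apply: (@wp_for _ _ w (fun i t r' M' => [/\ r' 50 < 2 ^ w, r' 51 < 2 ^ w, r' 52 < 2 ^ w &
   Nat.lxor (r' 49) (toeplitz w (w - i) (r' 50) (r' 51 + 2 ^ w * r' 52)) =
   toeplitz w w (r 37) (M k + 2 ^ w * M k.+1)])) => //.
- exact: ltn_expl.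
- by rewrite /put /= subn0 Nat.lxor_0_l; split.
- move=> i t r' M' [bz b0 b1 e] iw ri kp _ _.
  have r10 : r' 10 = w by rewrite kp.
  split=> //= lt; have E : w - i = (w - i.+1).+1 by lia.
  set s := r' 51 + 2 ^ w * r' 52 in e *.
  have sE : s %/ 2 = r' 51 %/ 2 + r' 52 %% 2 * 2 ^ w.-1 + 2 ^ w * (r' 52 %/ 2).
    have -> : s = (r' 52 %% 2 * 2 ^ w.-1 + 2 ^ w * (r' 52 %/ 2)) * 2 + r' 51.
      by rewrite /s wE {1}(divn_eq (r' 52) 2); lia.
    by rewrite divnMDl //; lia.
  have sM : s %% 2 ^ w = r' 51 by rewrite /s addnC mulnC modnMDl modn_small.
  have p0 := expn_gt0 2 w.-1.
  have m2 : r' 52 %% 2 = 0 \/ r' 52 %% 2 = 1 by lia.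
  have lt51 : r' 51 %/ 2 + r' 52 %% 2 * 2 ^ w.-1 < 2 ^ w by case: m2 => ->; lia.
  have b2 : r' 51 * (r' 50 %% 2) < 2 ^ w by rewrite modn2; case: odd; lia.
  rewrite E /= sM in e.
  apply/wp_seq/wp_assign => /=.
    by rewrite w2 modn_sub b2 /=; lia.
  apply/wp_seq/wp_assign => /=.
    rewrite /put /= r10 modn_sub w2 w1 w0 !mul1n !subn1 ltn_exp2l //.
    have b3 : r' 52 %% 2 * 2 ^ w.-1 < 2 ^ w by case: m2 => ->; lia.
    by rewrite lt51 b3 ltn_predL w0 /=; lia.
  apply/wp_seq/wp_assign => /=; first by rewrite w2.
  apply: wp_assign => /=; first by rewrite w2.
  rewrite /put /= r10 !modn_sub !mul1n subn1; split; first exact: ri.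
  split; [by lia | by [] | by lia |].
  rewrite -sE -e Nat.lxor_assoc; congr (Nat.lxor _ (Nat.lxor _ _)).
  by rewrite modn2; case: odd; rewrite ?muln1 ?muln0.
- move=> t r' M' [_ _ _ e] _ _ _ _; move: e; rewrite subnn /=.
  by rewrite Nat.lxor_0_r.
Qed.

Definition poly_cmd : cmd :=
 (49 ::= #0 ;; 51 ::= Get #4 ;;
  For 53 11
   (52 ::= 49 * 39 + (51 mod 16) ;;
    49 ::= 52 mod 16 ;;
    51 ::= 51 / 16))%prog.

Lemma wp_poly w ok n p r M :
  99 < 2 ^ w -> n < 2 ^ w -> r 11 = n -> r 16 = p -> r 39 < p -> p * p < 2 ^ w ->
  M 4 < 2 ^ w ->
  wp w ok poly_cmd (fun t r' M' => r' 49 = poly_hash p n (M 4) (r 39)) r M.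
Proof.
move=> w99 nw rn rp xp pw m4; have p0 : 0 < p by lia.
have w0 : 0 < w by move: w99; case: (w).
apply/wp_seq/wp_assign => /=; first lia.
apply/wp_seq/wp_assign => /=; first lia.
apply: (@wp_for _ _ n (fun i t r' M' => r' 51 = M 4 %/ p ^ i /\
   r' 49 = poly_hash p i (M 4) (r 39))) => //.
- by rewrite /put /= divn1.
- move=> i t r' M' [e1 e2] iw ri kp _ _.
  have [r11 [r16 r39]] : r' 11 = n /\ r' 16 = p /\ r' 39 = r 39.
    by rewrite !kp.
  have hl : poly_hash p i (M 4) (r 39) < p by case: (i) => //= j; rewrite ltn_mod.
  set h := poly_hash p i (M 4) (r 39) in e2 hl.
  have cl : (M 4 %/ p ^ i) %% p < p by rewrite ltn_mod.
  have b1 : h * r 39 + (M 4 %/ p ^ i) %% p < 2 ^ w by nia.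
  have b2 : M 4 %/ p ^ i < 2 ^ w by apply: leq_ltn_trans m4; apply: leq_div.
  have dm x : x %/ p * p <= x by apply: leq_divM.
  split=> //= lt; apply/wp_seq/wp_assign => /=.
    rewrite e1 e2 r16 r39 modn_sub b1 dm; have := dm (M 4 %/ p ^ i).
    by case/andP: (conj b1 b2); lia.
  apply/wp_seq/wp_assign => /=.
    rewrite /put /= e1 e2 r16 r39 modn_sub dm.
    by have := dm (h * r 39 + (M 4 %/ p ^ i) %% p); lia.
  apply: wp_assign => //=.
  rewrite /put /= e1 e2 r16 r39 !modn_sub; split=> //; split=> //.
  by rewrite expnS mulnC divnMA.
- by move=> t r' M' [_ ->].
Qed.

Definition prime_cmd : cmd :=
 (16 ::= 25 ;; 40 ::= #0 ;;
  While (Eq 40 #0)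
   (16 ::= 16 + #1 ;; 40 ::= #1 ;;
    For 41 16
     (If (Lt #1 41) (If (Eq (16 mod 41) #0) (40 ::= #0) Skip) Skip)))%prog.

Lemma prime_trial p : 1 < p ->
  prime p = ~~ has (fun d => (1 < d) && (d %| p)) (iota 0 p).
Proof.
move=> p1; apply/primeP/hasPn => [[_ h] d | h].
  rewrite mem_iota /= => lt; apply/negP => /andP[d1 /h /= /orP[] /eqP e]; lia.
split=> // d dp; rewrite /= -[_ || _]negbK negb_or; apply/negP => /andP[d1 dp'].
have dle : d <= p by apply: dvdn_leq dp; lia.
have := h d; rewrite mem_iota dp andbT /=.
have d0 : 0 < d by apply: dvdn_gt0 dp; lia.
by move=> /(_ ltac:(lia)); lia.
Qed.

Lemma wp_prime w ok r M :
  99 < 2 ^ w -> modulus w < 2 ^ w -> r 25 = 2 ^ sig_bits w ->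
  wp w ok prime_cmd (fun t r' M' => r' 16 = modulus w) r M.
Proof.
move=> w99 mw r25.
have w0 : 0 < w by move: w99; case: (w).
have mgt := modulus_gt w; have s0 := expn_gt0 2 (sig_bits w).
apply/wp_seq/wp_assign => //=.
apply/wp_seq/wp_assign => /=; first lia.
apply: (@wp_while _ _ (fun (j t : nat) (r' M' : store) => r' 16 + j = modulus w /\
    if r' 40 == 0 then (2 ^ sig_bits w <= r' 16 < modulus w : Prop)
    else r' 16 = modulus w)).
  exists (modulus w - r 25); rewrite /put /= r25 leqnn mgt; split=> //; lia.
move=> j t r' M' [e1 e2] kp _ _; split=> /=; first lia.
  move=> c40; rewrite c40 in e2; have /andP[lo hi] := e2.
  split; first lia.
  apply/wp_seq/wp_assign => /=; first lia.
  apply/wp_seq/wp_assign => /=; first lia.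
  set p := r' 16 + 1.
  have p1 : 1 < p by rewrite /p; lia.
  pose trial i := has (fun d => (1 < d) && (d %| p)) (iota 0 i).
  apply: (@wp_for _ _ p (fun i t r2 M2 => r2 40 =
     ~~ trial i :> nat)) => //.
  - by rewrite /p; lia.
  - move=> i t2 r2 M2 e3 ip ri kp2 _ _.
    have r16 : r2 16 = p by rewrite kp2.
    have trialS : trial i.+1 = trial i || (1 < i) && (i %| p).
      by rewrite /trial -[i.+1]addn1 iotaD has_cat /= orbF.
    split=> //= lt; apply: wp_if => /=; first lia.
      rewrite ri => i1; apply: wp_if => /=.
        have := leq_divM p i; rewrite ri r16 /p; lia.
      * rewrite r16 ri modn_sub => /eqP dv; apply: wp_assign => /=; first lia.
        by rewrite /put /= trialS i1 /dvdn dv orbT.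
      * rewrite r16 ri modn_sub => ndv; apply: wp_skip.
        by rewrite /put /= trialS e3 i1 /= /dvdn (negbTE ndv) orbF.
    rewrite ri => i1; apply: wp_skip.
    by rewrite /put /= trialS e3 (negbTE i1) orbF.
  - move=> t2 r2 M2 e3 _ kp2 _ _.
    have r16 : r2 16 = p by rewrite kp2.
    rewrite r16 e3 /trial -prime_trial //; split; first by rewrite /p; lia.
    case: (boolP (prime p)) => pp /=.
      have : modulus w <= p.
        rewrite /modulus; case: ex_minnP => q _; apply; rewrite pp /p; lia.
      by rewrite /p; lia.
    have : p != modulus w by apply: contra pp => /eqP->; apply: modulus_prime.
    by rewrite /p; lia.
by move=> c40; move: e2; rewrite (negbTE c40).
Qed.


Definition width_cmd : cmd :=
 (40 ::= Ones ;; 10 ::= #0 ;;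
  While (Lt #0 40) (40 ::= 40 / #2 ;; 10 ::= 10 + #1))%prog.

Lemma wp_width w ok r M : 99 < 2 ^ w ->
  wp w ok width_cmd (fun t r' M' => r' 10 = w) r M.
Proof.
move=> w99; have w0 : 0 < w by move: w99; case: (w).
apply/wp_seq/wp_assign => //=.
apply/wp_seq/wp_assign => /=; first lia.
apply: (@wp_while _ _ (fun (j t : nat) (r' M' : store) =>
   r' 10 + j = w /\ r' 40 = 2 ^ j - 1)).
  by exists w.
move=> j t r' M' [e1 e2] _ _ _; rewrite /= e2; split; first lia.
  case: j e1 e2 => [|j] //= e1 e2 _; split=> //.
  apply/wp_seq/wp_assign => /=; first lia.
  apply: wp_assign => /=; first by rewrite /put /=; have := @ltn_expl 2 w isT; lia.
  rewrite /put /= e2; split; first lia.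
  by rewrite expnS; have := expn_gt0 2 j; lia.
by case: j e1 {e2} => [|j] e1; rewrite ?addn0 in e1 => //; rewrite expnS; have := expn_gt0 2 j; lia.
Qed.

Definition params_cmd : cmd :=
 (12 ::= #4 * 11 ;; 13 ::= 12 + #2 ;; 14 ::= 11 * 13 + #1 ;;
  15 ::= (10 - #1) / (11 * 14) ;; 26 ::= 15 * 11 ;; 25 ::= #1 shl 12)%prog.

Definition sizes_cmd : cmd :=
 (40 ::= (#64 * 0) / 26 ;; pow2above_cmd 40 17 42 ;; pow2above_cmd 0 18 42 ;;
  19 ::= 0 + #7 ;;
  22 ::= ((#1 shl (13 * 11)) - #1) / ((#1 shl 13) - #1) ;;
  23 ::= ((#1 shl (14 * 11)) - #1) / ((#1 shl 14) - #1) ;;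
  27 ::= ((#1 shl (14 * 26)) - #1) / ((#1 shl 14) - #1) ;;
  24 ::= 27 * 22)%prog.

Definition setup_cmd : cmd :=
 (width_cmd ;; pow2above_cmd 10 40 11 ;; params_cmd ;; prime_cmd ;; sizes_cmd)%prog.

Definition const_regs :=
  [:: 0; 10; 11; 12; 13; 14; 15; 16; 17; 18; 19; 22; 23; 24; 25; 26; 27].

Definition const_vals (w n : nat) :=
  [:: n; w; ell w; sig_bits w; field w; block w; slots w; modulus w;
      buckets w n; classes n; n + 7;
      packed (ell w) (field w) (fun=> 1); packed (ell w) (block w) (fun=> 1);
      packed (blocks w) (block w) (fun=> 1) * packed (ell w) (field w) (fun=> 1);
      2 ^ sig_bits w; blocks w; packed (blocks w) (block w) (fun=> 1)].

Section Setup.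
Variable w : nat.
Hypothesis lw : large w.

Lemma large_99 : 99 < 2 ^ w.
Proof.
have : 2 ^ 7 <= 2 ^ w by rewrite leq_exp2l //; have := ell_cube lw; have := ell_ge16 lw; nia.
by apply: leq_trans.
Qed.

Lemma lt_exp_w : w < 2 ^ w. Proof. exact: ltn_expl. Qed.

Lemma dbl_exp_w : w.*2.+1 < 2 ^ w.
Proof.
have := lt_w_ell w; have : 2 ^ (ell w).+2 <= 2 ^ w.
  by rewrite leq_exp2l //; have := ell_cube lw; have := ell_ge16 lw; nia.
by rewrite !expnS; lia.
Qed.

Lemma modulus_lt : modulus w < 2 ^ w.
Proof.
by have := modulus_sq lw; have := prime_gt1 (modulus_prime w); nia.
Qed.

Lemma field_ell : field w * ell w < w.
Proof. by have := ell_block_lt lw; rewrite /block; have := ell_ge16 lw; nia. Qed.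

Lemma wp_params ok r M : r 10 = w -> r 11 = ell w ->
  wp w ok params_cmd (fun t r' M' =>
    [/\ r' 12 = sig_bits w, r' 13 = field w, r' 14 = block w, r' 15 = slots w &
     r' 26 = blocks w /\ r' 25 = 2 ^ sig_bits w]) r M.
Proof.
move=> r10 r11; have l99 := large_99; have := field_ell; have := lt_exp_w.
have := ell_block_lt lw; have := blocks_lt lw; have := ell_ge16 lw; have := w_gt0 lw.
have sE : sig_bits w = 4 * ell w by []. have fE : field w = sig_bits w + 2 by [].
have bE : block w = ell w * field w + 1 by [].
have slE : slots w = (w - 1) %/ (ell w * block w) by [].
have blE : blocks w = slots w * ell w by [].
move=> w0 L16 bl lb we fl.
have sw : sig_bits w < w by nia.
have bw : block w < 2 ^ w by nia.
apply/wp_seq/wp_assign => /=; first by rewrite r11; nia.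
apply/wp_seq/wp_assign => /=; first by rewrite /put /= r11; nia.
apply/wp_seq/wp_assign => /=; first by rewrite /put /= r11 -sE -fE; nia.
apply/wp_seq/wp_assign => /=; first by rewrite /put /= r10 r11 -sE -fE -bE; nia.
apply/wp_seq/wp_assign => /=.
  by rewrite /put /= r10 r11 -sE -fE -bE -slE -blE; nia.
apply: wp_assign => /=.
  by rewrite /put /= r11 -sE !mul1n ltn_exp2l // sw; lia.
by rewrite /put /= r10 r11 -sE -fE -bE -slE -blE !mul1n.
Qed.

Lemma buckets_le n : buckets w n <= 128 * n + 1.
Proof.
rewrite /buckets; apply: leq_trans (pow2above_le _) _.
by have := leq_div (64 * n) (blocks w); lia.
Qed.

Lemma wp_sizes ok n r M : 2000 * n.+1 <= 2 ^ w ->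
  r 0 = n -> r 11 = ell w -> r 13 = field w -> r 14 = block w -> r 26 = blocks w ->
  wp w ok sizes_cmd (fun t r' M' =>
    [/\ r' 17 = buckets w n, r' 18 = classes n, r' 19 = n + 7,
      r' 22 = packed (ell w) (field w) (fun=> 1) &
      [/\ r' 23 = packed (ell w) (block w) (fun=> 1),
        r' 27 = packed (blocks w) (block w) (fun=> 1) &
        r' 24 = packed (blocks w) (block w) (fun=> 1) *
                packed (ell w) (field w) (fun=> 1)]]) r M.
Proof.
move=> nw r0 r11 r13 r14 r26.
have l99 := large_99; have we := lt_exp_w; have w0 := w_gt0 lw.
have f0 : 0 < field w by rewrite /field addn2.
have b0 : 0 < block w by rewrite /block addn1.
have fl := field_ell; have lb := ell_block_lt lw; have bb := blocks_block lw.
have L16 := ell_ge16 lw.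
have bw : block w < w by nia.
have fw : field w < w by nia.
have bl : block w * ell w < w by nia.
have [n7 c7] : n + 7 < 2 ^ w /\ 7 < 2 ^ w by split; lia.
have d64 : 64 * n %/ blocks w <= 64 * n by apply: leq_div.
apply/wp_seq/wp_assign => /=; first by rewrite r0; lia.
rewrite r0 r26; set r1 := put r 40 _.
apply/wp_seq/(wp_conseq (wp_pow2above _ _ _ _)) => //.
  by rewrite /r1 /put /=; lia.
move=> t2 r2 M2 k2 _ p2 [e17 _].
apply/wp_seq/(wp_conseq (wp_pow2above _ _ _ _)) => //.
  by rewrite k2 // /r1 /put /= r0; lia.
move=> t3 r3 M3 k3 _ p3 [e18 _].
have E x : x \notin [:: 17; 42; 18; 40] -> r3 x = r x.
  rewrite !inE !negb_or => /and4P[h1 h2 h3 h4].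
  rewrite k3 /= ?inE ?negb_or ?h1 ?h2 ?h3 // k2 /= ?inE ?negb_or ?h1 ?h2 ?h3 //.
  by rewrite /r1 /put (negbTE h4).
have r17 : r3 17 = buckets w n by rewrite k3 // e17 /r1 /put.
have r18 : r3 18 = classes n by rewrite e18 k2 // /r1 /put /= r0.
have one g : 0 < 2 ^ g by rewrite expn_gt0.
have o1 : packed (ell w) (field w) (fun=> 1) = (2 ^ (field w * ell w) - 1) %/ (2 ^ field w - 1).
  by rewrite packed_ones // !subn1.
have o2 : packed (ell w) (block w) (fun=> 1) = (2 ^ (block w * ell w) - 1) %/ (2 ^ block w - 1).
  by rewrite packed_ones // !subn1.
have o3 : packed (blocks w) (block w) (fun=> 1) = (2 ^ (block w * blocks w) - 1) %/ (2 ^ block w - 1).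
  by rewrite packed_ones // !subn1.
have l1 : 1 < 2 ^ w by apply: leq_trans l99.
apply/wp_seq/wp_assign => /=; first by rewrite c7 (E 0) // r0 n7.
rewrite (E 0) // r0.
apply/wp_seq/wp_assign => /=.
  by rewrite /put /= !E // r13 r11 !mul1n !ltn_exp2l // fl fw l1 !one (ltn_trans fl we).
rewrite [X in put _ 22 X](_ : _ = packed (ell w) (field w) (fun=> 1)); last first.
  by rewrite o1 /put /= !E // r13 r11 !mul1n.
apply/wp_seq/wp_assign => /=.
  by rewrite /put /= !E // r14 r11 !mul1n !ltn_exp2l // bl bw l1 !one (ltn_trans bl we).
rewrite [X in put _ 23 X](_ : _ = packed (ell w) (block w) (fun=> 1)); last first.
  by rewrite o2 /put /= !E // r14 r11 !mul1n.
apply/wp_seq/wp_assign => /=.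
  by rewrite /put /= !E // r14 r26 !mul1n !ltn_exp2l // bb bw l1 !one (ltn_trans bb we).
rewrite [X in put _ 27 X](_ : _ = packed (blocks w) (block w) (fun=> 1)); last first.
  by rewrite o3 /put /= !E // r14 r26 !mul1n.
apply: wp_assign; rewrite /put /=.
  rewrite -(word_b_nil w (fun=> 0)); exact: word_b_lt.
by rewrite r17 r18.
Qed.

Lemma wp_setup ok n r M : 2000 * n.+1 <= 2 ^ w -> r 0 = n ->
  wp w ok setup_cmd (fun t r' M' =>
    map r' const_regs = const_vals w n) r M.
Proof.
move=> nw r0; have l99 := large_99.
apply/wp_seq/(wp_conseq (wp_width _ _ _ _)) => //.
move=> t1 r1 M1 k1 _ p1 e10.
apply/wp_seq/(wp_conseq (wp_pow2above _ _ _ _)) => //.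
  by rewrite e10; apply: dbl_exp_w.
move=> t2 r2 M2 k2 _ p2 [_ e11].
have f10 : r2 10 = w by rewrite k2.
have f11 : r2 11 = ell w by rewrite e11 e10.
apply/wp_seq/(wp_conseq (wp_params _ _ f10 f11)) => t3 r3 M3 k3 _ p3 [e12 e13 e14 e15 [e26 e25]].
apply/wp_seq/(wp_conseq (wp_prime _ _ _ modulus_lt e25)) => //.
move=> t4 r4 M4 k4 _ p4 e16.
have f0 : r4 0 = n by rewrite k4 ?k3 ?k2 ?k1.
have f11' : r4 11 = ell w by rewrite k4 ?k3.
have f13 : r4 13 = field w by rewrite k4.
have f14 : r4 14 = block w by rewrite k4.
have f26 : r4 26 = blocks w by rewrite k4.
apply: (wp_conseq (wp_sizes _ _ nw f0 f11' f13 f14 f26)).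
move=> t5 r5 M5 k5 _ p5 [e17 e18 e19 e22 [e23 e27 e24]].
rewrite /= e17 e18 e19 e22 e23 e24 e27 /const_vals.
by rewrite (k5 0) ?(k5 10) ?(k5 11) ?(k5 12) ?(k5 13) ?(k5 14) ?(k5 15) ?(k5 16) ?(k5 25) ?(k5 26) //
  f0 f11' f13 f14 f26 e16 (k4 10) ?(k4 12) ?(k4 15) ?(k4 25) // (k3 10) // f10 e12 e15 e25.
Qed.

End Setup.


(* Register 30 holds the current bucket, 31 the position of its first element,
   32, 33 and 34 its three words, 35 whether it is full, 37 the current element,
   39 its signature, 40 its slot, 41 its dictionary hash, 42 its rank in the
   slot, 44 its mark, and 46 the number of elements stored so far; for the
   others see const_regs. *)
Definition header_cmd : cmd :=
 (20 ::= #11 + #5 * (17 + #1) ;; 21 ::= 20 + #5 * 0 ;;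
  Put (19 + #0) 0 ;; Put (19 + #1) 17 ;; Put (19 + #2) 18 ;; Put (19 + #3) 20 ;;
  Put (19 + #4) 21 ;; Put (19 + #5) (24 * (#1 shl (13 - #1))) ;;
  Put (19 + #6) ((27 * (#1 shl (14 - #1))) - 27) ;;
  Put (19 + #7) (27 * (#1 shl (14 - #1))) ;;
  Put (19 + #8) (#1 shl (14 - #1)) ;; Put (19 + #9) 10 ;;
  Put (19 + #10) (#1 shl 14) ;;
  20 ::= 20 + 19 ;; 21 ::= 21 + 19)%prog.

Definition record_cmd : cmd :=
 (47 ::= 20 + #5 * 46 ;; 48 ::= 21 + (41 mod 18) ;;
  Put (47 + #0) 37 ;; Put (47 + #1) 41 ;; Put (47 + #2) 44 ;;
  Put (47 + #3) (Get 48) ;; Put (47 + #4) 40 ;;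
  46 ::= 46 + #1 ;; Put 48 46)%prog.

Lemma wp_record w ok a hd r M : 99 < 2 ^ w ->
  a = r 20 + 5 * r 46 -> hd = r 21 + r 41 %% r 18 ->
  (forall i, i <= 4 -> ok (a + i) && (a + i < 2 ^ w)) ->
  ok hd && (hd < 2 ^ w) -> r 41 < 2 ^ w -> r 46 + 1 < 2 ^ w ->
  a + 4 < hd ->
  wp w ok record_cmd (fun t r' M' => r' 46 = r 46 + 1 /\
    M' = store_at (store_at (store_at (store_at (store_at (store_at M
      (a + 0) (r 37)) (a + 1) (r 41)) (a + 2) (r 44)) (a + 3) (M hd))
      (a + 4) (r 40)) hd (r 46 + 1)) r M.
Proof.
move=> l99 ae he oka /andP[okh hw] hl cl lt.
have lit k : k <= 99 -> k < 2 ^ w by move=> hk; apply: leq_ltn_trans hk l99.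
have [okA ltA] : (forall i, i <= 4 -> ok (a + i)) /\
    (forall i, i <= 4 -> a + i < 2 ^ w) by split=> i /oka /andP[].
have a5 : a < 2 ^ w by have := ltA 0 isT; rewrite addn0.
have dm : r 41 %/ r 18 * r 18 <= r 41 by apply: leq_divM.
apply/wp_seq/wp_assign => /=.
  by rewrite -ae a5 lit // !andbT; apply: leq_ltn_trans a5; rewrite ae leq_addl.
rewrite -ae; apply/wp_seq/wp_assign; rewrite /put /=.
  by rewrite modn_sub -he hw dm (leq_ltn_trans dm hl).
rewrite modn_sub -he; set r1 := fun x => if x == 48 then _ else _.
have e1 : [/\ r1 47 = a, r1 48 = hd, r1 37 = r 37, r1 41 = r 41 & r1 44 = r 44].
  by [].
have e2 : r1 40 = r 40 /\ r1 46 = r 46 by [].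
clearbody r1; case: e1 => f47 f48 f37 f41 f44; case: e2 => f40 f46.
do 5!(apply: wp_seq; apply: wp_put => /=;
  [by rewrite f47 lit // ltA | by [] | by rewrite f47 okA |]).
apply/wp_seq/wp_assign => /=; first by rewrite f46 cl lit.
apply: wp_put => //=; first by rewrite /put /= f48.
have ne i : i <= 4 -> (hd == a + i) = false by move=> hi; apply/eqP; lia.
have hdE : store_at (store_at (store_at M (a + 0) (r 37)) (a + 1) (r 41))
    (a + 2) (r 44) hd = M hd by rewrite /store_at /put !ne.
by rewrite [put r1 _ _ _]/put [put r1 _ _ _]/put /= f47 f37 f41 f44 f40 f46 f48 hdE.
Qed.

Definition element_cmd : cmd :=
 (toeplitz_cmd 2 ;; 39 ::= 49 mod 25 ;; poly_cmd ;; 40 ::= 49 mod 15 ;;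
  toeplitz_cmd 5 ;; 41 ::= 49 ;; 42 ::= #0 ;;
  For 43 (46 - 31)
   (If (Eq (Get (20 + (#5 * (31 + 43) + #4))) 40) (42 ::= 42 + #1) Skip) ;;
  44 ::= #0 ;;
  If (Lt 42 11)
   (45 ::= 14 * ((40 * 11) + 42) ;; 44 ::= #1 shl (45 + (14 - #1)) ;;
    If (Eq 35 #0)
     (32 ::= 32 + (((39 + #2) * 22) * (#1 shl 45)) ;;
      33 ::= 33 + ((((39 + #1) * (#1 shl (13 * 42))) * 23) *
                   (#1 shl (14 * (40 * 11)))) ;;
      34 ::= 34 + ((46 - 31) * (#1 shl 45)))
     Skip)
   (35 ::= #1) ;;
  record_cmd)%prog.

Definition bucket_cmd : cmd :=
 (31 ::= 46 ;; 32 ::= #0 ;; 33 ::= 24 ;; 34 ::= #0 ;; 35 ::= #0 ;;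
  For 36 0
   (37 ::= Get (#7 + 36) ;; toeplitz_cmd 0 ;;
    If (Eq (49 mod 17) 30) element_cmd Skip) ;;
  47 ::= 19 + (#11 + #5 * 30) ;;
  Put (47 + #0) 32 ;; Put (47 + #1) 33 ;; Put (47 + #2) 34 ;; Put (47 + #3) 31 ;;
  Put (47 + #4) 35)%prog.

Definition pre_cmd : cmd :=
 (setup_cmd ;; header_cmd ;; 46 ::= #0 ;; For 30 17 bucket_cmd ;;
  Put (19 + ((#11 + #5 * 17) + #3)) 0 ;;
  0 ::= (21 + 18) - 19 ;; 1 ::= 19)%prog.

Definition pre_regs := const_regs ++ [:: 20; 21].
Definition pre_vals (w n : nat) :=
  const_vals w n ++ [:: n + 7 + elements_at w n; n + 7 + heads_at w n].

Section Pre.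
Variables (w : nat) (rho : nat -> nat) (X : seq nat) (M0 : store).
Let n := size X.
Let W := buckets w n.
Let C := classes n.
Let D := n + 7.
Hypotheses (lw : large w) (nw : 2000 * n.+1 <= 2 ^ w).
Hypotheses (uX : uniq X) (Xw : forall x, x \in X -> x < 2 ^ w).
Hypotheses (rhow : forall k, k < 7 -> rho k < 2 ^ w).
Hypothesis M0rho : forall k, k < 7 -> M0 k = rho k.
Hypothesis M0X : forall j, j < n -> M0 (7 + j) = nth 0 X j.

Let ok : pred nat := fun a => D <= a < D + total_size w n.
Local Notation wp := (wp w ok).

Lemma W_le : W <= 128 * n + 1. Proof. exact: buckets_le. Qed.
Lemma C_le : C <= 2 * n + 1.
Proof. by have := pow2above_le n; rewrite /C /classes; lia. Qed.
Lemma W_gt0 : 0 < W. Proof. exact: pow2above_gt0. Qed.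
Lemma C_gt0 : 0 < C. Proof. exact: pow2above_gt0. Qed.
Lemma elE : elements_at w n = 11 + 5 * W.+1. Proof. by []. Qed.
Lemma hdE : heads_at w n = elements_at w n + 5 * n. Proof. by []. Qed.
Lemma totE : total_size w n = heads_at w n + C. Proof. by []. Qed.

Lemma okE a : D <= a -> a < D + total_size w n -> ok a.
Proof. by rewrite /ok => -> ->. Qed.

Lemma tops_E : block_tops (blocks w) (block w) =
  packed (blocks w) (block w) (fun=> 1) * 2 ^ (block w).-1.
Proof. by rewrite mulnC packed_mull; apply: eq_packed => k _; rewrite muln1. Qed.

Lemma fill_E : block_fill (blocks w) (block w) =
  packed (blocks w) (block w) (fun=> 1) * 2 ^ (block w).-1 -
  packed (blocks w) (block w) (fun=> 1).
Proof.
rewrite mulnC packed_mull packed_sub => [|k _]; last by rewrite muln1 expn_gt0.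
by apply: eq_packed => k _; rewrite muln1 subn1.
Qed.

Lemma field_tops_E : field_tops (blocks w) (ell w) (field w) (block w) =
  packed (blocks w) (block w) (fun=> 1) * packed (ell w) (field w) (fun=> 1) *
  2 ^ (field w).-1.
Proof.
rewrite /field_tops packed_const (packed_const (ell w)).
move: (packed _ _ _) (packed _ _ _) (2 ^ _) => a b c; lia.
Qed.

Lemma wp_header r : map r const_regs = const_vals w n ->
  wp header_cmd (fun t r' M' =>
    [/\ map r' pre_regs = pre_vals w n,
      forall k, k < header -> M' (D + k) = nth 0 (header_of w n) k &
      forall a, a < D \/ D + header <= a -> M' a = M0 a]) r M0.
Proof.
move=> cE; have := cE; rewrite /const_vals.
case=> r0 r10 r11 r12 r13 r14 r15 r16 r17 r18 r19 r22 r23 r24 r25 r26 r27.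
have l99 := large_99 lw; have ww := lt_exp_w w; have w0 := w_gt0 lw.
have [WL CL] := (W_le, C_le).
have lit k : k <= 99 -> k < 2 ^ w by move=> hk; apply: leq_ltn_trans hk l99.
have tot : D + total_size w n < 2 ^ w.
  by rewrite totE hdE elE /D; clear -WL CL nw; move: nw; rewrite -/n; lia.
have [hb eb] : D + heads_at w n < 2 ^ w /\ D + elements_at w n < 2 ^ w.
  by split; apply: leq_ltn_trans tot; rewrite leq_add2l totE ?hdE; clear; lia.
have eE : 11 + 5 * (W + 1) = elements_at w n by rewrite elE addn1.
have [e1 h1] : elements_at w n < 2 ^ w /\ heads_at w n < 2 ^ w.
  by split; [apply: leq_ltn_trans eb | apply: leq_ltn_trans hb]; apply: leq_addl.
have [W1 W5] : W + 1 < 2 ^ w /\ 5 * (W + 1) < 2 ^ w.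
  by split; apply: leq_ltn_trans e1; rewrite -eE; clear; lia.
have n5 : 5 * n < 2 ^ w by apply: leq_ltn_trans h1; rewrite hdE leq_addl.
apply/wp_seq/wp_assign => /=; first by rewrite r17 eE e1 W1 W5 !lit.
rewrite r17 eE; apply/wp_seq/wp_assign; rewrite /put /=.
  by rewrite r0 -hdE h1 n5 lit.
rewrite r0 -hdE; set r1 := fun x => if x == 21 then _ else _.
have E y : y \notin [:: 20; 21] -> r1 y = r y.
  by rewrite !inE negb_or /r1 => /andP[/negbTE-> /negbTE->].
have [f20 f21] : r1 20 = elements_at w n /\ r1 21 = heads_at w n by [].
clearbody r1.
have okk k : k < 11 -> ok (D + k).
  move=> hk; apply: okE; first exact: leq_addr.
  by rewrite totE hdE elE; clear -hk; lia.
have {}r19 : r 19 = D by []. have l1 : 1 < 2 ^ w by apply: lit.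
have okw k : k < 11 -> D + k < 2 ^ w.
  by move=> /okk /andP[_ h]; apply: ltn_trans h tot.
have g0 : 0 < field w by rewrite /field addn2.
have b0 : 0 < block w by rewrite /block addn1.
have L16 := ell_ge16 lw.
have [fw bw] : (field w < w) /\ (block w < w).
  have fl := field_ell lw; have lb := ell_block_lt lw.
  split; [apply: leq_ltn_trans fl | apply: leq_ltn_trans (ltn_trans _ lb)].
  - by rewrite leq_pmulr //; apply: leq_trans L16.
  - by apply: leqnn.
  - by clear -b0 L16; nia.
have [fp bp] : (field w).-1 < w /\ (block w).-1 < w.
  by split; apply: leq_ltn_trans (leq_pred _) _.
have p0 k : 0 < 2 ^ k by rewrite expn_gt0.
have ft : field_tops (blocks w) (ell w) (field w) (block w) < 2 ^ w.
  rewrite /field_tops.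
  rewrite -(packed_nest (slots w) (ell w) (block w) (fun _ _ => packed (ell w) (field w) (fun=> 2 ^ (field w).-1))).
  apply: words_lt => // s q _ _; apply: fields_lt => q' _.
  by rewrite ltn_exp2l // ltn_predL.
have bt : block_tops (blocks w) (block w) < 2 ^ w.
  rewrite /block_tops; apply: leq_trans (packed_lt _) _; last first.
    by rewrite leq_exp2l // ltnW // blocks_block.
  by move=> k _; rewrite ltn_exp2l // ltn_predL.
have cl : packed (blocks w) (block w) (fun=> 1) <= block_tops (blocks w) (block w).
  by rewrite tops_E leq_pmulr.
move: ft bt cl; rewrite field_tops_E tops_E => ft bt cl.
do 6!(apply: wp_seq; apply: wp_put => /=;
  [by rewrite (E 19) // r19 ?okw // ?lit |
   by rewrite ?(E 24) // ?(E 13) // ?r24 ?r13 ?mul1n ?subn1 ?l1 ?g0 ?ft ?ltn_exp2l ?fp ?(ltn_trans fp ww) |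
   by rewrite (E 19) // r19; apply: okk |]).
do 5!(apply: wp_seq; apply: wp_put => /=;
  [by rewrite (E 19) // r19 ?okw // ?lit |
   by rewrite ?(E 27) // ?(E 14) // ?r27 ?r14 ?mul1n ?subn1 ?l1 ?b0 ?bt ?cl ?ltn_exp2l ?bp ?bw ?(ltn_trans bp ww) |
   by rewrite (E 19) // r19; apply: okk |]).
apply/wp_seq/wp_assign => /=; first by rewrite f20 (E 19) // r19 addnC eb.
apply: wp_assign; rewrite /put /=; first by rewrite f21 (E 19) // r19 addnC hb.
rewrite !f20 !f21 ?(E 24) ?(E 13) ?(E 27) ?(E 14) ?(E 17) ?(E 18) ?(E 10) ?(E 0) //.
split.
- by rewrite /= !E // r0 r10 r11 r12 r13 r14 r15 r16 r17 r18 r19 r22 r23 r24 r25 r26 r27 /pre_vals /const_vals /= ![_ + (n + 7)]addnC.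
- move=> k hk; rewrite (E 19) // r19 /store_at /put.
  by case: k hk => [|[|[|[|[|[|[|[|[|[|[|k]]]]]]]]]]] // _;
    rewrite !eqn_add2l /= ?r0 ?r17 ?r18 ?r24 ?r13 ?r27 ?r14 ?r10 ?mul1n ?subn1
      ?field_tops_E ?tops_E ?fill_E.
- move=> a ha; rewrite (E 19) // r19 /store_at /put.
  have ne k : k < 11 -> (a == D + k) = false.
    by move=> hk; apply/eqP; clear -ha hk; move: ha; rewrite /header; lia.
  by rewrite !ne.
Qed.

Record inv (u : nat) (Z : seq nat) (r M : store) : Prop := Inv {
  inv_cnt : r 46 = size (sorted_by_bucket w rho X W u ++ Z);
  inv_base : r 31 = size (sorted_by_bucket w rho X W u);
  inv_full : r 35 = full w rho Z;
  inv_words : ~~ full w rho Z ->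
    [/\ r 32 = word_a w rho Z, r 33 = word_b w rho Z & r 34 = word_n w rho Z];
  inv_elements : forall i, i < size (sorted_by_bucket w rho X W u ++ Z) ->
    element_ok w rho (fun k => M (D + k)) (elements_at w n + 5 * i) W C
      (sorted_by_bucket w rho X W u ++ Z) i;
  inv_heads : forall v, v < C -> M (D + (heads_at w n + v)) =
    last_pos w rho C v (sorted_by_bucket w rho X W u ++ Z) }.

Lemma wp_element u Z x r M :
  map r pre_regs = pre_vals w n ->
  (forall k, k < 7 -> M k = rho k) -> x < 2 ^ w -> r 37 = x ->
  x \notin Z -> (forall y, y \in Z -> hash w rho 0 y %% W = u) ->
  hash w rho 0 x %% W = u ->
  size (sorted_by_bucket w rho X W u ++ Z) < n ->
  inv u Z r M ->
  wp element_cmd (fun t r' M' => inv u (rcons Z x) r' M' /\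
    forall a, a < D + elements_at w n -> M' a = M a) r M.
Proof.
move=> cE Mrho xw r37 xZ Zu xu szn [i46 i31 i35 iW iE iH].
have := cE; rewrite /pre_vals /const_vals.
case=> r0 r10 r11 r12 r13 r14 r15 r16 r17 r18 r19 r22 r23 r24 r25 r26 r27 r20 r21.
set P := sorted_by_bucket w rho X W u in i46 i31 iE iH szn *.
have l99 := large_99 lw.
have hl := hash_lt w rho; have sl := sig_lt w rho; have sll := slot_lt rho lw.
have [WL [CL [W0 C0]]] := (W_le, (C_le, (W_gt0, C_gt0))).
have [eE [hE tE]] := (elE, (hdE, totE)).
have mp := modulus_gt w; have mw := modulus_lt lw; have msq := modulus_sq lw.
apply/wp_seq/(wp_conseq (wp_toeplitz (k := 2) ok l99 _ r10 _ _ _)) => //;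
  rewrite ?r37 ?Mrho ?rhow //.
move=> t1 r1 M1 k1 _ /(_ isT)-> e49 {M1}.
apply/wp_seq/wp_assign => /=.
  rewrite (k1 25) // r25; have := leq_divM (r1 49) (2 ^ sig_bits w).
  by rewrite e49; have := hl 2 x; rewrite /hash; lia.
rewrite (k1 25) // r25 modn_sub e49 -/(hash w rho 2 x) -/(sig w rho x).
apply/wp_seq/(wp_conseq (wp_poly (n := ell w) (p := modulus w) ok l99 _ _ _ _ msq _)).
- by apply: ltn_trans (blocks_lt lw) _ || have := lt_exp_w w; have := field_ell lw; rewrite /field; nia.
- by rewrite /put /= k1.
- by rewrite /put /= k1.
- by rewrite /put /=; apply: ltn_trans mp.
- by rewrite Mrho // rhow.
move=> t2 r2 M2 k2 _ /(_ isT)-> e49' {M2}.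
have E2 y : y \notin [:: 39; 49; 50; 51; 52; 53] -> r2 y = r y.
  rewrite !inE !negb_or => /and5P[h1 h2 h3 h4 /andP[h5 h6]].
  rewrite k2 /= ?inE ?negb_or ?h2 ?h4 ?h5 ?h6 // /put (negbTE h1) k1 //=.
  by rewrite ?inE ?negb_or ?h2 ?h3 ?h4 ?h5 ?h6.
have e39 : r2 39 = sig w rho x by rewrite k2.
apply/wp_seq/wp_assign => /=.
  rewrite (E2 15) // r15; have := leq_divM (r2 49) (slots w).
  have : r2 49 < 2 ^ w.
    by rewrite e49'; apply: ltn_trans mw; apply: poly_hash_lt; lia.
  by lia.
rewrite (E2 15) // r15 modn_sub e49' Mrho // [X in poly_hash _ _ _ X]/put /=.
rewrite -/(slot w rho x); set s := slot w rho x.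
set r3 := put r2 40 s.
apply/wp_seq/(wp_conseq (wp_toeplitz (k := 5) ok l99 _ _ _ _ _)) => //;
  rewrite /r3 /put /= ?E2 ?r37 ?Mrho ?rhow //.
move=> t4 r4 M4 k4 _ /(_ isT)-> e49'' {M4}.
rewrite -/(hash w rho 5 x) in e49''.
have E4 y : y \notin [:: 39; 40; 49; 50; 51; 52; 53] -> r4 y = r y.
  rewrite !inE !negb_or => /and5P[h1 h2 h3 h4 /and3P[h5 h6 h7]].
  rewrite k4 /= ?inE ?negb_or ?h3 ?h4 ?h5 ?h6 ?h7 // /put (negbTE h2) E2 //.
  by rewrite !inE !negb_or h1 h3 h4 h5 h6 h7.
have [e40 e39'] : r4 40 = s /\ r4 39 = sig w rho x by rewrite !k4.
clear k4 E2 k2 k1 e49 e39 r1 r2 r3 e49' t1 t2.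
apply/wp_seq/wp_assign => //=.
apply/wp_seq/wp_assign => /=; first lia.
rewrite e49''; set r5 := put (put r4 41 _) 42 0.
have E5 y : y \notin [:: 39; 40; 41; 42; 49; 50; 51; 52; 53] -> r5 y = r y.
  rewrite !inE !negb_or => /and5P[h1 h2 h3 h4 /and5P[h5 h6 h7 h8 h9]].
  rewrite /r5 /put (negbTE h3) (negbTE h4) E4 //.
  by rewrite !inE !negb_or h1 h2 h5 h6 h7 h8 h9.
have [f39 [f40 [f41 f42]]] : r5 39 = sig w rho x /\ r5 40 = s /\
    r5 41 = hash w rho 5 x /\ r5 42 = 0 by [].
clearbody r5; clear E4 e49'' e40 e39' r4 t4.
have szY : size (P ++ Z) = size P + size Z by rewrite size_cat.
have bound : D + total_size w n < 2 ^ w by rewrite tE hE eE /D; lia.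
have w0 : 0 < w by apply: w_gt0.
pose cnt k := count (fun y => slot w rho y == s) (take k Z).
apply: wp_seq; apply: (@wp_for _ _ (size Z) (fun k t r' M' => r' 42 = cnt k)) => //.
- lia.
- by rewrite /put /= f42 /cnt take0.
- move=> k t r' M' e42 kZ rk kp _ /(_ isT)-> {M'}.
  have E6 y : y \notin [:: 39; 40; 41; 42; 43; 49; 50; 51; 52; 53] -> r' y = r y.
    rewrite !inE !negb_or => /and5P[h1 h2 h3 h4 /and5P[h5 h6 h7 h8 /andP[h9 h10]]].
    rewrite kp /= ?inE ?negb_or ?h4 ?h5 // E5 //.
    by rewrite !inE !negb_or h1 h2 h3 h4 h6 h7 h8 h9 h10.
  have g40 : r' 40 = s by rewrite kp.
  rewrite /= (E6 46) // (E6 31) // i46 i31 szY addKn.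
  split=> //; first by rewrite leq_addr.
  move=> lt; have lt' : size P + k < size (P ++ Z) by rewrite szY ltn_add2l.
  have [_ _ _ _] := iE _ lt'; rewrite nth_cat ltnNge leq_addr /= addKn => eslot.
  have adE : r' 20 + (5 * (r' 31 + r' 43) + 4) =
      D + (elements_at w n + 5 * (size P + k) + 4).
    by rewrite (E6 20) // (E6 31) // r20 i31 rk -addnA; congr (_ + _); rewrite addnA.
  have adb : D + (elements_at w n + 5 * (size P + k) + 4) < 2 ^ w by lia.
  have cntS : cnt k.+1 = cnt k + (slot w rho (nth 0 Z k) == s).
    by rewrite /cnt (take_nth 0 lt) -cats1 count_cat /= addn0.
  apply: wp_if => /=.
  + by rewrite adE adb (E6 31) // i31 rk /=; lia.
  + rewrite adE eslot g40 => es; apply: wp_assign => /=.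
      have : cnt k <= k by apply: leq_trans (count_size _ _) _; rewrite size_take; case: ifP; lia.
      by rewrite e42; lia.
    by rewrite /put /= e42 cntS es.
  + rewrite adE eslot g40 => es; apply: wp_skip.
    by rewrite /put /= e42 cntS (negbTE es) addn0.
move=> t6 r6 M6 e42 _ k6 _ /(_ isT)-> {M6}.
have E6 y : y \notin [:: 39; 40; 41; 42; 43; 49; 50; 51; 52; 53] -> r6 y = r y.
  rewrite !inE !negb_or => /and5P[h1 h2 h3 h4 /and5P[h5 h6 h7 h8 /andP[h9 h10]]].
  rewrite k6 /= ?inE ?negb_or ?h4 ?h5 // E5 //.
  by rewrite !inE !negb_or h1 h2 h3 h4 h6 h7 h8 h9 h10.
have [g39 [g40 g41]] : r6 39 = sig w rho x /\ r6 40 = s /\ r6 41 = hash w rho 5 x.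
  by rewrite !k6.
set q := size (in_slot w rho Z s).
have g42 : r6 42 = q by rewrite e42 /cnt take_size /q size_filter.
clear e42 k6 E5 f39 f40 f41 f42 r5 cnt t6.
apply/wp_seq/wp_assign => /=; first lia.
set r7 := put r6 44 0.
have E7 y : y \notin [:: 39; 40; 41; 42; 43; 44; 49; 50; 51; 52; 53] -> r7 y = r y.
  rewrite !inE !negb_or => /and5P[h1 h2 h3 h4 /and5P[h5 h6 h7 h8 /and3P[h9 h10 h11]]].
  rewrite /r7 /put (negbTE h6) E6 //.
  by rewrite !inE !negb_or h1 h2 h3 h4 h5 h7 h8 h9 h10 h11.
have [h39 [h40 h42]] : r7 39 = sig w rho x /\ r7 40 = s /\ r7 42 = q by [].
have fullE := full_rcons rho lw Z x.
rewrite -/s -/q in fullE.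
apply: wp_seq; apply: (@wp_conseq _ _ _ (fun t r' M' =>
  [/\ M' = M, r' 35 = full w rho (rcons Z x),
    ~~ full w rho (rcons Z x) ->
      [/\ r' 32 = word_a w rho (rcons Z x), r' 33 = word_b w rho (rcons Z x) &
        r' 34 = word_n w rho (rcons Z x)] &
    q < ell w -> r' 44 = 2 ^ (block w * (s * ell w + q) + (block w).-1)])).
  apply: wp_if => /=; first by [].
    rewrite (E7 11) // r11 h42 => qL.
    have sb : s * ell w + q < blocks w.
      apply: (@leq_trans (s.+1 * ell w)); first by rewrite mulSnr ltn_add2l.
      by rewrite /blocks leq_mul2r (sll x) orbT.
    set kb := s * ell w + q in sb *.
    have b0 : 0 < block w by rewrite /block addn1.
    have posw : block w * kb + (block w).-1 < w.
      have bb := blocks_block lw; have : block w * kb.+1 <= block w * blocks w.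
        by rewrite leq_mul2l sb orbT.
      by rewrite mulnS; clear -b0 bb; lia.
    have ww := lt_exp_w w.
    have [wa wb] : word_a w rho (rcons Z x) < 2 ^ w /\
      word_b w rho (rcons Z x) < 2 ^ w.
      by split; [apply: word_a_lt | apply: word_b_lt].
    have sL : s * ell w <= kb by rewrite /kb leq_addr.
    have kbl : kb <= block w * kb by rewrite leq_pmull.
    have lt1 : block w * kb < 2 ^ w by apply: leq_ltn_trans (ltn_trans posw ww); apply: leq_addr.
    have kbw := leq_ltn_trans kbl lt1; have sLw := leq_ltn_trans sL kbw.
    have l1 : 1 < 2 ^ w by apply: leq_trans l99.
    apply/wp_seq/wp_assign => /=.
      by rewrite (E7 14) // (E7 11) // r14 r11 h40 h42 sLw kbw lt1.
    rewrite (E7 14) // (E7 11) // r14 r11 h40 h42 -/kb.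
    apply/wp_seq/wp_assign => /=.
      by rewrite /put /= (E7 14) // r14 l1 b0 !mul1n !subn1 ltn_exp2l // (ltn_trans posw ww) posw.
    set r8 := put (put r7 45 _) 44 _.
    have e44 : r8 44 = 2 ^ (block w * kb + (block w).-1).
      by rewrite /r8 /put /= (E7 14) // r14 mul1n subn1.
    have e45 : r8 45 = block w * kb by [].
    have E8 y : y \notin [:: 39; 40; 41; 42; 43; 44; 45; 49; 50; 51; 52; 53] -> r8 y = r y.
      rewrite !inE !negb_or => /and5P[h1 h2 h3 h4 /and5P[h5 h6 h7 h8 /and4P[h9 h10 h11 h12]]].
      rewrite /r8 /put (negbTE h6) (negbTE h7) E7 //.
      by rewrite !inE !negb_or h1 h2 h3 h4 h5 h6 h8 h9 h10 h11 h12.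
    have [e39 [e40 e42]] : r8 39 = sig w rho x /\ r8 40 = s /\ r8 42 = q by [].
    clearbody r8; apply: wp_if => /=; first by rewrite (ltn_trans _ l1).
      rewrite (E8 35) // i35 eqb0 => nf.
      have nf' : ~~ full w rho (rcons Z x) by rewrite fullE negb_or nf -ltnNge.
      have [ea eb en] := iW nf.
      have sz : size (in_slot w rho Z (slot w rho x)) < ell w by [].
      have wn := word_n_lt lw nf'.
      move: wa wb wn; rewrite !word_a_rcons // !word_b_rcons // !word_n_rcons // -/s -/q -/kb.
      set R1 := packed (ell w) (field w) _; set R2 := packed (ell w) (block w) _.
      have [R1p R2p] : 0 < R1 /\ 0 < R2.
        by split; apply: packed_ones_gt0; have := ell_ge16 lw; case: (ell w).
      move=> wa wb wn.
      have a1 := leq_ltn_trans (leq_addl _ _) wa.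
      have a2 : (sig w rho x + 2) * R1 < 2 ^ w.
        by apply: leq_ltn_trans a1; rewrite leq_pmulr // expn_gt0.
      have a3 : sig w rho x + 2 < 2 ^ w by apply: leq_ltn_trans a2; rewrite leq_pmulr.
      have b1 := leq_ltn_trans (leq_addl _ _) wb.
      have b2 : (sig w rho x + 1) * 2 ^ (field w * q) * R2 < 2 ^ w.
        by apply: leq_ltn_trans b1; rewrite leq_pmulr // expn_gt0.
      have b3 : (sig w rho x + 1) * 2 ^ (field w * q) < 2 ^ w.
        by apply: leq_ltn_trans b2; rewrite leq_pmulr.
      have b4 : sig w rho x + 1 < 2 ^ w.
        by apply: leq_ltn_trans b3; rewrite leq_pmulr // expn_gt0.
      have b5 : 2 ^ (field w * q) < 2 ^ w.
        by apply: leq_ltn_trans b3; rewrite leq_pmull // addn1.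
      have fq : field w * q < 2 ^ w by apply: ltn_trans (ltn_expl _ _) b5.
      have bs : block w * (s * ell w) < 2 ^ w.
        by apply: leq_ltn_trans lt1; rewrite leq_mul2l sL orbT.
      have b6 : 2 ^ (block w * (s * ell w)) < 2 ^ w.
        by apply: leq_ltn_trans b1; rewrite leq_pmull // !muln_gt0 addn1 R2p expn_gt0.
      have a4 : 2 ^ (block w * kb) < 2 ^ w.
        by apply: leq_ltn_trans a1; rewrite leq_pmull // !muln_gt0 addn2 R1p.
      have n1 := leq_ltn_trans (leq_addl _ _) wn.
      have l2 : 2 < 2 ^ w by apply: leq_trans l99.
      apply/wp_seq/wp_assign => /=.
        by rewrite e39 e45 (E8 22) // r22 (E8 32) // ea !mul1n l1 l2 a3 a2 a4 a1 wa.
      rewrite e39 e45 (E8 22) // r22 (E8 32) // ea !mul1n.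
      apply/wp_seq/wp_assign; rewrite /put /=.
        rewrite e39 e40 e42 (E8 13) // r13 (E8 23) // r23 (E8 14) // r14 (E8 11) // r11.
        by rewrite (E8 33) // eb !mul1n l1 b4 fq b5 b3 b2 sLw bs b6 b1 wb.
      rewrite e39 e40 e42 (E8 13) // r13 (E8 23) // r23 (E8 14) // r14 (E8 11) // r11.
      rewrite (E8 33) // eb !mul1n; apply: wp_assign => /=.
        rewrite e45 (E8 46) // (E8 31) // (E8 34) // i46 i31 en szY addKn !mul1n.
        by rewrite l1 a4 n1 wn leq_addr.
      rewrite e45 (E8 46) // (E8 31) // (E8 34) // i46 i31 en szY addKn !mul1n.
      rewrite /put /= (E8 35) // i35 fullE (negbTE nf) leqNgt qL; split=> //.
    rewrite (E8 35) // i35 eqb0 negbK => fz; apply: wp_skip.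
    by split; rewrite ?fullE ?fz //= (E8 35) // i35 fz.
  rewrite (E7 11) // r11 h42 -leqNgt => qL.
  apply: wp_assign => /=; first lia.
  rewrite fullE qL orbT /put /=; split=> //; lia.
move=> t8 r8 M8 k8 _ _ [-> e35 eW e44] {M8}.
have E8 y : y \notin [:: 32; 33; 34; 35; 39; 40; 41; 42; 43; 44; 45; 49; 50; 51; 52; 53] -> r8 y = r y.
  rewrite !inE !negb_or => /and5P[h1 h2 h3 h4 /and5P[h5 h6 h7 h8 /and5P[h9 h10 h11 h12 /and4P[h13 h14 h15 h16]]]].
  rewrite k8 /= ?inE ?negb_or ?h1 ?h2 ?h3 ?h4 ?h10 ?h11 // E7 //.
  by rewrite !inE !negb_or h5 h6 h7 h8 h9 h10 h12 h13 h14 h15 h16.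
have [g40' g41'] : r8 40 = s /\ r8 41 = hash w rho 5 x by rewrite !k8.
clear k8 E7 E6 g39 g40 g41 g42 h39 h40 h42 r7 r6.
set h := hash w rho 5 x in g41' *.
have hC : h %% C < C by rewrite ltn_mod.
set el := elements_at w n + 5 * size (P ++ Z).
have e47 : r8 20 + 5 * r8 46 = D + el.
  by rewrite (E8 20) // (E8 46) // r20 i46 /el addnA.
have e48 : r8 21 + (r8 41 - r8 41 %/ r8 18 * r8 18) = D + (heads_at w n + h %% C).
  by rewrite (E8 21) // (E8 18) // r21 r18 g41' modn_sub addnA.
have okA i : i <= 4 -> ok (D + el + i) && (D + el + i < 2 ^ w).
  move=> hi; have lt : D + el + i < D + total_size w n.
    by rewrite /el tE hE -/n; clear -szn hi C0; lia.
  by rewrite okE ?(ltn_trans lt bound) // -addnA leq_addr.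
have okH : ok (D + (heads_at w n + h %% C)) && (D + (heads_at w n + h %% C) < 2 ^ w).
  have lt : D + (heads_at w n + h %% C) < D + total_size w n.
    by rewrite tE; clear -hC; lia.
  by rewrite okE ?(ltn_trans lt bound) // leq_addr.
apply: (@wp_conseq _ _ _ (fun t r' M' => r' 46 = r8 46 + 1 /\
    M' = store_at (store_at (store_at (store_at (store_at (store_at M
      (D + el + 0) (r8 37)) (D + el + 1) (r8 41)) (D + el + 2) (r8 44))
      (D + el + 3) (M (D + (heads_at w n + h %% C))))
      (D + el + 4) (r8 40)) (D + (heads_at w n + h %% C)) (r8 46 + 1))).
  apply: wp_record => //.
  - by rewrite -e48 modn_sub.
  - by rewrite g41' hl.
  - by rewrite (E8 46) // i46; clear -szn nw; move: nw; rewrite -/n; lia.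
  - by rewrite /el hE; clear -szn; lia.
move=> t9 r9 M9 k9 _ _ [e46 M9E].
have E9 y : y \notin [:: 46; 47; 48] -> r9 y = r8 y.
  rewrite !inE !negb_or => /and3P[h1 h2 h3].
  by rewrite k9 // ?inE ?negb_or h1 h2 h3.
have Mout b : b < D + el \/ D + el + 4 < b -> b != D + (heads_at w n + h %% C) ->
    M9 b = M b.
  move=> hb nb; rewrite M9E /store_at /put (negbTE nb).
  have ne i : i <= 4 -> (b == D + el + i) = false by move=> hi; apply/eqP; clear -hb hi; lia.
  by rewrite !ne.
have Min : [/\ M9 (D + (el + 0)) = x, M9 (D + (el + 1)) = h, M9 (D + (el + 2)) = r8 44,
    M9 (D + (el + 3)) = M (D + (heads_at w n + h %% C)) & M9 (D + (el + 4)) = s].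
  rewrite ![D + (el + _)]addnA M9E /store_at /put.
  have ne i : i <= 4 -> (D + el + i == D + (heads_at w n + h %% C)) = false.
    by move=> hi; apply/eqP; rewrite /el hE; clear -szn hi; lia.
  by rewrite !ne // !eqn_add2l /= (E8 37) // r37 g40' g41'.
have Mhd : M9 (D + (heads_at w n + h %% C)) = (size (P ++ Z)).+1.
  by rewrite M9E /store_at /put eqxx (E8 46) // i46 addn1.
have sz' : size (P ++ rcons Z x) = (size (P ++ Z)).+1 by rewrite -rcons_cat size_rcons.
split; last first.
  move=> a ha; apply: Mout; first by left; apply: leq_trans ha _; rewrite leq_add2l leq_addr.
  by apply/eqP; clear -ha hE; lia.
split; rewrite -/P.
- by rewrite e46 (E8 46) // i46 sz' addn1.
- by rewrite (E9 31) // (E8 31).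
- by rewrite (E9 35).
- by rewrite (E9 32) // (E9 33) // (E9 34).
- move=> i; rewrite sz' ltnS leq_eqVlt -rcons_cat => /orP[/eqP-> | lt].
    case: Min => m0 m1 m2 m3 m4.
    have rk : rank w rho W (rcons (P ++ Z) x) (size (P ++ Z)) = q by apply: rank_new.
    rewrite /element_ok nth_rcons ltnn eqxx rk -/el -[el in M9 (D + el)]addn0.
    rewrite m0 m1 m2 m3 m4 -cats1 take_size_cat //; split=> //.
    by rewrite iH.
  apply: element_ok_rcons => //; apply: element_ok_ext (iE _ lt) => k k5.
  apply: Mout; first by left; rewrite /el; clear -lt k5; lia.
  by apply/eqP; rewrite hE; clear -lt k5 szn; lia.
- move=> v vC; rewrite -rcons_cat last_pos_rcons; case: eqP => [<- // | /eqP ne].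
  rewrite Mout ?iH //; last by rewrite !eqn_add2l eq_sym.
  by right; rewrite /el hE; clear -szn; lia.
Qed.


Lemma inv_regs u Z r r' M : (forall y, y \in [:: 46; 31; 32; 33; 34; 35] -> r' y = r y) ->
  inv u Z r M -> inv u Z r' M.
Proof.
move=> e [h1 h2 h3 h4 h5 h6]; split=> //; rewrite ?e //.
Qed.

Record stage (u : nat) (r M : store) : Prop := Stage {
  stage_cnt : r 46 = size (sorted_by_bucket w rho X W u);
  stage_low : forall a, a < D -> M a = M0 a;
  stage_header : forall k, k < header -> M (D + k) = nth 0 (header_of w n) k;
  stage_bucket : forall v, v < u ->
    bucket_ok w rho (fun k => M (D + k)) (header + 5 * v)
      (size (sorted_by_bucket w rho X W v)) (bucket w rho W X v);
  stage_elements : forall i, i < size (sorted_by_bucket w rho X W u) ->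
    element_ok w rho (fun k => M (D + k)) (elements_at w n + 5 * i) W C
      (sorted_by_bucket w rho X W u) i;
  stage_heads : forall v, v < C -> M (D + (heads_at w n + v)) =
    last_pos w rho C v (sorted_by_bucket w rho X W u) }.

Lemma wp_bucket u r M : map r pre_regs = pre_vals w n -> r 30 = u -> u < W ->
  stage u r M -> wp bucket_cmd (fun t r' M' => stage u.+1 r' M') r M.
Proof.
move=> cE r30 uW [i46 ilow ihd ibk iel ihe].
have := cE; rewrite /pre_vals /const_vals.
case=> r0 r10 r11 r12 r13 r14 r15 r16 r17 r18 r19 r22 r23 r24 r25 r26 r27 r20 r21.
have l99 := large_99 lw; have w0 := w_gt0 lw.
have lit k : k <= 99 -> k < 2 ^ w by move=> hk; apply: leq_ltn_trans hk l99.
have [WL CL] := (W_le, C_le).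
have tot : D + total_size w n < 2 ^ w.
  by rewrite totE hdE elE /D; clear -WL CL nw; move: nw; rewrite -/n; lia.
have n7 : n + 7 < 2 ^ w by apply: leq_ltn_trans tot; apply: leq_addr.
have nw' : n < 2 ^ w by apply: leq_ltn_trans n7; apply: leq_addr.
do 5!(apply/wp_seq/wp_assign => /=; first by rewrite ?lit).
set r1 := put _ 35 0.
have E y : y \notin [:: 31; 32; 33; 34; 35] -> r1 y = r y.
  by rewrite !inE !negb_or /r1 /put => /and5P[/negbTE-> /negbTE-> /negbTE-> /negbTE-> /negbTE->].
have i1 : inv u [::] r1 M.
  split; rewrite ?cats0 ?full_nil //.
  by move=> _; rewrite word_a_nil word_b_nil word_n_nil /r1 /put /= r24.
clearbody r1; apply/wp_seq; apply: (@wp_for _ _ n (fun j t r' M' =>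
   inv u (bucket w rho W (take j X) u) r' M' /\
   forall a, a < D + elements_at w n -> M' a = M a)) => //.
- by split=> //; rewrite take0; apply: inv_regs i1 => y hy;
    rewrite /put; case: eqP hy => // ->.
- move=> j t r' M' [ij jlow] jn rj kp _ _.
  have K y : y \in pre_regs ++ [:: 30] -> r' y = r y.
    move=> hy; rewrite kp ?E //; first by move: y hy; apply/allP.
    by move: y hy; apply/allP.
  have cE' : map r' pre_regs = pre_vals w n.
    by rewrite -cE; apply/eq_in_map => y hy; apply: K; rewrite mem_cat hy.
  split=> //; first by rewrite /= K // r0.
  move=> lt; set x := nth 0 X j; have xX : x \in X by apply: mem_nth.
  have low7 k : k < 7 -> M' k = rho k.
    move=> hk; rewrite jlow ?ilow ?M0rho //; rewrite /D; clear -hk; lia.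
  have Mx : M' (7 + j) = x.
    by rewrite jlow ?ilow ?M0X //; rewrite /D; clear -lt; lia.
  apply/wp_seq/wp_assign => /=.
    by rewrite rj lit //=; apply: leq_ltn_trans n7; rewrite addnC leq_add2r.
  rewrite rj Mx.
  apply/wp_seq/(wp_conseq (wp_toeplitz (k := 0) ok l99 _ _ _ _ _)) => //.
  - by rewrite /put /= K // r10.
  - by rewrite /put /=; apply: Xw.
  - by rewrite low7 // rhow.
  - by rewrite low7 // rhow.
  move=> t2 r2 M2 k2 _ /(_ isT)-> e49.
  rewrite [put _ _ _ 37]/put /= !low7 // -/(hash w rho 0 x) in e49.
  have K2 y : y \notin [:: 37; 49; 50; 51; 52; 53] -> r2 y = r' y.
    rewrite !inE !negb_or => /and5P[h1 h2 h3 h4 /andP[h5 h6]].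
    by rewrite k2 /= ?inE ?negb_or ?h2 ?h3 ?h4 ?h5 ?h6 // /put (negbTE h1).
  have r2x : r2 37 = x by rewrite k2.
  clear k2; set Z := bucket w rho W (take j X) u in ij.
  have ZS : bucket w rho W (take j.+1 X) u =
      if hash w rho 0 x %% W == u then rcons Z x else Z.
    by rewrite (take_nth 0 lt) /bucket filter_rcons.
  have ij2 : inv u Z r2 M'.
    by apply: inv_regs ij => y hy; apply: K2; move: y hy; apply/allP.
  have r2j : r2 36 = j by rewrite K2.
  have d17 := leq_divM (hash w rho 0 x) W.
  apply: wp_if => /=.
  + by rewrite (K2 17) // K // r17 e49 d17 andbT (leq_ltn_trans d17 (hash_lt w rho 0 x)).
  + rewrite (K2 17) // K // r17 e49 modn_sub (K2 30) // (K 30) // r30 => /eqP xu.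
    have xZ : x \notin Z.
      rewrite mem_filter negb_and; apply/orP; right.
      by rewrite in_take_leq ?index_uniq ?ltnn // ltnW.
    have Zu y : y \in Z -> hash w rho 0 y %% W = u.
      by rewrite mem_filter => /andP[/eqP].
    have szn : size (sorted_by_bucket w rho X W u ++ Z) < n.
      apply: leq_trans (size_sorted_by_bucket w rho X W_gt0 uW).
      rewrite sorted_by_bucketS !size_cat ltn_add2l.
      rewrite -(cat_take_drop j.+1 X) [bucket _ _ _ (_ ++ _) _]filter_cat size_cat.
      by rewrite -/(bucket w rho W (take j.+1 X) u) ZS xu eqxx size_rcons leq_addr.
    have cE2 : map r2 pre_regs = pre_vals w n.
      by rewrite -cE'; apply/eq_in_map => y hy; apply: K2; move: y hy; apply/allP.
    apply: (wp_conseq (wp_element cE2 low7 (Xw xX) r2x xZ Zu xu szn ij2)).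
    move=> t3 r3 M3 k3 _ _ [i3 l3]; split; first by rewrite k3.
    split; last by move=> a ha; rewrite l3 ?jlow.
    rewrite ZS xu eqxx; apply: inv_regs i3 => y hy.
    by rewrite /put; case: eqP hy => // ->.
  + rewrite (K2 17) // K // r17 e49 modn_sub (K2 30) // (K 30) // r30 => /negbTE xu.
    apply: wp_skip; split=> //; split=> //.
    rewrite ZS xu; apply: inv_regs ij2 => y hy.
    by rewrite /put; case: eqP hy => // ->.
move=> t2 r2 M2 [i2 l2] _ kp _ _.
rewrite take_size in i2; set Z := bucket w rho W X u in i2.
have K y : y \in pre_regs ++ [:: 30] -> r2 y = r y.
  move=> hy; rewrite kp ?E //; first by move: y hy; apply/allP.
  by move: y hy; apply/allP.
set a := D + (header + 5 * u).
have aE : r2 19 + (11 + 5 * r2 30) = a by rewrite (K 19) // (K 30) // r19 r30.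
have lta : a + 5 <= D + elements_at w n by rewrite /a elE /header; clear -uW; lia.
have eltot : D + elements_at w n <= D + total_size w n.
  by rewrite leq_add2l totE hdE; clear; lia.
have okA i : i < 5 -> ok (a + i) && (a + i < 2 ^ w).
  move=> hi; have lt : a + i < D + total_size w n.
    by apply: leq_trans eltot; apply: leq_trans lta; rewrite ltn_add2l.
  by rewrite okE ?(ltn_trans lt tot) // /a -addnA leq_addr.
have [okA1 okA2] : (forall i, i < 5 -> ok (a + i)) /\ (forall i, i < 5 -> a + i < 2 ^ w).
  by split=> i /okA /andP[].
have aw : a < 2 ^ w by have := okA2 0 isT; rewrite addn0.
apply/wp_seq/wp_assign => /=.
  have b1 : 11 + 5 * r2 30 < 2 ^ w by apply: leq_ltn_trans aw; rewrite -aE leq_addl.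
  have b2 : 5 * r2 30 < 2 ^ w by apply: leq_ltn_trans b1; apply: leq_addl.
  by rewrite aE aw b1 b2 (lit 11) // (lit 5).
rewrite aE; set r3 := put r2 47 a.
have [e47 e32 e33 e34 e31] : [/\ r3 47 = a, r3 32 = r2 32, r3 33 = r2 33, r3 34 = r2 34 & r3 31 = r2 31] by [].
have [e35 e46] : r3 35 = r2 35 /\ r3 46 = r2 46 by [].
clearbody r3.
do 4!(apply: wp_seq; apply: wp_put => /=;
  [by rewrite e47 okA2 // lit | by [] | by rewrite e47; apply: okA1 |]).
apply: wp_put => /=; [by rewrite e47 okA2 // lit | by [] | by rewrite e47; apply: okA1 |].
rewrite e47 e32 e33 e34 e31 e35; case: i2 => j46 j31 j35 jW jE jH.
set M3 := store_at _ _ _.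
have Mout b : b < a \/ a + 5 <= b -> M3 b = M2 b.
  move=> hb; rewrite /M3 /store_at /put.
  have ne i : i < 5 -> (b == a + i) = false by move=> hi; apply/eqP; clear -hb hi; lia.
  by rewrite !ne.
have Min : [/\ M3 (a + 0) = r2 32, M3 (a + 1) = r2 33, M3 (a + 2) = r2 34,
    M3 (a + 3) = r2 31 & M3 (a + 4) = r2 35].
  by rewrite /M3 /store_at /put !eqn_add2l.
clearbody M3; have D0 : D <= a by apply: leq_addr.
split.
- by rewrite e46 j46 sorted_by_bucketS.
- move=> b hb; rewrite Mout; last by left; apply: leq_trans hb D0.
  by rewrite l2 ?ilow //; apply: leq_trans hb (leq_addr _ _).
- move=> k hk; rewrite Mout; last by left; rewrite /a ltn_add2l; apply: leq_trans hk (leq_addr _ _).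
  by rewrite l2 ?ihd // ltn_add2l elE; move: hk; rewrite /header; clear; lia.
- move=> v; rewrite ltnS leq_eqVlt => /orP[/eqP-> | vu].
    case: Min => m0 m1 m2 m3 m4; rewrite /a -!addnA in m0 m1 m2 m3 m4.
    rewrite /bucket_ok -!addnA m3 m4 j31 j35; split=> // nf.
    by have [<- <- <-] := jW nf; rewrite m1 m2; split=> //; rewrite -m0 addn0.
  have get k : k < 5 -> M3 (D + (header + 5 * v + k)) = M (D + (header + 5 * v + k)).
    move=> hk; rewrite Mout; last by left; rewrite /a; clear -vu hk; lia.
    by apply: l2; rewrite ltn_add2l elE /header; clear -hk vu uW; lia.
  exact: bucket_ok_ext get (ibk _ vu).
- rewrite sorted_by_bucketS => i hi; apply: element_ok_ext (jE _ hi) => k k5.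
  by rewrite Mout //; right; apply: leq_trans lta _; rewrite leq_add2l -addnA leq_addr.
- move=> v hv; rewrite sorted_by_bucketS Mout ?jH //.
  by right; apply: leq_trans lta _; rewrite leq_add2l hdE -addnA leq_addr.
Qed.

Lemma wp_pre r : (forall a, D <= a -> M0 a = 0) -> r 0 = n ->
  wp pre_cmd (fun t r' M' => [/\ r' 0 = total_size w n, r' 1 = D &
    represents w rho X (fun k => M' (D + k))]) r M0.
Proof.
move=> M0z r0; have l99 := large_99 lw; have w0 := w_gt0 lw.
have lit k : k <= 99 -> k < 2 ^ w by move=> hk; apply: leq_ltn_trans hk l99.
have [WL CL] := (W_le, C_le).
have tot : D + total_size w n < 2 ^ w.
  by rewrite totE hdE elE /D; clear -WL CL nw; move: nw; rewrite -/n; lia.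
have totw : total_size w n < 2 ^ w by apply: leq_ltn_trans tot; apply: leq_addl.
have W5 : 11 + 5 * W + 3 < total_size w n.
  by rewrite totE hdE elE; have := C_gt0; clear; lia.
have Ww : W < 2 ^ w by apply: leq_ltn_trans totw; apply: leq_trans (ltnW W5); clear; lia.
apply/wp_seq/(wp_conseq (wp_setup lw ok M0 nw r0)) => t1 r1 M1 k1 _ /(_ isT)-> c1 {M1}.
apply/wp_seq/(wp_conseq (wp_header c1)) => t2 r2 M2 k2 _ _ [c2 hd lo].
apply/wp_seq/wp_assign => /=; first by rewrite lit.
apply/wp_seq; apply: (@wp_for _ _ W (fun u t r' M' => stage u r' M')) => //.
- split=> //.
  + by move=> a ha; apply: lo; left.
  + move=> v hv; rewrite lo; last by right; rewrite leq_add2l hdE elE /header; clear; lia.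
    by rewrite M0z // leq_addr.
- move=> u t r' M' st uW ru kp _ _.
  have K y : y \in pre_regs -> r' y = r2 y.
    move=> hy; rewrite kp; last by move: y hy; apply/allP.
    by rewrite /put; case: eqP hy => // ->.
  have c' : map r' pre_regs = pre_vals w n by rewrite -c2; apply/eq_in_map => y /K.
  split=> //; first by rewrite /= K //; case: c2.
  move=> lt; apply: (wp_conseq (wp_bucket c' ru lt st)).
  move=> t3 r3 M3 k3 _ _ [s1 s2 s3 s4 s5 s6]; split; first by rewrite k3.
  by split.
move=> t3 r3 M3 [s1 s2 s3 s4 s5 s6] _ kp _ _.
have K y : y \in pre_regs -> r3 y = r2 y.
  move=> hy; rewrite kp; last by move: y hy; apply/allP.
  by rewrite /put; case: eqP hy => // ->.
have := c2; rewrite /pre_vals /const_vals.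
case=> q0 _ _ _ _ _ _ _ q17 q18 q19 _ _ _ _ _ _ q20 q21.
have e17 : r3 17 = W by rewrite K.
have e19 : r3 19 = D by rewrite K.
have e0 : r3 0 = n by rewrite K.
have e21 : r3 21 = D + heads_at w n by rewrite K.
have e18 : r3 18 = C by rewrite K.
set a := 11 + 5 * W + 3.
have aw : D + a < 2 ^ w by apply: ltn_trans tot; rewrite ltn_add2l.
have a1 : a < 2 ^ w by apply: leq_ltn_trans aw; apply: leq_addl.
have a2 : 11 + 5 * W < 2 ^ w by apply: leq_ltn_trans a1; apply: leq_addr.
have a3 : 5 * W < 2 ^ w by apply: leq_ltn_trans a2; apply: leq_addl.
apply: wp_seq; apply: wp_put => /=.
- by rewrite e17 e19 -/a a3 a2 a1 aw (lit 11) // (lit 5) // (lit 3).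
- by [].
- by rewrite e17 e19 -/a; apply: okE; rewrite ?leq_addr // ltn_add2l.
rewrite e17 e19 e0 -/a.
have De : D + heads_at w n + C = D + total_size w n by rewrite totE addnA.
apply/wp_seq/wp_assign => /=.
  by rewrite e21 e18 e19 De tot leq_addr.
apply: wp_assign; rewrite /put //= e19 e21 e18 De addKn; split=> //.
set M4 := store_at M3 _ _.
have Mo b : b != D + a -> M4 b = M3 b by rewrite /M4 /store_at /put => /negbTE->.
have Ma : M4 (D + a) = n by rewrite /M4 /store_at /put eqxx.
clearbody M4.
have szn := perm_size (perm_sorted_by_bucket w rho X W_gt0).
split.
- by move=> k hk; rewrite Mo ?s3 // eqn_add2l /a; move: hk; rewrite /header; clear; lia.
- move=> u hu; have get k : k < 5 -> M4 (D + (header + 5 * u + k)) = M3 (D + (header + 5 * u + k)).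
    by move=> hk; rewrite Mo // eqn_add2l /a /header; move: hu; rewrite -/W -/n; clear -hk; lia.
  exact: bucket_ok_ext get (s4 _ hu).
- by [].
- move=> j hj; have hj' : j < size (sorted_by_bucket w rho X W W) by rewrite szn.
  apply: element_ok_ext (s5 _ hj') => k k5; rewrite Mo // eqn_add2l /a elE.
  by clear; lia.
- move=> v hv; rewrite Mo ?s6 // eqn_add2l /a hdE elE.
  by clear; lia.
Qed.

End Pre.


(** * Reading the representation *)

Lemma pow2above_dvd j k : j <= k -> pow2above j %| pow2above k.
Proof. by move=> h; rewrite !pow2aboveE dvdn_exp2l // leq_up_log. Qed.

Lemma leq_sum_subseq (F : nat -> nat) s1 s2 :
  uniq s1 -> uniq s2 -> {subset s1 <= s2} ->
  \sum_(x <- s1) F x <= \sum_(x <- s2) F x.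
Proof.
move=> u1 u2 sub; rewrite [X in _ <= X](bigID (mem s1)) /= -[X in X <= _]addn0.
apply: leq_add => //; rewrite -[X in _ <= X]big_filter (perm_big [seq x <- s2 | x \in s1]) //.
apply: uniq_perm => //; first exact: filter_uniq.
by move=> x; rewrite mem_filter; case: (boolP (x \in s1)) => // /sub ->.
Qed.

Section Reading.
Variables (w : nat) (rho : nat -> nat).
Hypothesis lw : large w.
Local Notation L := (ell w).
Local Notation slot := (slot w rho).
Local Notation sig := (sig w rho).
Local Notation in_slot := (in_slot w rho).
Local Notation hash := (hash w rho).
Local Notation Q := (blocks w).
Local Notation G := (block w).

Lemma last_posP n v S :
  let cls x := hash 5 x %% n == v in
  let j := last_pos w rho n v S in
  (j = 0 /\ count cls S = 0) \/
  [/\ 0 < j <= size S, cls (nth 0 S j.-1),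
    count cls S = (count cls (take j.-1 S)).+1 &
    forall z, cls z -> (z \in S) = (z == nth 0 S j.-1) || (z \in take j.-1 S)].
Proof.
move=> cls; elim/last_ind: S => [|S x IH]; first by left.
rewrite last_pos_rcons -/(cls x); case cx: (cls x) => /=.
  right; rewrite size_rcons leqnn nth_rcons ltnn eqxx -cats1 take_size_cat //.
  split=> //; first by rewrite count_cat /= cx addn0 addn1.
  by move=> z cz; rewrite mem_cat inE orbC.
case: IH => [[j0 c0] | [/andP[j0 jS] cj cE mE]].
  by left; split=> //; rewrite -cats1 count_cat /= cx c0.
right; set j := last_pos _ _ _ _ _ in j0 jS cj cE mE *.
have lt : j.-1 < size S by rewrite prednK.
rewrite size_rcons nth_rcons lt -cats1 takel_cat; last exact: ltnW.
rewrite j0 ltnW // count_cat /= cx !addn0; split=> // z cz.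
rewrite mem_cat mE // inE; case: (z =P x) => [e | _]; last by rewrite orbF.
by rewrite e cx in cz.
Qed.

Lemma full_slot Z s : ~~ full w rho Z -> size (in_slot Z s) <= L.
Proof.
move=> /hasPn nf; case: (ltnP s (slots w)) => hs.
  by rewrite leqNgt; apply: nf; rewrite mem_iota.
have -> : in_slot Z s = [::]; last by [].
apply/eqP; rewrite -[_ == _]negbK -has_filter; apply/hasP => -[x _ /eqP e].
by have := slot_lt rho lw x; rewrite e ltnNge hs.
Qed.

Definition elt (Z : seq nat) (k : nat) : nat := nth 0 (in_slot Z (k %/ L)) (k %% L).
Definition occupied (Z : seq nat) (k : nat) : bool :=
  k %% L < size (in_slot Z (k %/ L)).
Definition place (Z : seq nat) (x : nat) : nat :=
  slot x * L + index x (in_slot Z (slot x)).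

Lemma L_gt0 : 0 < L. Proof. by have := ell_ge16 lw; case: L. Qed.

Lemma mem_in_slot Z x : (x \in in_slot Z (slot x)) = (x \in Z).
Proof. by rewrite mem_filter eqxx. Qed.

Section Good.
Variable Z : seq nat.
Hypotheses (uZ : uniq Z) (nfZ : ~~ full w rho Z).

Lemma index_slot_lt x : x \in Z -> index x (in_slot Z (slot x)) < L.
Proof.
by move=> xZ; apply: leq_trans (full_slot (slot x) nfZ); rewrite index_mem mem_in_slot.
Qed.

Lemma place_div x : x \in Z -> place Z x %/ L = slot x.
Proof.
move=> xZ; rewrite /place divnMDl ?L_gt0 // divn_small ?addn0 //.
exact: index_slot_lt.
Qed.

Lemma place_mod x : x \in Z -> place Z x %% L = index x (in_slot Z (slot x)).
Proof. by move=> xZ; rewrite /place modnMDl modn_small // index_slot_lt. Qed.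

Lemma place_lt x : x \in Z -> place Z x < Q.
Proof.
move=> xZ; rewrite /place /blocks; apply: (@leq_trans ((slot x).+1 * L)).
  by rewrite mulSnr ltn_add2l index_slot_lt.
by rewrite leq_mul2r slot_lt ?orbT.
Qed.

Lemma elt_place x : x \in Z -> elt Z (place Z x) = x.
Proof. by move=> xZ; rewrite /elt place_div ?place_mod // nth_index // mem_in_slot. Qed.

Lemma occupied_place x : x \in Z -> occupied Z (place Z x).
Proof. by move=> xZ; rewrite /occupied place_div ?place_mod // index_mem mem_in_slot. Qed.

Lemma elt_mem k : occupied Z k -> elt Z k \in Z.
Proof. by move=> /(mem_nth 0); rewrite mem_filter => /andP[]. Qed.

Lemma slot_elt k : occupied Z k -> slot (elt Z k) = k %/ L.
Proof. by move=> /(mem_nth 0); rewrite mem_filter => /andP[/eqP]. Qed.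

Lemma place_elt k : occupied Z k -> place Z (elt Z k) = k.
Proof.
move=> o; rewrite /place slot_elt // index_uniq //; last exact: filter_uniq.
by rewrite {3}(divn_eq k L).
Qed.

Lemma rank_place n (u : nat) X x : u < n -> Z = bucket w rho n X u -> x \in Z ->
  rank w rho n (sorted_by_bucket w rho X n n)
    (size (sorted_by_bucket w rho X n u) + index x Z) =
  index x (in_slot Z (slot x)) /\
  nth 0 (sorted_by_bucket w rho X n n)
    (size (sorted_by_bucket w rho X n u) + index x Z) = x.
Proof.
move=> n0 ZE xZ.
have xu : hash 0 x %% n = u by move: xZ; rewrite ZE mem_filter => /andP[/eqP].
have ix : index x Z < size Z by rewrite index_mem.
set j := _ + _.
have YE : exists Y', sorted_by_bucket w rho X n n =
    (sorted_by_bucket w rho X n u ++ Z) ++ Y'.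
  rewrite ZE -sorted_by_bucketS /sorted_by_bucket -(subnKC n0) iotaD map_cat flatten_cat.
  by eexists.
case: YE => Y' YE.
have nthE : nth 0 (sorted_by_bucket w rho X n n) j = x.
  by rewrite YE -catA nth_cat ltnNge leq_addr /= addKn nth_cat ix nth_index.
split=> //; rewrite /rank nthE xu YE -catA take_cat ltnNge leq_addr /= addKn.
rewrite takel_cat; last exact: ltnW.
rewrite count_cat (_ : count _ (sorted_by_bucket _ _ _ _ _) = 0) ?add0n; last first.
  apply/eqP; rewrite -leqn0 leqNgt -has_count; apply/hasP => -[y].
  by rewrite mem_sorted_by_bucket => /andP[_ lt] /andP[/eqP e]; rewrite e ltnn in lt.
have Zu y : y \in Z -> hash 0 y %% n = u by rewrite ZE mem_filter => /andP[/eqP].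
rewrite (@eq_in_count _ _ (fun y => slot y == slot x)); last first.
  by move=> y /mem_take /Zu ->; rewrite eqxx.
rewrite -size_filter -/(in_slot _ _) -[in RHS](cat_take_drop (index x Z) Z).
rewrite !in_slotE filter_cat index_cat mem_filter eqxx /=.
have -> : x \in take (index x Z) Z = false.
  by rewrite in_take_leq ?ltnn // ltnW.
by rewrite (drop_nth 0 ix) nth_index //= eqxx /= eqxx addn0.
Qed.

End Good.

Definition marks (c : nat -> bool) : nat := packed Q G (fun k => c k * 2 ^ G.-1).

Lemma G_gt0 : 0 < G. Proof. by rewrite /block addn1. Qed.

Lemma eq_marks c c' : (forall k, k < Q -> c k = c' k) -> marks c = marks c'.
Proof. by move=> e; apply: eq_packed => k hk; rewrite e. Qed.

Lemma mark_lt (c : bool) : c * 2 ^ G.-1 < 2 ^ G.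
Proof.
by case: c; rewrite ?mul0n ?expn_gt0 // mul1n ltn_exp2l // ltn_predL G_gt0.
Qed.

Lemma marks_or c c' : Nat.lor (marks c) (marks c') = marks (fun k => c k || c' k).
Proof.
rewrite /marks packed_lor; try by move=> k _; apply: mark_lt.
apply: eq_packed => k _; case: (c k) (c' k) => [] [];
  by rewrite ?mul0n ?mul1n ?Nat.lor_diag ?Nat.lor_0_r ?Nat.lor_0_l.
Qed.

Lemma marks_and c c' : Nat.land (marks c) (marks c') = marks (fun k => c k && c' k).
Proof.
rewrite /marks packed_land; try by move=> k _; apply: mark_lt.
apply: eq_packed => k _; case: (c k) (c' k) => [] [];
  by rewrite ?mul0n ?mul1n ?Nat.land_diag ?Nat.land_0_r ?Nat.land_0_l.
Qed.

Lemma marks_none : marks (fun=> false) = 0.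
Proof. by rewrite /marks /packed big1. Qed.

Lemma marks_all : marks (fun=> true) = block_tops Q G.
Proof. by apply: eq_packed => k _; rewrite mul1n. Qed.

Lemma marks_one k0 : k0 < Q -> marks (fun k => k == k0) = 2 ^ (G * k0 + G.-1).
Proof.
move=> h; have := @packed_upd Q G (fun=> 0) k0 (2 ^ G.-1) h.
have -> : packed Q G (fun=> 0) = 0 by rewrite /packed big1.
by rewrite add0n -expnD addnC => <-; apply: eq_packed => k _; rewrite add0n.
Qed.

Lemma words_flat f :
  packed (slots w) (L * G) (fun s => packed L G (f s)) =
  packed Q G (fun k => f (k %/ L) (k %% L)).
Proof. exact: packed_nest. Qed.

Lemma match_words Z Z' :
  match_word Q L (field w) G (word_a w rho Z) (word_b w rho Z') =
  marks (fun k => has (fun q => entry w rho Z (k %/ L) (k %% L) ==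
                                maxn 1 (entry w rho Z' (k %/ L) q)) (iota 0 L)).
Proof.
rewrite /word_a /word_b !words_flat match_wordE //.
- exact: field_gt0.
- by move=> k q _ _; apply: entry_lt.
- by move=> k q _ _; apply: maxn_entry_lt.
Qed.

Lemma match_words_safe Z Z' :
  Nat.lxor (word_a w rho Z) (word_b w rho Z') <= field_tops Q L (field w) G /\
  field_tops Q L (field w) G + block_fill Q G < 2 ^ w.
Proof.
rewrite /word_a /word_b !words_flat.
have [] := @match_word_safe Q L (field w) G (field_gt0 w) (blockE w)
  (fun k _ => entry w rho Z (k %/ L) (k %% L))
  (fun k q => maxn 1 (entry w rho Z' (k %/ L) q)).
- by move=> k q _ _; apply: entry_lt.
- by move=> k q _ _; apply: maxn_entry_lt.
move=> h1 h2; split=> //; apply: leq_trans h2 _.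
by rewrite leq_exp2l // ltnW // blocks_block.
Qed.

Lemma match_sound Z Z' k :
  has (fun q => entry w rho Z (k %/ L) (k %% L) ==
                maxn 1 (entry w rho Z' (k %/ L) q)) (iota 0 L) ->
  occupied Z k /\ exists2 y, y \in Z' & sig y = sig (elt Z k).
Proof.
case/hasP=> q _; rewrite /entry -/(occupied Z k) -/(elt Z k).
case: (occupied Z k); case: ifP => h /eqP e; try by clear -e; lia.
split=> //.
exists (nth 0 (in_slot Z' (k %/ L)) q); last by clear -e; lia.
by have := mem_nth 0 h; rewrite mem_filter => /andP[].
Qed.

Lemma match_complete Z Z' k : ~~ full w rho Z' -> occupied Z k ->
  elt Z k \in Z' ->
  has (fun q => entry w rho Z (k %/ L) (k %% L) ==
                maxn 1 (entry w rho Z' (k %/ L) q)) (iota 0 L).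
Proof.
move=> nf o xZ'; set x := elt Z k in xZ'.
have sx : slot x = k %/ L by apply: slot_elt.
have ix : index x (in_slot Z' (k %/ L)) < size (in_slot Z' (k %/ L)).
  by rewrite index_mem -sx mem_in_slot.
apply/hasP; exists (index x (in_slot Z' (k %/ L))).
  by rewrite mem_iota add0n; apply: leq_trans ix (full_slot _ nf).
rewrite /entry -/(occupied Z k) o ix -/(elt Z k) -/x nth_index.
  by rewrite (maxn_idPr _).
by rewrite -index_mem.
Qed.

Lemma word_n_digit Z k : ~~ full w rho Z -> k < Q -> occupied Z k ->
  (word_n w rho Z %/ 2 ^ (G * k)) %% 2 ^ G = index (elt Z k) Z.
Proof.
move=> nf kQ o; rewrite /word_n words_flat packed_digit //.
  by rewrite /local_index -/(occupied Z k) o.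
by move=> j _; apply: local_index_lt.
Qed.

End Reading.


(** * The query program *)

(* Register 5 holds the address of the smallest set, 8 its number of buckets, 9
   the address of its elements, 10 to 15 constants from its header, 16 the
   length of the output, 17 the current bucket, 19 and 20 the positions where it
   starts and ends, 22 to 24 an element (address, value, dictionary hash), 27
   the address of another set, 30 the result of a lookup in it, 35 the marks of
   the remaining candidates, and 38 the marks of the elements that match the
   set in 27. *)
Definition lookup_cmd : cmd :=
 (28 ::= Get (27 + #2) ;;
  29 ::= Get (27 + (Get (27 + #4) + (24 mod 28))) ;;
  31 ::= 27 + Get (27 + #3) ;;
  30 ::= #0 ;;
  While (Lt #0 29)
   (32 ::= 31 + #5 * (29 - #1) ;;
    If (Eq (Get (32 + #0)) 23) (30 ::= #1) Skip ;;
    29 ::= Get (32 + #3)))%prog.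

Definition verify_cmd : cmd :=
 (23 ::= Get (22 + #0) ;; 24 ::= Get (22 + #1) ;; 25 ::= #1 ;;
  For 26 0
   (27 ::= Get (1 + 26) ;; lookup_cmd ;; If (Eq 30 #0) (25 ::= #0) Skip) ;;
  If (Eq 25 #0) Skip (Put (3 + 16) 23 ;; 16 ::= 16 + #1))%prog.

Definition slow_cmd : cmd :=
 (For 44 (20 - 19)
   (22 ::= 9 + #5 * (19 + 44) ;;
    23 ::= Get (22 + #0) ;; 24 ::= Get (22 + #1) ;; lookup_cmd ;;
    If (Eq 30 #0) Skip (38 ::= Bin Or 38 (Get (22 + #2)))))%prog.

Definition fast_cmd : cmd :=
 (43 ::= Bin And (11 - Bin Xor 33 (Get (40 + #1))) 11 ;;
  38 ::= Bin Or 38 (Bin And (43 + 12) 13))%prog.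

Definition filter_cmd : cmd :=
 (27 ::= Get (1 + 36) ;; 37 ::= Get (27 + #1) ;; 38 ::= #0 ;;
  If (Lt (37 / 8) 10)
   (39 ::= 17 ;;
    While (Lt 39 37)
     (40 ::= 27 + (#11 + #5 * 39) ;;
      If (Eq (Get (40 + #4)) #0) fast_cmd slow_cmd ;;
      39 ::= 39 + 8))
   slow_cmd ;;
  35 ::= Bin And 35 38)%prog.

Definition extract_cmd : cmd :=
 (While (Lt #0 35)
   (41 ::= Bin And 35 (35 - #1) ;;
    42 ::= (34 / ((35 - 41) / 14)) mod 15 ;;
    35 ::= 41 ;;
    22 ::= 9 + #5 * (19 + 42) ;;
    verify_cmd))%prog.

Definition bucket_query_cmd : cmd :=
 (18 ::= 5 + (#11 + #5 * 17) ;;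
  19 ::= Get (18 + #3) ;; 20 ::= Get (18 + #8) ;;
  If (Eq (Get (18 + #4)) #0)
   (33 ::= Get (18 + #0) ;; 34 ::= Get (18 + #2) ;; 35 ::= 13 ;;
    For 36 0 filter_cmd ;; extract_cmd)
   (For 21 (20 - 19) (22 ::= 9 + #5 * (19 + 21) ;; verify_cmd)))%prog.

Definition query_cmd : cmd :=
 (5 ::= Get (1 + #0) ;;
  For 6 0
   (7 ::= Get (1 + 6) ;;
    If (Lt (Get (7 + #0)) (Get (5 + #0))) (5 ::= 7) Skip) ;;
  8 ::= Get (5 + #1) ;; 9 ::= 5 + Get (5 + #3) ;; 10 ::= Get (5 + #9) ;;
  11 ::= Get (5 + #5) ;; 12 ::= Get (5 + #6) ;; 13 ::= Get (5 + #7) ;;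
  14 ::= Get (5 + #8) ;; 15 ::= Get (5 + #10) ;; 16 ::= #0 ;;
  For 17 8 bucket_query_cmd ;;
  0 ::= 16 ;; 1 ::= 3)%prog.

Lemma represents_ext w rho X (get get' : nat -> nat) :
  (forall k, k < total_size w (size X) -> get' k = get k) ->
  represents w rho X get -> represents w rho X get'.
Proof.
move=> g [r1 r2 r3 r4 r5].
have tE : total_size w (size X) =
  11 + 5 * (buckets w (size X)).+1 + 5 * size X + classes (size X) by [].
split.
- by move=> k hk; rewrite g ?r1 //; move: hk; rewrite /header tE; clear; lia.
- move=> u hu; apply: bucket_ok_ext (r2 _ hu) => k hk; apply: g.
  by rewrite /header tE; clear -hu hk; lia.
- by rewrite g // /header tE; clear; lia.
- move=> j hj; apply: element_ok_ext (r4 _ hj) => k hk; apply: g.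
  by rewrite tE /elements_at /header; clear -hj hk; lia.
- move=> v hv; rewrite g ?r5 // /heads_at /elements_at /header tE.
  by clear -hv; lia.
Qed.

Section Query.
Variables (w : nat) (rho : nat -> nat) (m : nat) (X : nat -> seq nat).
Variables (P : nat -> nat) (H work len : nat).
Hypothesis lw : large w.
Hypotheses (m0 : 0 < m) (mw : m < 2 ^ w).
Hypothesis uX : forall i, i < m -> uniq (X i).

Let ok : pred nat := fun a => work <= a < work + len.
Definition set_size i := size (X i).
Definition set_buckets i := buckets w (set_size i).
Definition set_classes i := classes (set_size i).
Definition set_elements i :=
  sorted_by_bucket w rho (X i) (set_buckets i) (set_buckets i).
Definition set_bucket i := bucket w rho (set_buckets i) (X i).
Definition set_base i u := size (sorted_by_bucket w rho (X i) (set_buckets i) u).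
Local Notation n := set_size.
Local Notation W := set_buckets.
Local Notation C := set_classes.
Local Notation Y := set_elements.
Local Notation bk := set_bucket.
Local Notation base := set_base.
Local Notation hash := (hash w rho).

Hypothesis Hw : forall i, i < m -> H + i < 2 ^ w.
Hypothesis Hout : forall i, i < m -> ~~ ok (H + i).
Hypothesis Pw : forall i, i < m -> P i + total_size w (n i) <= 2 ^ w.
Hypothesis Pout : forall i k, i < m -> k < total_size w (n i) -> ~~ ok (P i + k).
Hypothesis workw : work + len <= 2 ^ w.

Definition mem_ok (M : store) : Prop :=
  (forall i, i < m -> M (H + i) = P i) /\
  forall i, i < m -> represents w rho (X i) (fun k => M (P i + k)).

Local Notation wp := (wp w ok).

Lemma q_lit k : k <= 99 -> k < 2 ^ w.
Proof. by move=> h; apply: leq_ltn_trans h (large_99 lw). Qed.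

Lemma q_totE i : total_size w (n i) = 11 + 5 * (W i).+1 + 5 * n i + C i.
Proof. by []. Qed.

Lemma q_addr i k : i < m -> k < total_size w (n i) -> P i + k < 2 ^ w.
Proof. by move=> im h; apply: leq_trans (Pw im); rewrite ltn_add2l. Qed.

Lemma q_small i k : i < m -> k < total_size w (n i) -> k < 2 ^ w.
Proof. by move=> im h; apply: leq_ltn_trans (q_addr im h); apply: leq_addl. Qed.

Lemma q_W0 i : 0 < W i. Proof. exact: pow2above_gt0. Qed.
Lemma q_C0 i : 0 < C i. Proof. exact: pow2above_gt0. Qed.

Lemma q_szY i : size (Y i) = n i.
Proof. by apply: perm_size; apply: perm_sorted_by_bucket; apply: q_W0. Qed.

Lemma q_memY i x : (x \in Y i) = (x \in X i).
Proof. by apply: perm_mem; apply: perm_sorted_by_bucket; apply: q_W0. Qed.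

Lemma represents_outside M M' : mem_ok M -> outside ok M M' -> mem_ok M'.
Proof.
move=> [h1 h2] out; split=> [i im | i im]; first by rewrite out ?h1 ?Hout.
by apply: represents_ext (h2 i im) => k hk; rewrite out // Pout.
Qed.

Section Mem.
Variable M : store.
Hypothesis okM : mem_ok M.

Lemma q_header i k : i < m -> k < header -> M (P i + k) = nth 0 (header_of w (n i)) k.
Proof. by move=> im hk; case: okM => _ /(_ i im) [e _ _ _ _]; apply: e. Qed.

Lemma q_base i u : i < m -> u <= W i -> M (P i + (11 + 5 * u) + 3) = base i u.
Proof.
move=> im; rewrite leq_eqVlt => /orP[/eqP-> | lt].
  case: okM => _ /(_ i im) [_ _ e _ _]; rewrite -(addnA (P i)) e; apply/esym/q_szY.
case: okM => _ /(_ i im) [_ /(_ u lt) [e _ _] _ _ _].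
by rewrite -(addnA (P i)) e.
Qed.

Lemma q_full i u : i < m -> u < W i ->
  M (P i + (11 + 5 * u) + 4) = full w rho (bk i u).
Proof.
move=> im lt; case: okM => _ /(_ i im) [_ /(_ u lt) [_ e _] _ _ _].
by rewrite -(addnA (P i)) e.
Qed.

Lemma q_words i u : i < m -> u < W i -> ~~ full w rho (bk i u) ->
  [/\ M (P i + (11 + 5 * u) + 0) = word_a w rho (bk i u),
      M (P i + (11 + 5 * u) + 1) = word_b w rho (bk i u) &
      M (P i + (11 + 5 * u) + 2) = word_n w rho (bk i u)].
Proof.
move=> im lt nf; case: okM => _ /(_ i im) [_ /(_ u lt) [_ _ /(_ nf) [e1 e2 e3]] _ _ _].
by rewrite -!(addnA (P i)) addn0 e1 e2 e3.
Qed.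

Lemma q_element i j : i < m -> j < n i ->
  let x := nth 0 (Y i) j in let a := P i + elements_at w (n i) + 5 * j in
  [/\ M (a + 0) = x, M (a + 1) = hash 5 x,
    rank w rho (W i) (Y i) j < ell w -> M (a + 2) =
      2 ^ (block w * (slot w rho x * ell w + rank w rho (W i) (Y i) j) + (block w).-1) &
    M (a + 3) = last_pos w rho (C i) (hash 5 x %% C i) (take j (Y i))].
Proof.
move=> im lt x a; case: okM => _ /(_ i im) [_ _ _ /(_ j lt) [e1 e2 e3 e4 _] _].
by rewrite /a -!(addnA (P i)) addn0 e1 e2 e4.
Qed.

Lemma q_head i v : i < m -> v < C i ->
  M (P i + (heads_at w (n i) + v)) = last_pos w rho (C i) v (Y i).
Proof. by move=> im hv; case: okM => _ /(_ i im) [_ _ _ _ ->]. Qed.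

End Mem.

(* The length of the chain that is searched for x in set i. *)
Definition chain i x := count (fun y => hash 5 y %% C i == hash 5 x %% C i) (X i).

Lemma wp_lookup i x r M : mem_ok M -> i < m ->
  r 27 = P i -> r 23 = x -> r 24 = hash 5 x ->
  wp lookup_cmd (fun t r' M' => t <= 10 + 5 * chain i x /\
    r' 30 = (x \in X i)) r M.
Proof.
move=> okM im r27 r23 r24.
have lit := q_lit; have tE := q_totE i.
have hdr k : k < 11 -> P i + k < 2 ^ w.
  by move=> hk; apply: q_addr => //; rewrite tE; clear -hk; lia.
have hm := leq_divM (hash 5 x) (C i).
have hs := hash_lt w rho 5 x.
have vC : hash 5 x %% C i < C i by rewrite ltn_mod q_C0.
set v := hash 5 x %% C i in vC.
have hv : heads_at w (n i) + v < total_size w (n i) by rewrite ltn_add2l.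
have qh := q_header okM im.
have e2 : M (P i + 2) = C i by rewrite qh.
have e4 : M (P i + 4) = heads_at w (n i) by rewrite qh.
have e3 : M (P i + 3) = elements_at w (n i) by rewrite qh.
apply/wp_seq/wp_assign => /=; first by rewrite r27 hdr // lit.
rewrite r27 e2; apply/wp_seq/wp_assign; rewrite /put /=.
  rewrite r27 r24 e4 modn_sub -/v (lit 4) // hdr // (q_small im hv) (q_addr im hv).
  by rewrite hm (leq_ltn_trans hm hs).
rewrite r27 r24 e4 modn_sub -/v q_head //.
apply/wp_seq/wp_assign => /=.
  rewrite r27 e3 (lit 3) // hdr // q_addr //.
  by rewrite tE /elements_at /header -/(W i); have := q_C0 i; clear; lia.
rewrite r27 e3; apply/wp_seq/wp_assign; rewrite /put /=; first exact: lit.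
set r1 := fun y => if y == 30 then _ else _.
have [f31 f29 f23] : [/\ r1 31 = P i + elements_at w (n i),
  r1 29 = last_pos w rho (C i) v (Y i) & r1 23 = x] by [].
have f30 : r1 30 = 0 by [].
clearbody r1.
pose cls y := hash 5 y %% C i == v.
have cY : count cls (Y i) = chain i x.
  by apply/permP; apply: perm_sorted_by_bucket; apply: q_W0.
apply: (@wp_while _ _ (fun (k t : nat) (r' M' : store) => exists j (f : bool),
  [/\ j <= size (Y i), r' 29 = last_pos w rho (C i) v (take j (Y i)),
      k = count cls (take j (Y i)), t + 5 * k <= 5 * chain i x &
      r' 30 = f /\ (x \in X i) = f || (x \in take j (Y i))])).
  exists (chain i x), (size (Y i)), false; rewrite take_size f29 f30 -cY.
  by split=> //; split=> //; rewrite /= q_memY.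
move=> k t r' M' [j [f [jY r29 kE tk [r30 mE]]]] kp _ /(_ isT)->; split=> /=.
- by rewrite lit.
- rewrite r29 => pos.
  have := @last_posP w rho (C i) v (take j (Y i)); rewrite -/cls -r29.
  case=> [[e _] | [/andP[p1 p2] c3 c4 c5]]; first by rewrite -r29 e in pos.
  have ltj : (r' 29).-1 < j by rewrite prednK //; apply: leq_trans p2 _; rewrite size_take; case: ifP; lia.
  set j' := (r' 29).-1 in c3 c4 c5 ltj.
  have takeE : take j' (take j (Y i)) = take j' (Y i) by rewrite take_takel // ltnW.
  have nthE : nth 0 (take j (Y i)) j' = nth 0 (Y i) j' by rewrite nth_take.
  rewrite takeE nthE in c3 c4 c5.
  have jn : j' < n i by rewrite -q_szY; apply: leq_trans ltj jY.
  have [g0 g1 _ g3] := q_element okM im jn.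
  have g31 : r' 31 = P i + elements_at w (n i) by rewrite kp.
  have g23 : r' 23 = x by rewrite kp.
  set a := P i + elements_at w (n i) + 5 * j' in g0 g1 g3.
  have aw l : l < 5 -> a + l < 2 ^ w.
    move=> hl; rewrite /a -!addnA; apply: q_addr => //.
    by rewrite tE /elements_at /header -/(W i); clear -hl jn; lia.
  have a5 : 5 * j' < 2 ^ w.
    by apply: leq_ltn_trans (aw 0 isT); rewrite /a addn0 leq_addl.
  have aE : r' 31 + 5 * (r' 29 - 1) = a by rewrite g31 subn1.
  rewrite kE c4; split=> //.
  apply/wp_seq/wp_assign => /=.
    rewrite aE subn1 -/j' a5 (lit 5) // (lit 1) // -(addn0 a) aw //.
    by rewrite p1.
  rewrite aE; apply/wp_seq.
  apply: (@wp_conseq _ _ _ (fun t' r1 M1 => t' <= 2 /\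
     r1 30 = (nth 0 (Y i) j' == x) || f)).
    apply: wp_if; rewrite /put /=.
    + by rewrite aw // (lit 0).
    + rewrite g0 g23 => ->; apply: wp_assign => //=; exact: lit.
    + by rewrite g0 g23 => /negbTE->; apply: wp_skip.
  move=> t1 r1' M1 k1 _ /(_ isT)-> [t12 e30].
  apply: wp_assign => /=; rewrite k1 //= /put /=.
    by rewrite aw // (lit 3).
  exists j', ((nth 0 (Y i) j' == x) || f); split=> //.
  + by apply: leq_trans jY; apply: ltnW.
  + by rewrite g3 (eqP c3).
  + by rewrite kE c4 in tk; clear -tk t12; lia.
  + split=> //; rewrite mE c5 /cls //.
    by rewrite orbA [x == _]eq_sym (orbC f).
- rewrite r29 -eqn0Ngt => /eqP z; split; first by clear -tk; lia.
  have := @last_posP w rho (C i) v (take j (Y i)); rewrite -/cls z.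
  case=> [[_ c0] | [] //]; rewrite r30 mE.
  case: (boolP (x \in take j (Y i))) => [xin | _]; last by rewrite orbF.
  have : has cls (take j (Y i)) by apply/hasP; exists x; rewrite /cls.
  by rewrite has_count c0.
Qed.

Section Output.
Variable b : nat.
Hypothesis bm : b < m.
Hypothesis b_fits : n b <= len.

Definition inter x := all (fun i => x \in X i) (iota 0 m).

(* The elements of the intersection that satisfy p have been output. *)
Definition outp (p : pred nat) (r M : store) : Prop := exists O : seq nat,
  [/\ r 16 = size O, forall j, j < size O -> M (work + j) = nth 0 O j, uniq O &
    forall x, (x \in O) = [&& x \in X b, inter x & p x]].

Lemma outp_ext p p' r r' M : r' 16 = r 16 ->
  (forall x, x \in X b -> inter x -> p x = p' x) -> outp p r M -> outp p' r' M.
Proof.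
move=> e ep [O [h1 h2 h3 h4]]; exists O; split; rewrite ?e // => x.
rewrite h4; case: (boolP (x \in X b)) => //= xb.
by case: (boolP (inter x)) => //= ix; apply: ep.
Qed.

Definition verify_cost x := 12 + \sum_(i <- iota 0 m) (16 + 5 * chain i x).

Lemma wp_verify p x j r M : mem_ok M -> outp p r M -> ~~ p x ->
  r 0 = m -> r 1 = H -> r 3 = work -> j < n b -> x = nth 0 (Y b) j ->
  r 22 = P b + elements_at w (n b) + 5 * j ->
  wp verify_cmd (fun t r' M' => [/\ t <= verify_cost x, mem_ok M' &
    outp (fun y => p y || (y == x)) r' M']) r M.
Proof.
move=> okM [O [o1 o2 o3 o4]] npx r0 r1 r3 jn xE r22.
have lit := q_lit; have [e0 e1 _ _] := q_element okM bm jn.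
rewrite -xE -r22 in e0 e1.
have aw l : l < 5 -> r 22 + l < 2 ^ w.
  move=> hl; rewrite r22 -!addnA; apply: q_addr => //.
  by rewrite q_totE /elements_at /header -/(W b); clear -hl jn; lia.
have xX : x \in X b by rewrite xE -q_memY mem_nth // q_szY.
apply/wp_seq/wp_assign => /=; first by rewrite aw // lit.
rewrite e0; apply/wp_seq/wp_assign; rewrite /put /=; first by rewrite aw // lit.
rewrite e1; apply/wp_seq/wp_assign; rewrite /put /=; first by rewrite lit.
set r4 := fun y => if y == 25 then _ else _.
have [f0 [f1 [f3 f16]]] : [/\ r4 0 = m, r4 1 = H, r4 3 = work & r4 16 = size O].
  by [].
have [f23 [f24 f25]] : r4 23 = x /\ r4 24 = hash 5 x /\ r4 25 = 1 by [].
clearbody r4.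
pose S k := \sum_(i <- iota 0 k) (16 + 5 * chain i x).
pose A k := all (fun i => x \in X i) (iota 0 k).
apply/wp_seq; apply: (@wp_for _ _ m (fun k t r' M' =>
   t <= S k /\ r' 25 = A k :> nat)) => //.
- by apply: w_gt0.
- move=> k t r' M' [tk e25] km rk kp _ /(_ isT)-> {M'}.
  have g0 : r' 0 = m by rewrite kp.
  have g1 : r' 1 = H by rewrite kp.
  have g23 : r' 23 = x by rewrite kp.
  have g24 : r' 24 = hash 5 x by rewrite kp.
  split=> // lt; apply/wp_seq/wp_assign => /=; first by rewrite g1 rk Hw.
  rewrite g1 rk; case: (okM) => -> // _.
  apply/wp_seq/(wp_conseq (@wp_lookup k x _ _ okM lt _ _ _)) => //.
  move=> t1 r1' M1 k1 _ /(_ isT)-> [t1E e30] {M1}.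
  have SE : S k.+1 = S k + (16 + 5 * chain k x).
    by rewrite /S -[k.+1]addn1 iotaD big_cat big_seq1.
  have AE : A k.+1 = A k && (x \in X k).
    by rewrite /A -[k.+1]addn1 iotaD all_cat /= andbT.
  have h25 : r1' 25 = A k :> nat by rewrite k1.
  have h26 : r1' 26 = k by rewrite k1.
  apply: wp_if => /=; first by rewrite lit.
  + rewrite e30 eqb0 => nx; apply: wp_assign => /=; first by rewrite lit.
    rewrite AE (negbTE nx) andbF SE /put /= h26; split=> //; split=> //.
    by clear -tk t1E; lia.
  + rewrite e30 eqb0 negbK => nx; apply: wp_skip.
    rewrite AE nx andbT SE /put /= h26; split=> //; split=> //.
    by clear -tk t1E; lia.
move=> t r' M' [tm e25] _ kp _ /(_ isT)-> {M'}.
have g3 : r' 3 = work by rewrite kp.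
have g16 : r' 16 = size O by rewrite kp.
have g23 : r' 23 = x by rewrite kp.
apply: wp_if => /=; first by rewrite lit.
  rewrite e25 eqb0 => ni; apply: wp_skip; split=> //.
    by rewrite /verify_cost -/(S m); clear -tm; lia.
  exists O; split=> // y; rewrite o4; case: (y =P x) => [-> | _]; last by rewrite orbF.
  by rewrite /inter -/(A m) (negbTE ni) andbF.
rewrite e25 eqb0 negbK => ix.
have xO : x \notin O by rewrite o4 (negbTE npx) !andbF.
have szO : size O < n b.
  apply: (@uniq_leq_size _ (x :: O)) => /=.
    by rewrite xO.
  by move=> y; rewrite inE => /orP[/eqP-> // | ]; rewrite o4 => /and3P[].
have szl := leq_trans szO b_fits.
have lt : work + size O < 2 ^ w by apply: leq_trans workw; rewrite ltn_add2l.
have okO : ok (work + size O) by rewrite /ok leq_addr ltn_add2l.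
apply/wp_seq/wp_put => /=.
- by rewrite g3 g16.
- by [].
- by rewrite g3 g16.
rewrite g3 g16 g23; apply: wp_assign => /=.
  rewrite g16 lit // addn1 /=; apply: leq_ltn_trans szO _; apply: (q_small bm).
  by rewrite q_totE; clear; lia.
rewrite g16; split.
- by rewrite /verify_cost -/(S m); clear -tm; lia.
- apply: represents_outside okM _ => a na; rewrite /store_at /put.
  by case: eqP na => // ->; rewrite okO.
- exists (rcons O x); rewrite size_rcons rcons_uniq xO; split=> //.
  + by rewrite /put /= addn1.
  + move=> l; rewrite ltnS leq_eqVlt /store_at /put eqn_add2l nth_rcons.
    case: eqP => [-> _ | _ /= ll]; first by rewrite ltnn.
    by rewrite ll o2.
  + move=> y; rewrite mem_rcons inE o4; case: (y =P x) => [-> | _]; last by rewrite orbF.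
    by rewrite xX orbT /inter -/(A m) ix.
Qed.

Hypothesis b_min : forall i, i < m -> n b <= n i.

Lemma W_dvd i : i < m -> W b %| W i.
Proof. by move=> im; apply: pow2above_dvd; apply: leq_div2r; rewrite leq_mul2l b_min. Qed.

Lemma W_le_min i : i < m -> W b <= W i.
Proof. by move=> im; apply: dvdn_leq (W_dvd im); apply: q_W0. Qed.

(* Sets with many more buckets than set b are not compared word by word. *)
Definition huge i := w <= W i %/ W b.

(* What the word-parallel filter with set i lets pass. *)
Definition passes i x := (x \in X i) || ~~ huge i &&
  has (fun y => [&& y != x, hash 0 y %% W b == hash 0 x %% W b &
                    sig w rho y == sig w rho x]) (X i).

Definition slow_cost i u := 4 + \sum_(x <- bk b u) (20 + 5 * chain i x).
Definition filter_cost i u := 10 +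
  if huge i then slow_cost i u else
  \sum_(v <- iota 0 (W i) | v %% W b == u)
    (8 + full w rho (bk i v) * slow_cost i u).
Definition bucket_cost u := 20 +
  if full w rho (bk b u) then \sum_(x <- bk b u) (8 + verify_cost x) else
  \sum_(i <- iota 0 m) (4 + filter_cost i u) +
  \sum_(x <- bk b u | all (passes^~ x) (iota 0 m)) (8 + verify_cost x).
Definition query_cost :=
  40 + 10 * m + \sum_(u <- iota 0 (W b)) (4 + bucket_cost u).

Lemma sum_iotaS (F : nat -> nat) k :
  \sum_(i <- iota 0 k.+1) F i = \sum_(i <- iota 0 k) F i + F k.
Proof. by rewrite -[k.+1]addn1 iotaD big_cat big_seq1. Qed.

Section Bucket.
Variable u : nat.
Hypothesis uW : u < W b.
Local Notation Z := (bk b u).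
Local Notation marks := (marks w).
Local Notation occupied := (occupied w rho Z).
Local Notation elt := (elt w rho Z).

Lemma uniq_Z : uniq Z. Proof. by apply: filter_uniq; apply: uX. Qed.

Lemma mem_Z x : (x \in Z) = (x \in X b) && (hash 0 x %% W b == u).
Proof. by rewrite mem_filter andbC. Qed.

Lemma base_Z : base b u.+1 = base b u + size Z.
Proof. by rewrite /set_base sorted_by_bucketS size_cat. Qed.

Lemma base_Z_lt j : j < size Z -> base b u + j < n b.
Proof.
move=> hj; apply: (@leq_trans (base b u.+1)); first by rewrite base_Z ltn_add2l.
by apply: size_sorted_by_bucket => //; apply: q_W0.
Qed.

Lemma nth_Y_Z j : j < size Z -> nth 0 (Y b) (base b u + j) = nth 0 Z j.
Proof.
move=> hj.
have [_] := @rank_place w rho Z (W b) u (X b) (nth 0 Z j) uW erefl (mem_nth 0 hj).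
by rewrite index_uniq // uniq_Z.
Qed.

Lemma rank_Y_Z j : j < size Z ->
  rank w rho (W b) (Y b) (base b u + j) =
  index (nth 0 Z j) (in_slot w rho Z (slot w rho (nth 0 Z j))).
Proof.
move=> hj.
have [+ _] := @rank_place w rho Z (W b) u (X b) (nth 0 Z j) uW erefl (mem_nth 0 hj).
by rewrite index_uniq // uniq_Z.
Qed.

Hypothesis nfZ : ~~ full w rho Z.

Lemma wp_slow i c r M : mem_ok M -> i < m -> r 27 = P i ->
  r 19 = base b u -> r 20 = base b u.+1 -> r 9 = P b + elements_at w (n b) ->
  r 38 = marks c ->
  wp slow_cmd (fun t r' M' => t <= slow_cost i u /\
    r' 38 = marks (fun k => c k || occupied k && (elt k \in X i))) r M.
Proof.
move=> okM im r27 r19 r20 r9 r38; have lit := q_lit; have uZ := uniq_Z.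
have szw : size Z < 2 ^ w.
  apply: (@q_small b) => //; rewrite q_totE; have := @size_sorted_by_bucket w rho (X b) (W b) u.+1 (q_W0 b) uW.
  by rewrite -/(base b u.+1) base_Z -/(n b); clear; lia.
have cM k : occupied k -> elt k \in Z by apply: elt_mem.
pose S k := \sum_(x <- take k Z) (20 + 5 * chain i x).
pose D k := fun kb => c kb || [&& occupied kb, elt kb \in take k Z & elt kb \in X i].
apply: (@wp_for _ _ (size Z) (fun k t r' M' => t <= S k /\ r' 38 = marks (D k))) => //.
- by apply: w_gt0.
- rewrite /put /= r38; split=> //; apply: eq_marks => k _.
  by rewrite /D take0 andbF orbF.
- move=> k t r' M' [tk e38] kZ rk kp _ /(_ isT)-> {M'}.
  have [g27 g19 g20 g9] : [/\ r' 27 = P i, r' 19 = base b u, r' 20 = base b u.+1 &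
     r' 9 = P b + elements_at w (n b)] by rewrite !kp.
  split=> /=; first by rewrite g19 g20 base_Z leq_addr.
    by rewrite g19 g20 base_Z addKn.
  move=> lt; have jn := base_Z_lt lt; set j := base b u + k in jn.
  have [e0 e1 e2 _] := q_element okM bm jn.
  rewrite /j nth_Y_Z // rank_Y_Z // -/j in e0 e1 e2.
  set x := nth 0 Z k in e0 e1 e2; have xZ : x \in Z by apply: mem_nth.
  have {}e2 := e2 (index_slot_lt lw nfZ xZ).
  set a := P b + elements_at w (n b) + 5 * j in e0 e1 e2.
  have aw l : l < 5 -> a + l < 2 ^ w.
    move=> hl; rewrite /a -!addnA; apply: q_addr => //.
    by rewrite q_totE /elements_at /header -/(W b); clear -hl jn; lia.
  have aE : r' 9 + 5 * (r' 19 + r' 44) = a by rewrite g9 g19 rk.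
  have a5 : 5 * j < 2 ^ w by apply: leq_ltn_trans (aw 0 isT); rewrite addn0 leq_addl.
  have aj : j < 2 ^ w by apply: leq_ltn_trans a5; rewrite leq_pmull.
  apply/wp_seq/wp_assign => /=.
    by rewrite aE g19 rk -/j aj a5 -[a]addn0 aw // lit.
  rewrite aE; apply/wp_seq/wp_assign; rewrite /put /=; first by rewrite aw // lit.
  rewrite e0; apply/wp_seq/wp_assign; rewrite /put /=; first by rewrite aw // lit.
  rewrite e1; set r1 := fun y => if y == 24 then _ else _.
  have [f22 f23 f24 f27 f38] : [/\ r1 22 = a, r1 23 = x, r1 24 = hash 5 x, r1 27 = P i &
     r1 38 = marks (D k)] by split; rewrite /r1 /=.
  have f44 : r1 44 = k by rewrite /r1 /=.
  clearbody r1.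
  apply/wp_seq/(wp_conseq (@wp_lookup i x _ _ okM im _ _ _)) => //.
  move=> t1 r2 M2 k2 _ /(_ isT)-> [t1E e30] {M2}.
  have [h22 h38 h44] : [/\ r2 22 = a, r2 38 = marks (D k) & r2 44 = k] by rewrite !k2.
  have takeS : take k.+1 Z = rcons (take k Z) x by rewrite (take_nth 0 lt).
  have SS : S k.+1 = S k + (20 + 5 * chain i x).
    by rewrite /S takeS -cats1 big_cat big_seq1.
  have occ kb : occupied kb -> (elt kb == x) = (kb == place w rho Z x).
    move=> o; apply/eqP/eqP => [<- | ->]; first by rewrite place_elt.
    by rewrite elt_place.
  apply: wp_if => /=; first by rewrite lit.
    rewrite e30 eqb0 => nx; apply: wp_skip.
    rewrite /put /= h38 h44; split=> //; split; first by rewrite SS; clear -tk t1E; lia.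
    apply: eq_marks => kb _; rewrite /D takeS mem_rcons inE.
    case o : (occupied kb) => //=; case: eqP => [-> | //].
    by rewrite (negbTE nx) !andbF.
  rewrite e30 eqb0 negbK => nx; apply: wp_assign => /=.
    by rewrite h22 aw // lit.
  rewrite /put /= h22 h38 h44 e2; split=> //; split.
    by rewrite SS; clear -tk t1E; lia.
  rewrite -/(place w rho Z x) -marks_one ?place_lt // marks_or.
  apply: eq_marks => kb _; rewrite /D takeS mem_rcons inE.
  case o : (occupied kb) => /=; last first.
    case: (kb =P place w rho Z x) => [e | _]; last by rewrite orbF.
    by move: o; rewrite e occupied_place.
  rewrite -occ //; case: eqP => [-> | _]; last by rewrite orbF.
  by rewrite nx orbT /= orbT.
move=> t r' M' [tm e38] _ kp _ _.
split; first by rewrite /slow_cost; move: tm; rewrite /S take_size; clear; lia.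
rewrite e38; apply: eq_marks => kb _; rewrite /D take_size.
by case o : (occupied kb) => //=; rewrite cM.
Qed.

Definition matched i v k : bool :=
  has (fun q => entry w rho Z (k %/ ell w) (k %% ell w) ==
                maxn 1 (entry w rho (bk i v) (k %/ ell w) q)) (iota 0 (ell w)).

Definition has_constants (r : store) : Prop :=
  [/\ r 11 = field_tops (blocks w) (ell w) (field w) (block w),
      r 12 = block_fill (blocks w) (block w) &
      r 13 = block_tops (blocks w) (block w)].

Lemma wp_fast i v c r M : mem_ok M -> i < m -> v < W i -> ~~ full w rho (bk i v) ->
  has_constants r -> r 33 = word_a w rho Z -> r 40 = P i + (11 + 5 * v) ->
  r 38 = marks c ->
  wp fast_cmd (fun t r' M' => t = 2 /\
    r' 38 = marks (fun k => c k || matched i v k)) r M.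
Proof.
move=> okM im vW nf [r11 r12 r13] r33 r40 r38; have lit := q_lit.
have [_ eB _] := q_words okM im vW nf; rewrite -r40 in eB.
have aw : r 40 + 1 < 2 ^ w.
  rewrite r40 -addnA; apply: q_addr => //.
  by rewrite q_totE; clear -vW; lia.
have [s1 s2] := match_words_safe rho lw Z (bk i v).
have mE := match_words rho lw Z (bk i v); rewrite /match_word -marks_all in mE.
apply/wp_seq/wp_assign => /=; first by rewrite aw (lit 1) // eB r11 r33 s1.
rewrite /put /= r11 r33 eB; apply: wp_assign => /=.
  rewrite !andbT r12; apply: leq_ltn_trans _ s2; rewrite leq_add2r.
  by apply: leq_trans (land_le _ _) _; apply: leq_subr.
by rewrite /put /= r12 r13 r38 -marks_all mE marks_or.
Qed.

Lemma wp_filter i c r M : mem_ok M -> i < m ->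
  has_constants r -> r 33 = word_a w rho Z ->
  r 1 = H -> r 36 = i -> r 8 = W b -> r 10 = w -> r 17 = u ->
  r 19 = base b u -> r 20 = base b u.+1 -> r 9 = P b + elements_at w (n b) ->
  r 35 = marks c ->
  wp filter_cmd (fun t r' M' => t <= filter_cost i u /\ exists d : nat -> bool,
    [/\ r' 35 = marks (fun k => c k && d k),
        forall k, d k -> occupied k /\ passes i (elt k) &
        forall k, occupied k -> elt k \in X i -> d k]) r M.
Proof.
move=> okM im hc r33 r1 r36 r8 r10 r17 r19 r20 r9 r35; have lit := q_lit.
have cM k : occupied k -> elt k \in Z by apply: elt_mem.
have q0 := q_header okM im.
have hP1 : P i + 1 < 2 ^ w by apply: q_addr => //; rewrite q_totE; clear; lia.
have e1 : M (P i + 1) = W i by rewrite q0.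
apply/wp_seq/wp_assign => /=; first by rewrite r1 r36 Hw.
rewrite r1 r36; case: (okM) => -> // _.
apply/wp_seq/wp_assign; rewrite /put /=; first by rewrite hP1 lit.
rewrite e1; apply/wp_seq/wp_assign; rewrite /put /=; first by rewrite lit.
set r2 := fun y => if y == 38 then _ else _.
have [g27 g37 g38] : [/\ r2 27 = P i, r2 37 = W i & r2 38 = 0] by [].
have kp2 x : x \notin [:: 27; 37; 38] -> r2 x = r x.
  by rewrite !inE !negb_or /r2 => /and3P[/negbTE-> /negbTE-> /negbTE->].
clearbody r2.
have [h8 h10 h17] : [/\ r2 8 = W b, r2 10 = w & r2 17 = u] by rewrite !kp2.
have [h19 h20 h9] : [/\ r2 19 = base b u, r2 20 = base b u.+1 &
  r2 9 = P b + elements_at w (n b)] by rewrite !kp2.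
have [h33 h35] : r2 33 = word_a w rho Z /\ r2 35 = marks c by rewrite !kp2.
have h11 : has_constants r2 by case: hc; split; rewrite kp2.
set costE := if huge i then slow_cost i u else
  \sum_(v <- iota 0 (W i) | v %% W b == u) (8 + full w rho (bk i v) * slow_cost i u).
apply/wp_seq.
apply: (@wp_conseq _ _ _ (fun t r' M' => t <= 5 + costE /\ exists d : nat -> bool,
    [/\ r' 38 = marks d, r' 35 = marks c,
        forall k, d k -> occupied k /\ passes i (elt k) &
        forall k, occupied k -> elt k \in X i -> d k])); last first.
  move=> t r' M' kp _ /(_ isT)-> [tc [d [e38 e35 so co]]].
  apply: wp_assign => //=; rewrite /filter_cost -/costE; split.
    by clear -tc; lia.
  by exists d; split=> //; rewrite /put /= e35 e38 marks_and.
apply: wp_if => /=.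
- by [].
- rewrite g37 h8 h10 => nh.
  have nhuge : huge i = false by rewrite /huge leqNgt nh.
  rewrite /costE nhuge {costE}.
  pose F v := 8 + full w rho (bk i v) * slow_cost i u.
  pose S j := \sum_(v <- iota 0 j | v %% W b == u) F v.
  rewrite -/(S (W i)).
  have SS v : S v.+1 = S v + (if v %% W b == u then F v else 0).
    by rewrite /S -[v.+1]addn1 iotaD big_cat /= big_cons big_nil; case: ifP; rewrite ?addn0.
  have Smon : {homo S : x y / x <= y}.
    apply: homo_leq; [by [] | exact: leq_trans |].
    by move=> v; rewrite SS leq_addr.
  apply/wp_seq/wp_assign => //=.
  have WiW : W i < 2 ^ w by apply: (q_small im); rewrite q_totE; clear; lia.
  set r3 := put r2 39 _.
  have k3 x : x != 39 -> r3 x = r2 x by rewrite /r3 /put => /negbTE->.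
  have r339 : r3 39 = u by rewrite /r3 /put /= h17.
  clearbody r3.
  apply: (@wp_while _ _ (fun (k t : nat) (r' M' : store) => exists (v : nat) (d : nat -> bool),
    [/\ [/\ r' 39 = v, v %% W b = u, r' 38 = marks d & W i - v <= k],
        t <= S (minn v (W i)),
        forall k, d k -> occupied k /\ passes i (elt k) &
        forall k, occupied k -> elt k \in X i -> hash 0 (elt k) %% W i < v -> d k])).
    exists (W i - u), u, (fun=> false); split=> //.
    - by rewrite (k3 38) // g38 marks_none; split; rewrite ?modn_small.
    - move=> k o _ lt; exfalso.
      have := cM _ o; rewrite mem_Z -(modn_dvdm _ (W_dvd im)).
      move=> /andP[_ /eqP e]; have := leq_mod (hash 0 (elt k) %% W i) (W b).
      by rewrite e leqNgt lt.
  move=> k t r' M' [v [d [[e39 vu e38 kge] tS so co]]] kp _ /(_ isT)->.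
  have [l27 l37 l8 l35] : [/\ r' 27 = P i, r' 37 = W i, r' 8 = W b & r' 35 = marks c].
    by rewrite !kp // !k3.
  have [l19 l20 l9 l33] : [/\ r' 19 = base b u, r' 20 = base b u.+1,
    r' 9 = P b + elements_at w (n b) & r' 33 = word_a w rho Z] by rewrite !kp // !k3.
  have l11 : has_constants r' by case: h11; split; rewrite kp ?k3.
  split=> //=; rewrite e39 l37; last first.
    rewrite -leqNgt => le; split.
      by move: tS; rewrite (minn_idPr le); clear; lia.
    exists d; split=> // kb o xX; apply: co => //.
    by apply: leq_trans le; rewrite ltn_mod q_W0.
  move=> vW; split; first by clear -kge vW; lia.
  have aw l : l < 5 -> P i + (11 + 5 * v) + l < 2 ^ w.
    by move=> hl; rewrite -addnA; apply: q_addr => //; rewrite q_totE; clear -vW hl; lia.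
  have aE : r' 27 + (11 + 5 * r' 39) = P i + (11 + 5 * v) by rewrite l27 e39.
  have a5 : 11 + 5 * v < 2 ^ w.
    by apply: leq_ltn_trans (aw 0 isT); rewrite addn0 leq_addl.
  have a5' : 5 * v < 2 ^ w by apply: leq_ltn_trans a5; rewrite leq_addl.
  apply/wp_seq/wp_assign => /=.
    by rewrite e39 l27 a5 a5' -[_ + (11 + _)]addn0 aw // (lit 11) // (lit 5).
  rewrite /put /= aE; set r4 := fun y => if y == 40 then _ else _.
  have k4 x : x != 40 -> r4 x = r' x by rewrite /r4 => /negbTE->.
  have e40 : r4 40 = P i + (11 + 5 * v) by rewrite /r4 /=.
  clearbody r4; apply/wp_seq.
  apply: (@wp_conseq _ _ _ (fun t' r1 M1 => t' + 5 <= F v /\ exists d',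
    [/\ r1 38 = marks d', forall k, d k -> d' k,
        forall k, d' k -> occupied k /\ passes i (elt k) &
        forall k, occupied k -> elt k \in bk i v -> d' k])).
    apply: wp_if => /=.
    + by rewrite e40 aw // (lit 4) // (lit 0).
    + rewrite e40 (q_full okM) // eqb0 => nf.
      apply: (wp_conseq (@wp_fast i v d r4 _ okM im vW nf _ _ e40 _)).
      * by case: l11; split; rewrite k4.
      * by rewrite k4.
      * by rewrite k4.
      move=> t' r5 M1 _ _ _ [-> e38']; split; first by rewrite /F; clear; lia.
      eexists; split; [exact: e38' | by move=> k' /= -> | |] => k' /=.
        case/orP=> [/so // | /match_sound [o [y yb se]]]; split=> //.
        rewrite /passes nhuge; case: (boolP (elt k' \in X i)) => //= nX.
        move: yb; rewrite mem_filter => /andP[/eqP hy yX].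
        apply/hasP; exists y => //; rewrite se eqxx andbT.
        apply/andP; split; first by apply: contra nX => /eqP <-.
        have := cM _ o; rewrite mem_Z => /andP[_ /eqP e].
        by rewrite e -(modn_dvdm (hash 0 y) (W_dvd im)) hy vu.
      by move=> o xb; rewrite [matched _ _ _]match_complete ?orbT.
    + rewrite e40 (q_full okM) // eqb0 negbK => fl.
      apply: (wp_conseq (@wp_slow i d r4 _ okM im _ _ _ _ _)); rewrite ?k4 //.
      move=> t' r5 M1 _ _ _ [tE e38']; split.
        by rewrite /F fl mul1n; clear -tE; lia.
      eexists; split; [exact: e38' | by move=> k' /= -> | |] => k' /=.
        by case/orP=> [/so // | /andP[o xX]]; split=> //; rewrite /passes xX.
      by rewrite mem_filter => -> /andP[_ ->]; rewrite orbT.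
  move=> t1 r1' M1 kk _ /(_ isT)-> [t1F [d' [e38' dd so' co']]].
  have [n39 n8] : r1' 39 = v /\ r1' 8 = W b by rewrite !kk // !k4.
  have vW2 : v + W b < 2 ^ w.
    apply: (q_small im); rewrite q_totE; have := W_le_min im; clear -vW; lia.
  apply: wp_assign => /=; first by rewrite n39 n8.
  rewrite n39 n8; exists (v + W b), d'; split.
  - split; rewrite /put //=; first by rewrite modnDr.
    by have := q_W0 b; clear -kge vW; lia.
  - have hv : minn v (W i) = v by apply/minn_idPl/ltnW.
    rewrite hv in tS; apply: (@leq_trans (S v.+1)).
      by rewrite SS vu eqxx; clear -tS t1F; lia.
    by apply: Smon; have := q_W0 b; clear -vW; lia.
  - exact: so'.
  - move=> kb o xX lt; case: (ltngtP (hash 0 (elt kb) %% W i) v) => h.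
    + by apply: dd; apply: co.
    + have := cM _ o; rewrite mem_Z => /andP[_ /eqP e].
      rewrite -(modn_dvdm _ (W_dvd im)) in e.
      set z := _ %% W i in h lt e.
      have : W b %| z - v by rewrite -eqn_mod_dvd ?(ltnW h) // e vu.
      by rewrite gtnNdvd //; clear -h lt; lia.
    + by apply: co' => //; rewrite mem_filter h eqxx.
- rewrite g37 h8 h10 -leqNgt => nh.
  have nhuge : huge i by [].
  rewrite /costE nhuge.
  apply: (wp_conseq (wp_slow okM im g27 h19 h20 h9 _)).
    by rewrite g38; apply/esym/marks_none.
  move=> t r' M' kp _ _ [tE e38]; split; first by clear -tE; lia.
  eexists; split; [exact: e38 | by rewrite kp | |] => k /=.
    by case/andP=> o xX; split=> //; rewrite /passes xX.
  by move=> -> ->.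
Qed.

Lemma wp_extract p s r M : mem_ok M -> outp p r M ->
  (forall x, x \in Z -> ~~ p x) -> sorted ltn s ->
  (forall k, k \in s -> k < blocks w /\ occupied k) ->
  r 0 = m -> r 1 = H -> r 3 = work -> r 34 = word_n w rho Z ->
  r 14 = 2 ^ (block w).-1 -> r 15 = 2 ^ block w ->
  r 19 = base b u -> r 9 = P b + elements_at w (n b) ->
  r 35 = top_bits (block w) s ->
  wp extract_cmd (fun t r' M' =>
    [/\ t <= 1 + \sum_(k <- s) (8 + verify_cost (elt k)), mem_ok M' &
      outp (fun x => p x || (x \in [seq elt k | k <- s])) r' M']) r M.
Proof.
move=> okM oO np so occ r0 r1 r3 r34 r14 r15 r19 r9 r35; have lit := q_lit.
have uZ := uniq_Z.
pose S s1 := \sum_(k <- s1) (8 + verify_cost (elt k)).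
apply: (@wp_while _ _ (fun (k t : nat) (r' M' : store) => exists s1 s2,
  [/\ s = s1 ++ s2 /\ k = size s2, r' 35 = top_bits (block w) s2, mem_ok M',
      outp (fun x => p x || (x \in [seq elt j | j <- s1])) r' M' & t <= S s1])).
  exists (size s), [::], s; rewrite r35; split=> //.
  by apply: outp_ext oO => // x _ _; rewrite orbF.
move=> k t r' M' [s1 [s2 [[sE kE] e35 okM' o' tS]]] kp _ _.
have g34 : r' 34 = word_n w rho Z by rewrite kp.
have [g0 g1 g3 g9] : [/\ r' 0 = m, r' 1 = H, r' 3 = work &
  r' 9 = P b + elements_at w (n b)] by rewrite !kp.
have [g14 g15 g19] : [/\ r' 14 = 2 ^ (block w).-1, r' 15 = 2 ^ block w &
  r' 19 = base b u] by rewrite !kp.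
case: s2 sE kE e35 => [|k0 s2] sE kE e35.
  rewrite /= e35 /top_bits big_nil; split; rewrite ?lit // => _; split=> //.
    by move: tS; rewrite sE cats0 /S; clear; lia.
  by rewrite sE cats0.
have [k0Q k0o] : k0 < blocks w /\ occupied k0.
  by apply: occ; rewrite sE mem_cat inE eqxx orbT.
have so2 : sorted ltn (k0 :: s2).
  by move: so; rewrite sE; case: (s1) => //= z s3; rewrite cat_path => /andP[_ /path_sorted].
have pop := top_bits_pop (field_gt0 w) (blockE w) so2; rewrite -e35 in pop.
have tb : r' 35 = 2 ^ (block w * k0) * 2 ^ (block w).-1 + top_bits (block w) s2.
  by rewrite e35 /top_bits big_cons expnD.
have pos : 0 < r' 35 by rewrite tb addn_gt0 muln_gt0 !expn_gt0.
split=> /=; rewrite ?lit ?pos //.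
move=> _; rewrite kE /=; split=> //.
apply/wp_seq/wp_assign => /=; first by rewrite (lit 1) // pos.
rewrite pop; set x := elt k0; have xZ : x \in Z by apply: elt_mem.
have jn : index x Z < size Z by rewrite index_mem.
have jY := base_Z_lt jn; set j := base b u + index x Z in jY.
have [_ _ _] := q_element okM' bm jY; set a := P b + _ + 5 * j => _.
have aw : a < 2 ^ w.
  by rewrite /a -addnA; apply: q_addr => //;
     rewrite q_totE /elements_at /header -/(W b); clear -jY; lia.
have a5 : 5 * j < 2 ^ w by apply: leq_ltn_trans aw; rewrite leq_addl.
have aj : j < 2 ^ w by apply: leq_ltn_trans a5; rewrite leq_pmull.
apply/wp_seq/wp_assign; rewrite /put /=.
  have nw := word_n_lt lw nfZ.
  rewrite {1 2}tb leq_addl /=; set q := r' 34 %/ _.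
  have qn : q <= r' 34 by apply: leq_div.
  have qd := leq_divM q (r' 15); rewrite qd andbT.
  by rewrite g34 in qn; clear -qn nw qd; lia.
rewrite tb addnK g14 mulnK ?expn_gt0 // g34 g15 modn_sub.
rewrite word_n_digit // -/x.
apply/wp_seq/wp_assign; rewrite /put //=.
apply/wp_seq/wp_assign; rewrite /put /=.
  by rewrite g9 g19 -/j -/a aj a5 aw lit.
rewrite g9 g19 -/j -/a; set r2 := fun y => if y == 22 then _ else _.
have k2 y : y \notin [:: 22; 35; 41; 42] -> r2 y = r' y.
  by rewrite !inE !negb_or /r2 => /and4P[/negbTE-> /negbTE-> /negbTE-> /negbTE->].
have [h22 h35] : r2 22 = a /\ r2 35 = top_bits (block w) s2 by [].
clearbody r2.
apply: (wp_conseq (@wp_verify (fun x => p x || (x \in [seq elt j | j <- s1]))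
  x j r2 _ okM' _ _ _ _ _ _ _ h22)); rewrite ?k2 //.
- by apply: outp_ext o'; rewrite ?k2.
- rewrite negb_or np //; apply/mapP => -[k1 ks1 /esym xk].
  have [_ o1] : k1 < blocks w /\ occupied k1 by apply: occ; rewrite sE mem_cat ks1.
  have kk : k1 = k0 by rewrite -(place_elt uZ o1) xk place_elt.
  have := sorted_uniq ltn_trans ltnn so; rewrite sE cat_uniq => /and3P[_ /hasPn/(_ k0)].
  by rewrite inE eqxx -kk ks1 => /(_ isT).
- by rewrite /j nth_Y_Z // nth_index.
move=> t1 r5 M3 kk _ _ [t1E okM3 o3].
exists (rcons s1 k0), s2; split.
- by rewrite cat_rcons.
- by rewrite kk.
- by [].
- by apply: outp_ext o3 => // y _ _; rewrite map_rcons mem_rcons inE -orbA; congr (_ || _); apply: orbC.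
- rewrite /S -cats1 big_cat big_seq1 /= -/(S s1) -/x.
  by clear -tS t1E; lia.
Qed.

End Bucket.

Definition query_regs (r : store) : Prop :=
  [/\ [/\ r 0 = m, r 1 = H & r 3 = work],
      [/\ r 5 = P b, r 8 = W b, r 9 = P b + elements_at w (n b) & r 10 = w],
      has_constants r & r 14 = 2 ^ (block w).-1 /\ r 15 = 2 ^ block w].

Lemma query_regs_ext r r' :
  (forall x, x \in [:: 0; 1; 3; 5; 8; 9; 10; 11; 12; 13; 14; 15] -> r' x = r x) ->
  query_regs r -> query_regs r'.
Proof.
move=> e [[? ? ?] [? ? ? ?] [? ? ?] [? ?]].
by split; first split; try split; try split; rewrite e.
Qed.

Definition before u x := hash 0 x %% W b < u.

Lemma wp_bucket_query u r M : u < W b -> mem_ok M -> query_regs r -> r 17 = u ->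
  outp (before u) r M ->
  wp bucket_query_cmd (fun t r' M' =>
    [/\ t <= bucket_cost u, mem_ok M' & outp (before u.+1) r' M']) r M.
Proof.
move=> uW okM hr r17 oO; have lit := q_lit.
have aw l : l < 9 -> P b + (11 + 5 * u) + l < 2 ^ w.
  by move=> hl; rewrite -addnA; apply: q_addr => //; rewrite q_totE; clear -uW hl; lia.
have a5 : 11 + 5 * u < 2 ^ w.
  by apply: leq_ltn_trans (aw 0 isT); rewrite addn0 leq_addl.
have a5' : 5 * u < 2 ^ w by apply: leq_ltn_trans a5; rewrite leq_addl.
have b0 := q_base okM bm (ltnW uW); have b1 := q_base okM bm uW.
have fl := q_full okM bm uW.
have beforeS x : before u.+1 x = before u x || (hash 0 x %% W b == u).
  by rewrite /before ltnS leq_eqVlt orbC.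
have npx x : x \in bk b u -> ~~ before u x.
  by rewrite mem_Z /before => /andP[_ /eqP->]; rewrite ltnn.
set a := P b + (11 + 5 * u) in aw b0 b1 fl.
have b1' : M (a + 8) = base b u.+1.
  by rewrite -b1; congr (M _); rewrite /a; clear; lia.
apply/wp_seq/wp_assign => /=.
  case: (hr) => _ [-> _ _ _] _ _; rewrite r17 a5 a5' -/a -[a]addn0 aw // (lit 11) //.
  by rewrite (lit 5).
have -> : r 5 + (11 + 5 * r 17) = a by rewrite r17; case: (hr) => _ [-> _ _ _].
apply/wp_seq/wp_assign; rewrite /put /=; first by rewrite aw // lit.
rewrite b0; apply/wp_seq/wp_assign; rewrite /put /=; first by rewrite aw // lit.
rewrite b1'; set r2 := fun y => if y == 20 then _ else _.
have k2 y : y \notin [:: 18; 19; 20] -> r2 y = r y.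
  by rewrite !inE !negb_or /r2 => /and3P[/negbTE-> /negbTE-> /negbTE->].
have [h18 h19 h20] : [/\ r2 18 = a, r2 19 = base b u & r2 20 = base b u.+1] by [].
have hr2 : query_regs r2.
  by apply: query_regs_ext hr => x; rewrite !inE => hx; apply: k2; move: hx; rewrite !inE; clear; lia.
have h17 : r2 17 = u by rewrite k2.
have {}oO : outp (before u) r2 M by apply: outp_ext oO; rewrite ?k2.
clearbody r2; clear hr r17 k2 r.
have szZ : size (bk b u) < 2 ^ w.
  apply: (q_small bm); rewrite q_totE.
  have := @size_sorted_by_bucket w rho (X b) (W b) u.+1 (q_W0 b) uW.
  by rewrite -/(base b u.+1) base_Z -/(n b); clear; lia.
apply: wp_if => /=; first by rewrite h18 aw // (lit 4) // (lit 0).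
  rewrite h18 fl eqb0 => nf; have [e0 _ e2] := q_words okM bm uW nf.
  apply/wp_seq/wp_assign; rewrite /put /=; first by rewrite h18 aw // lit.
  rewrite h18 e0; apply/wp_seq/wp_assign; rewrite /put /=; first by rewrite h18 aw // lit.
  rewrite h18 e2; apply/wp_seq/wp_assign; rewrite /put //=.
  set r3 := fun y => if y == 35 then _ else _.
  have k3 y : y \notin [:: 33; 34; 35] -> r3 y = r2 y.
    by rewrite !inE !negb_or /r3 => /and3P[/negbTE-> /negbTE-> /negbTE->].
  have [h33 h34 h35] : [/\ r3 33 = word_a w rho (bk b u),
     r3 34 = word_n w rho (bk b u) & r3 35 = marks w (fun=> true)].
    by rewrite marks_all; case: (hr2) => _ _ [_ _ <-] _.
  have hr3 : query_regs r3.
    by apply: query_regs_ext hr2 => x; rewrite !inE => hx; apply: k3; move: hx; rewrite !inE; clear; lia.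
  have [g17 g19 g20] : [/\ r3 17 = u, r3 19 = base b u & r3 20 = base b u.+1] by rewrite !k3.
  have {}oO : outp (before u) r3 M by apply: outp_ext oO; rewrite ?k3.
  clearbody r3; clear k3.
  set Z := bk b u in h33 h34 nf npx.
  have uZ : uniq Z by apply: uniq_Z.
  pose S j := \sum_(i <- iota 0 j) (4 + filter_cost i u).
  apply/wp_seq; apply: (@wp_for _ _ m (fun j t r' M' => t <= S j /\ exists c,
    [/\ r' 35 = marks w c,
        forall k, c k -> all (passes^~ (elt w rho Z k)) (iota 0 j) /\
          (0 < j -> occupied w rho Z k) &
        forall k, occupied w rho Z k ->
          all (fun i => elt w rho Z k \in X i) (iota 0 j) -> c k])) => //.
  - by apply: w_gt0.
  - by split=> //; exists (fun=> true); split; rewrite ?h35.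
  - move=> j t r' M' [tj [c [e35 so co]]] jm rj kp _ /(_ isT)->.
    have hr' : query_regs r'.
      by apply: query_regs_ext hr3 => x; rewrite !inE => hx; apply: kp; move: hx; rewrite !inE; clear; lia.
    have [l17 l19 l20 l33] : [/\ r' 17 = u, r' 19 = base b u, r' 20 = base b u.+1 &
      r' 33 = word_a w rho Z] by rewrite !kp.
    have [[l0 l1 _] [_ l8 l9 l10] lc _] := hr'.
    split=> // lt.
    apply: (wp_conseq (@wp_filter u uW nf j c r' _ okM lt lc l33 l1 rj l8 l10 l17 l19 l20 l9 e35)).
    move=> t1 r4 M4 k4 _ _ [t1E [d [e35' so' co']]]; split; first by rewrite k4.
    split; first by rewrite /S sum_iotaS -/(S j); clear -tj t1E; lia.
    exists (fun k => c k && d k); split=> // k.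
    + rewrite -[j.+1]addn1 iotaD all_cat /= andbT => /andP[/so [-> _] /so' [o ps]].
      by split=> //.
    + move=> o; rewrite -[j.+1]addn1 iotaD all_cat /= andbT => /andP[al xj].
      by rewrite co // co'.
  move=> t r' M' [tm [c [e35 so co]]] _ kp _ /(_ isT)->.
  have hr' : query_regs r'.
    by apply: query_regs_ext hr3 => x; rewrite !inE => hx; apply: kp; move: hx; rewrite !inE; clear; lia.
  have [l17 l19 l34] : [/\ r' 17 = u, r' 19 = base b u & r' 34 = word_n w rho Z].
    by rewrite !kp.
  have [[l0 l1 l3] [_ l8 l9 l10] _ [l14 l15]] := hr'.
  set s := [seq k <- iota 0 (blocks w) | c k].
  have e35s : r' 35 = top_bits (block w) s by rewrite e35 /marks packed_top_bits.
  have sP k : (k \in s) = (k < blocks w) && c k by rewrite mem_filter mem_iota add0n andbC.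
  have oP k : k \in s -> k < blocks w /\ occupied w rho Z k.
    by rewrite sP => /andP[kQ /so [_ o]]; split=> //; apply: o.
  apply: (wp_conseq (@wp_extract u uW nf (before u) s r' _ okM _ npx _ oP
    l0 l1 l3 l34 l14 l15 l19 l9 e35s)).
  + by apply: outp_ext oO; rewrite ?kp.
  + by apply: sorted_filter; [exact: ltn_trans | exact: iota_ltn_sorted].
  move=> t1 r4 M4 _ _ _ [t1E okM4 o4].
  have inj : {in s &, injective (elt w rho Z)}.
    move=> k k' /oP[_ o] /oP[_ o'] e.
    by rewrite -(place_elt uZ o) e place_elt.
  split=> //.
    rewrite /bucket_cost (negbTE nf) -/(S m).
    have : \sum_(k <- s) (8 + verify_cost (elt w rho Z k)) <=
      \sum_(x <- Z | all (passes^~ x) (iota 0 m)) (8 + verify_cost x).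
      rewrite -(big_map (elt w rho Z) xpredT (fun x => 8 + verify_cost x)) -[X in _ <= X]big_filter.
      apply: leq_sum_subseq; first by rewrite map_inj_in_uniq // filter_uniq // iota_uniq.
        exact: filter_uniq.
      move=> x /mapP[k ks ->]; rewrite mem_filter; have [_ o] := oP _ ks.
      by move: ks; rewrite sP => /andP[_ /so [-> _]]; rewrite elt_mem.
    by rewrite -/Z in t1E *; clear -tm t1E; lia.
  apply: outp_ext o4 => // x xX ix; rewrite beforeS; congr (_ || _).
  apply/mapP/idP => [[k /oP[_ o] ->] | hx].
    by have := elt_mem o; rewrite mem_Z => /andP[].
  have xZ : x \in Z by rewrite mem_Z xX.
  exists (place w rho Z x); last by rewrite elt_place.
  by rewrite sP place_lt // co ?occupied_place // elt_place.
rewrite h18 fl eqb0 negbK => fll.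
pose S k := \sum_(x <- take k (bk b u)) (8 + verify_cost x).
apply: (@wp_for _ _ (size (bk b u)) (fun k t r' M' => [/\ t <= S k, mem_ok M' &
   outp (fun x => before u x || (x \in take k (bk b u))) r' M'])) => //.
- by apply: w_gt0.
- by split=> //; apply: outp_ext oO => // x _ _; rewrite take0 orbF.
- move=> k t r' M' [tk okM' o'] kZ rk kp _ _.
  have hr' : query_regs r'.
    by apply: query_regs_ext hr2 => x; rewrite !inE => hx; apply: kp; move: hx; rewrite !inE; clear; lia.
  have [l19 l20] : r' 19 = base b u /\ r' 20 = base b u.+1 by rewrite !kp.
  split=> /=; first by rewrite l19 l20 base_Z leq_addr.
    by rewrite l19 l20 base_Z addKn.
  move=> lt; have jn := base_Z_lt uW lt; set j := base b u + k in jn.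
  case: (hr') => [[l0 l1 l3] [_ _ l9 _] _ _].
  set c := P b + elements_at w (n b) + 5 * j.
  have cw : c < 2 ^ w.
    rewrite /c -!addnA; apply: q_addr => //.
    by rewrite q_totE /elements_at /header -/(W b); clear -jn; lia.
  have c5 : 5 * j < 2 ^ w by apply: leq_ltn_trans cw; rewrite leq_addl.
  have cj : j < 2 ^ w by apply: leq_ltn_trans c5; rewrite leq_pmull.
  apply/wp_seq/wp_assign => /=.
    by rewrite l9 l19 rk -/j cj c5 cw lit.
  rewrite l9 l19 rk -/j -/c.
  set x := nth 0 (bk b u) k.
  have xZ : x \in bk b u by apply: mem_nth.
  have xn : x \notin take k (bk b u).
    have := uniq_Z u; rewrite -{1}(cat_take_drop k (bk b u)) cat_uniq (drop_nth 0 lt).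
    by case/and3P => _ + _; rewrite /= negb_or => /andP[].
  set r3 := put r' 22 _.
  have k3 y : y != 22 -> r3 y = r' y by rewrite /r3 /put => /negbTE->.
  have h22 : r3 22 = c by rewrite /r3 /put eqxx.
  clearbody r3.
  apply: (wp_conseq (@wp_verify (fun x => before u x || (x \in take k (bk b u)))
    x j r3 _ okM' _ _ _ _ _ jn _ h22)); rewrite ?k3 //.
  + by apply: outp_ext o'; rewrite ?k3.
  + by rewrite negb_or npx.
  + by rewrite /j nth_Y_Z.
  move=> t1 r4 M4 k4 _ _ [t1E okM4 o4]; split; first by rewrite k4 ?k3.
  split=> //.
    by rewrite /S (take_nth 0 lt) -cats1 big_cat big_seq1 /= -/(S k) -/x; clear -tk t1E; lia.
  apply: outp_ext o4; first by rewrite /put /=.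
  by move=> y _ _; rewrite (take_nth 0 lt) mem_rcons inE -/x -orbA; congr (_ || _); apply: orbC.
move=> t r' M' [tk okM' o'] _ _ _ _; split=> //.
  by rewrite /bucket_cost fll; move: tk; rewrite /S take_size; clear; lia.
apply: outp_ext o' => // x xX _.
by rewrite take_size beforeS mem_Z xX.
Qed.

Lemma wp_query r M : (forall i, i < b -> n b < n i) ->
  mem_ok M -> r 0 = m -> r 1 = H -> r 3 = work ->
  wp query_cmd (fun t r' M' => t <= query_cost /\ r' 1 = work /\ exists O,
    [/\ r' 0 = size O, forall j, j < size O -> M' (work + j) = nth 0 O j, uniq O &
      forall x, (x \in O) = (x \in X b) && inter x]) r M.
Proof.
move=> first okM r0 r1 r3; have lit := q_lit.
have hP i k : i < m -> k < 11 -> P i + k < 2 ^ w.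
  by move=> im hk; apply: q_addr => //; rewrite q_totE; clear -hk; lia.
have getP i : i < m -> M (H + i) = P i by case: okM => + _; apply.
have H0 : H + 0 < 2 ^ w by apply: Hw.
apply/wp_seq/wp_assign => /=; first by rewrite r1 H0 lit.
rewrite r1 (getP 0) //; set r2 := put r 5 _.
have k2 x : x != 5 -> r2 x = r x by rewrite /r2 /put => /negbTE->.
have h5 : r2 5 = P 0 by rewrite /r2 /put eqxx.
have [h0 h1 h3] : [/\ r2 0 = m, r2 1 = H & r2 3 = work] by rewrite !k2.
clearbody r2; apply/wp_seq.
apply: (@wp_for _ _ m (fun j t r' M' => t <= 8 * j /\ exists b',
  [/\ b' < m, b' <= j, r' 5 = P b', forall i, i < j -> n b' <= n i &
      forall i, i < b' -> n b' < n i])) => //.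
- by apply: w_gt0.
- by split=> //; exists 0; split.
- move=> j t r' M' [tj [b' [b'm b'j e5 mn fst]]] jm rj kp _ /(_ isT)->.
  have [l0 l1] : r' 0 = m /\ r' 1 = H by rewrite !kp.
  split=> // lt; apply/wp_seq/wp_assign => /=; first by rewrite l1 rj Hw.
  rewrite l1 rj getP //; set r4 := put r' 7 _.
  have [g5 g7 g6] : [/\ r4 5 = P b', r4 7 = P j & r4 6 = j] by rewrite /r4 /put /= e5 rj.
  clearbody r4.
  have e1 i : i < m -> M (P i + 0) = n i by move=> im; rewrite (q_header okM im).
  apply: wp_if => /=; first by rewrite g5 g7 !hP // lit.
  + rewrite g5 g7 !e1 // => lt'; apply: wp_assign => //=.
    rewrite /put /= g7; split=> //; split; first by clear -tj; lia.
    exists j; split=> // [i|i ij].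
      rewrite ltnS leq_eqVlt => /orP[/eqP-> // | ij].
      exact: leq_trans (ltnW lt') (mn _ ij).
    exact: leq_trans lt' (mn _ ij).
  + rewrite g5 g7 !e1 // -leqNgt => le'; apply: wp_skip.
    rewrite /put /= g5; split=> //; split; first by clear -tj; lia.
    exists b'; split=> // [|i]; first by rewrite leqW.
    by rewrite ltnS leq_eqVlt => /orP[/eqP-> // | ij]; apply: mn.
move=> t r' M' [tm [b' [b'm _ e5 mn fst]]] _ kp _ /(_ isT)->.
have b'E : b' = b.
  case: (ltngtP b' b) => // h.
    by have := leq_trans (first _ h) (mn _ bm); rewrite ltnn.
  by have := leq_trans (fst _ h) (b_min b'm); rewrite ltnn.
move: e5; rewrite b'E {b' b'm mn fst b'E} => e5.
have [l0 l1 l3] : [/\ r' 0 = m, r' 1 = H & r' 3 = work] by rewrite !kp.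
clear kp h0 h1 h3 h5 k2 r2 r0 r1 r3.
have qh := q_header okM bm.
have hb k : k < 11 -> P b + k < 2 ^ w := hP b k bm.
apply/wp_seq/wp_assign => /=; first by rewrite e5 hb // lit.
rewrite e5 qh // -[nth _ _ _]/(W b); apply/wp_seq/wp_assign; rewrite /put /=.
  rewrite e5 qh // hb // (lit 3) //= q_addr //.
  by rewrite q_totE /elements_at /header -/(W b); have := q_C0 b; clear; lia.
rewrite e5 qh // -[nth _ _ _]/(elements_at w (n b)).
apply/wp_seq/wp_assign; rewrite /put /=; first by rewrite e5 hb // lit.
rewrite e5 qh // -[nth _ _ _]/w.
apply/wp_seq/wp_assign; rewrite /put /=; first by rewrite e5 hb // lit.
rewrite e5 qh //; apply/wp_seq/wp_assign; rewrite /put /=; first by rewrite e5 hb // lit.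
rewrite e5 qh //; apply/wp_seq/wp_assign; rewrite /put /=; first by rewrite e5 hb // lit.
rewrite e5 qh //; apply/wp_seq/wp_assign; rewrite /put /=; first by rewrite e5 hb // lit.
rewrite e5 qh //; apply/wp_seq/wp_assign; rewrite /put /=; first by rewrite e5 hb // lit.
rewrite e5 qh //; apply/wp_seq/wp_assign; rewrite /put /=; first by rewrite lit.
set r2 := fun y => if y == 16 then _ else _.
have hr2 : query_regs r2 by [].
have h16 : r2 16 = 0 by [].
have h1 : r2 1 = H by case: hr2 => [[]].
clearbody r2.
pose S j := \sum_(u <- iota 0 j) (4 + bucket_cost u).
have WW : W b < 2 ^ w by apply: (q_small bm); rewrite q_totE; clear; lia.
apply/wp_seq; apply: (@wp_for _ _ (W b) (fun u t r' M' =>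
  [/\ t <= S u, mem_ok M' & outp (before u) r' M'])) => //.
- by apply: w_gt0.
- split=> //; exists [::]; split=> // x.
  by rewrite /before ltn0 !andbF.
- move=> u t1 r4 M4 [t1E okM4 o4] uW ru kp _ _.
  have hr4 : query_regs r4.
    by apply: query_regs_ext hr2 => x; rewrite !inE => hx; apply: kp; move: hx; rewrite !inE; clear; lia.
  have e8 : r4 8 = W b by case: hr4 => _ [].
  split=> // lt.
  apply: (wp_conseq (@wp_bucket_query u r4 _ lt okM4 hr4 ru o4)).
  move=> t2 r6 M6 k6 _ _ [t2E okM6 o6]; split; first by rewrite k6.
  by split=> //; rewrite /S sum_iotaS -/(S u); clear -t1E t2E; lia.
move=> t1 r4 M4 [t1E okM4 [O [o1 o2 o3 o4]]] _ kp _ _.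
have hr4 : query_regs r4.
  by apply: query_regs_ext hr2 => x; rewrite !inE => hx; apply: kp; move: hx; rewrite !inE; clear; lia.
have e3 : r4 3 = work by case: hr4 => [[]].
apply/wp_seq/wp_assign => //=; apply: wp_assign => //=.
rewrite /put /= e3; split.
  by rewrite /query_cost -/(S (W b)); clear -tm t1E; lia.
split=> //; exists O; split=> // x.
by rewrite o4 /before ltn_mod q_W0 andbT.
Qed.

End Output.

End Query.


(** * Averages over the seed *)

Definition mean_le (A : finType) (f : A -> nat) (c : nat) : Prop :=
  \sum_(a : A) f a <= c * #|A|.

Section Mean.
Variable A : finType.
Implicit Types (f g : A -> nat) (c d : nat).

Lemma mean_le_trans f g c d : (forall a, f a <= g a) -> c <= d ->
  mean_le g c -> mean_le f d.
Proof.
move=> fg cd h; apply: leq_trans (leq_sum _ (fun a _ => fg a)) _.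
by apply: leq_trans h _; rewrite leq_mul2r cd orbT.
Qed.

Lemma mean_le_const c : mean_le (fun _ : A => c) c.
Proof. by rewrite /mean_le sum_nat_const mulnC. Qed.

Lemma mean_leD f g c d : mean_le f c -> mean_le g d ->
  mean_le (fun a => f a + g a) (c + d).
Proof. by rewrite /mean_le big_split mulnDl; apply: leq_add. Qed.

Lemma mean_leM k f c : mean_le f c -> mean_le (fun a => k * f a) (k * c).
Proof. by rewrite /mean_le -big_distrr -mulnA leq_mul2l orbC => ->. Qed.

Lemma mean_le_div k f c : 0 < k -> mean_le (fun a => k * f a) (k * c) ->
  mean_le f c.
Proof. by move=> k0; rewrite /mean_le -big_distrr -mulnA leq_pmul2l. Qed.

Lemma mean_le_sum (I : Type) (s : seq I) (P : pred I) (F : I -> A -> nat) (G : I -> nat) :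
  (forall i, P i -> mean_le (F i) (G i)) ->
  mean_le (fun a => \sum_(i <- s | P i) F i a) (\sum_(i <- s | P i) G i).
Proof.
by move=> h; rewrite /mean_le exchange_big big_distrl; apply: leq_sum => i /h.
Qed.

End Mean.

Lemma mean_le_pair (A B : finType) (f : A -> B -> nat) (g : A -> nat) c :
  (forall a, mean_le (f a) (g a)) -> mean_le g c ->
  mean_le (fun ab : A * B => f ab.1 ab.2) c.
Proof.
move=> h1 h2; rewrite /mean_le -(pair_bigA _ f) /= card_prod mulnA.
apply: leq_trans (_ : \sum_a g a * #|B| <= _); first by apply: leq_sum => a _; apply: h1.
by rewrite -big_distrl leq_mul2r h2 orbT.
Qed.

Lemma mean_le_fst (A B : finType) (f : A -> nat) c :
  mean_le f c -> mean_le (fun ab : A * B => f ab.1) c.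
Proof. by apply: (@mean_le_pair A B (fun a _ => f a)) => a; apply: mean_le_const. Qed.

Lemma sum_pair_digits N K (g : nat -> nat) :
  \sum_(b < K) \sum_(a < N) g (a + N * b) = \sum_(s < N * K) g s.
Proof.
elim: K => [|K IH]; first by rewrite muln0 !big_ord0.
rewrite big_ord_recr /= IH -!(big_mkord xpredT g) mulnS addnC.
rewrite (@big_cat_nat _ _ _ (N * K) 0 (N + N * K)) ?leq_addl //= addnC; congr (_ + _).
rewrite -{2}[N * K]add0n big_addn addnK big_mkord.
by apply: eq_bigr => a _.
Qed.

(** * Universality of the hash functions *)

Section Toeplitz.
Variable w : nat.

Lemma lxor_bits (x y : nat) : Nat.lxor x y = 2 * Nat.lxor (x %/ 2) (y %/ 2) + (odd x (+) odd y).
Proof.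
apply: Nat.bits_inj => k; rewrite Nat.lxor_spec.
case: k => [|k].
  by rewrite !testbitE !expn0 !divn1 oddD oddM /= oddb; case: (odd x) (odd y) => [] [].
rewrite !testbitE !expnS !divnMA -!testbitE -Nat.lxor_spec.
have b : (odd x (+) odd y) %/ 2 = 0 by case: (_ (+) _).
by rewrite divnDl ?dvdn_mulr // mulKn // b addn0.
Qed.

Lemma lxor_div2 x y : Nat.lxor x y %/ 2 = Nat.lxor (x %/ 2) (y %/ 2).
Proof.
have b : (odd x (+) odd y) %/ 2 = 0 by case: (_ (+) _).
by rewrite lxor_bits divnDl ?dvdn_mulr // mulKn // b addn0.
Qed.

Lemma lxor_div x y t : Nat.lxor x y %/ 2 ^ t = Nat.lxor (x %/ 2 ^ t) (y %/ 2 ^ t).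
Proof.
by elim: t => [|t IH]; rewrite ?expn0 ?divn1 // expnSr !divnMA IH lxor_div2.
Qed.

Lemma odd_lxor x y : odd (Nat.lxor x y) = odd x (+) odd y.
Proof. by rewrite lxor_bits oddD oddM /= oddb. Qed.

Lemma lxor_mod x y t : Nat.lxor x y %% 2 ^ t = Nat.lxor (x %% 2 ^ t) (y %% 2 ^ t).
Proof.
apply: Nat.bits_inj => k.
rewrite Nat.lxor_spec -!pow_expn -!modE.
case: (ltnP k t) => kt.
  by rewrite !Nat.mod_pow2_bits_low ?Nat.lxor_spec //; apply/ltP.
by rewrite !Nat.mod_pow2_bits_high //; apply/leP.
Qed.

Lemma toeplitz_lxorl n x y s :
  toeplitz w n (Nat.lxor x y) s = Nat.lxor (toeplitz w n x s) (toeplitz w n y s).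
Proof.
elim: n x y s => //= n IH x y s; rewrite lxor_div2 IH odd_lxor.
set a := toeplitz _ _ _ _; set b := toeplitz _ _ _ _; set c := s %% _.
rewrite -!Nat.lxor_assoc; congr Nat.lxor.
rewrite [Nat.lxor (Nat.lxor _ a) _]Nat.lxor_assoc [Nat.lxor a _]Nat.lxor_comm -Nat.lxor_assoc.
congr Nat.lxor; case: (odd x) (odd y) => [] [] /=;
  by rewrite ?Nat.lxor_nilpotent ?Nat.lxor_0_r ?Nat.lxor_0_l.
Qed.

Lemma toeplitz_lxorr n x s s' :
  toeplitz w n x (Nat.lxor s s') = Nat.lxor (toeplitz w n x s) (toeplitz w n x s').
Proof.
elim: n x s s' => //= n IH x s s'; rewrite lxor_div2 IH lxor_mod.
set a := toeplitz _ _ _ _; set b := toeplitz _ _ _ _.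
rewrite -!Nat.lxor_assoc; congr Nat.lxor.
rewrite [Nat.lxor (Nat.lxor _ a) _]Nat.lxor_assoc [Nat.lxor a _]Nat.lxor_comm -Nat.lxor_assoc.
by congr Nat.lxor; case: (odd x) => //=; rewrite Nat.lxor_0_r.
Qed.

Lemma toeplitz_small n x s j : s < 2 ^ j -> toeplitz w n x s < 2 ^ j.
Proof.
elim: n x s => [|n IH] x s sj /=; first by rewrite expn_gt0.
apply: lxor_lt; first by case: odd; [apply: leq_ltn_trans (leq_mod _ _) sj | rewrite expn_gt0].
by apply: IH; apply: leq_ltn_trans (leq_div _ _) sj.
Qed.

(* If x is odd then bit j of the hash value is bit j of the seed plus a
   function of the higher bits of the seed. *)
Lemma toeplitz_kernel n x d t : t <= w -> odd x -> d < 2 ^ t ->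
  toeplitz w n.+1 x d %% 2 ^ t = 0 -> d = 0.
Proof.
move=> tw ox dt /= h; apply/eqP; rewrite -leqn0 leqNgt; apply/negP => d0.
have dw : d < 2 ^ w by apply: leq_trans dt _; rewrite leq_exp2l.
move: h; rewrite ox (modn_small dw) modn_small; last first.
  by apply: lxor_lt => //; apply: toeplitz_small; apply: leq_ltn_trans (leq_div _ _) dt.
move/Nat.lxor_eq => e.
have /andP[b1 b2] := trunc_log_bounds (isT : 1 < 2) d0.
have : toeplitz w n (x %/ 2) (d %/ 2) < 2 ^ trunc_log 2 d.
  by apply: toeplitz_small; rewrite ltn_divLR // mulnC -expnS.
by rewrite -e ltnNge b1.
Qed.

Lemma toeplitz_zeros n M z t : t <= w -> 0 < z < 2 ^ n -> t + n <= M ->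
  2 ^ t * \sum_(s < 2 ^ M) (toeplitz w n z s %% 2 ^ t == 0) <= 2 ^ M.
Proof.
move=> tw; elim: n M z => [|n IH] M z; first by case: z.
case: M => [|M]; first by rewrite addnS.
rewrite addnS ltnS; move=> /andP[z0 zn] tM.
case oz : (odd z); last first.
  have z2 : z = 2 * (z %/ 2) by rewrite mulnC divnK // dvdn2 oz.
  rewrite [2 ^ M.+1]expnS.
  rewrite -(sum_pair_digits 2 (2 ^ M) (fun s => toeplitz w n.+1 z s %% 2 ^ t == 0 : nat)).
  rewrite exchange_big.
  have e (a : 'I_2) (s : 'I_(2 ^ M)) : toeplitz w n.+1 z (a + 2 * s) = toeplitz w n (z %/ 2) s.
    rewrite /= oz Nat.lxor_0_l; congr toeplitz.
    by rewrite addnC mulnC divnMDl // divn_small ?addn0.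
  under eq_bigr => a _ do under eq_bigr => s _ do rewrite e.
  rewrite sum_nat_const card_ord mulnCA leq_pmul2l //; apply: IH tM.
  by rewrite divn_gt0 // ltn_divLR // mulnC -expnS zn andbT; clear -z2 z0; lia.
have tM1 : t <= M.+1 by apply: leq_trans (leq_trans (leq_addr n t) tM) (leqnSn _).
apply: (@leq_trans (2 ^ t * 2 ^ (M.+1 - t))); last by rewrite -expnD subnKC.
rewrite leq_mul2l; apply/orP; right.
have -> : \sum_(s < 2 ^ M.+1) (toeplitz w n.+1 z s %% 2 ^ t == 0) =
    #|[set s : 'I_(2 ^ M.+1) | toeplitz w n.+1 z s %% 2 ^ t == 0]|.
  by rewrite -sum1dep_card [RHS]big_mkcond; apply: eq_bigr => s _; case: eqP.
have hi (s : 'I_(2 ^ M.+1)) : s %/ 2 ^ t < 2 ^ (M.+1 - t).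
  by rewrite ltn_divLR ?expn_gt0 // -expnD subnK.
rewrite -[X in _ <= X]card_ord.
rewrite -(@card_in_imset _ _ (fun s => Ordinal (hi s))); first exact: max_card.
move=> s s'; rewrite !inE => /eqP h /eqP h' [e]; apply/val_inj/Nat.lxor_eq.
apply: (@toeplitz_kernel n _ _ _ tw oz).
  by rewrite -[_ < _]negbK -leqNgt -divn_gt0 ?expn_gt0 // lxor_div e Nat.lxor_nilpotent.
by rewrite toeplitz_lxorr lxor_mod h h'.
Qed.

Lemma toeplitz_universal x y t : t <= w -> x < 2 ^ w -> y < 2 ^ w -> x != y ->
  mean_le (fun s : 'I_(2 ^ (2 * w)) => 2 ^ t *
    (toeplitz w w x s == toeplitz w w y s %[mod 2 ^ t])) 1.
Proof.
move=> tw xw yw xy; rewrite /mean_le -big_distrr card_ord mul1n /=.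
have z0 : 0 < Nat.lxor x y < 2 ^ w.
  rewrite lxor_lt // andbT lt0n; apply: contra xy => /eqP.
  by move/Nat.lxor_eq => ->.
have tM : t + w <= 2 * w by clear -tw; lia.
apply: leq_trans (toeplitz_zeros tw z0 tM); rewrite leq_mul2l; apply/orP; right.
apply: leq_sum => s _; rewrite toeplitz_lxorl lxor_mod.
by case: eqP => // ->; rewrite Nat.lxor_nilpotent.
Qed.

End Toeplitz.

Section Polynomial.
Variable p : nat.
Hypothesis p_prime : prime p.

Import GRing.Theory.

Fixpoint digits_poly (n c : nat) : {poly 'F_p} :=
  if n is n'.+1 then
    (digits_poly n' c * 'X + ((c %/ p ^ n')%:R : 'F_p)%:P)%R
  else 0%R.

Lemma natF_mod k : ((k %% p)%N%:R = k%:R :> 'F_p)%R.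
Proof.
rewrite [in RHS](divn_eq k p) natrD natrM.
by rewrite (pcharf0 (pchar_Fp p_prime)) mulr0 add0r.
Qed.

Lemma natF_inj j k : (j%:R = k%:R :> 'F_p)%R -> j = k %[mod p].
Proof. by move/(congr1 val); rewrite /= !val_Fp_nat. Qed.

Lemma poly_hash_horner n c x :
  ((poly_hash p n c x)%:R = (digits_poly n c).[x%:R] :> 'F_p)%R.
Proof.
elim: n => [|n IH]; first by rewrite horner0.
by rewrite /= hornerMXaddC -IH natF_mod natrD natrM natF_mod.
Qed.

Lemma size_digits_poly n c : size (digits_poly n c) <= n.
Proof.
elim: n => [|n IH]; first by rewrite size_poly0.
by rewrite /= size_MXaddC; case: ifP.
Qed.

Lemma digit_mod c j k : j < k -> (c %% p ^ k) %/ p ^ j = c %/ p ^ j %[mod p].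
Proof.
move=> jk; have p0 := prime_gt0 p_prime.
have pE : p ^ k = p ^ (k - j).-1 * p * p ^ j.
  by rewrite -expnSr prednK ?subn_gt0 // -expnD subnK // ltnW.
rewrite [in RHS](divn_eq c (p ^ k)) [in X in _ = (X + _) %/ _ %% _]pE mulnA.
by rewrite divnMDl ?expn_gt0 ?p0 // mulnA modnMDl.
Qed.

Lemma poly_hash_mod c x j k : j <= k -> poly_hash p j (c %% p ^ k) x = poly_hash p j c x.
Proof. by elim: j => //= j IH jk; rewrite IH ?(ltnW jk) // digit_mod. Qed.

Lemma digits_poly_inj n c c' : c < p ^ n -> c' < p ^ n ->
  digits_poly n c = digits_poly n c' -> c = c'.
Proof.
have p0 := prime_gt0 p_prime.
have dE k d : digits_poly k (d %% p ^ k) = digits_poly k d.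
  move: (leqnn k); move: {1 3 5}k => j; elim: j => //= j IH jk.
  rewrite IH ?(ltnW jk) //; congr (_ + _%:P)%R.
  by rewrite -natF_mod digit_mod // natF_mod.
elim: n c c' => [|n IH] c c'; first by rewrite expn0 !ltnS !leqn0 => /eqP-> /eqP->.
move=> h h' /= e.
have e0 : ((c %/ p ^ n)%:R = (c' %/ p ^ n)%:R :> 'F_p)%R.
  by move/(congr1 (fun q : {poly 'F_p} => q`_0)%R): e; rewrite !coefD !coefMX !coefC !add0r.
have q0 d : d < p ^ n.+1 -> d %/ p ^ n < p by rewrite ltn_divLR ?expn_gt0 ?p0 // -expnS.
have {}e0 : c %/ p ^ n = c' %/ p ^ n.
  by move/natF_inj: e0; rewrite !modn_small ?q0.
have e1 : digits_poly n c = digits_poly n c'.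
  by move: e; rewrite e0 => /addIr /(mulIf (negbT (polyX_eq0 _))).
rewrite (divn_eq c (p ^ n)) (divn_eq c' (p ^ n)) e0; congr (_ + _).
by apply: IH; rewrite ?ltn_mod ?expn_gt0 ?p0 // !dE.
Qed.

Lemma poly_hash_inj n c c' (xs : seq nat) : c < p ^ n -> c' < p ^ n ->
  uniq xs -> size xs = n -> all (fun x => x < p) xs ->
  (forall x, x \in xs -> poly_hash p n c x = poly_hash p n c' x) -> c = c'.
Proof.
move=> h h' uxs sz xp e; apply: (digits_poly_inj h h').
apply/eqP; rewrite -subr_eq0; apply/negPn/negP => nz.
have := @max_poly_roots _ _ [seq x%:R | x <- xs]%R nz; rewrite size_map sz.
move=> le; suff : n < n by rewrite ltnn.
apply: leq_trans (le _ _) _.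
- apply/allP => _ /mapP[x xs_x ->].
  by rewrite rootE hornerD hornerN -!poly_hash_horner e // subrr.
- rewrite map_inj_in_uniq // => x y /(allP xp) xp' /(allP xp) yp.
  by move/natF_inj; rewrite !modn_small.
- apply: leq_trans (size_polyD _ _) _; rewrite size_polyN geq_max.
  by rewrite !size_digits_poly.
Qed.

Lemma count_residues V s : 0 < V -> V <= p ->
  V * #|[set v : 'I_p | v %% V == s]| <= 2 * p.
Proof.
move=> V0 Vp; have p0 := prime_gt0 p_prime.
have hi (v : 'I_p) : v %/ V < (p.-1 %/ V).+1.
  by rewrite ltnS leq_div2r // -ltnS prednK.
rewrite -(@card_in_imset _ _ (fun v => Ordinal (hi v))).
  apply: (@leq_trans (V * (p.-1 %/ V).+1)).
    by rewrite leq_mul2l -[X in _ <= X]card_ord max_card orbT.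
  by rewrite mulnS [V * _]mulnC; have := leq_divM p.-1 V; clear -p0 Vp; lia.
move=> v v'; rewrite !inE => /eqP h /eqP h' [e]; apply: val_inj => /=.
by rewrite (divn_eq v V) (divn_eq v' V) h h' e.
Qed.

(* A coefficient word c is determined by c %/ p ^ n and the values at n points. *)
Lemma poly_hash_count N n V s (xs : seq nat) : 0 < V -> V <= p ->
  p ^ n <= N -> uniq xs -> size xs = n -> all (fun x => x < p) xs ->
  V ^ n * \sum_(c < N) all (fun x => poly_hash p n c x %% V == s) xs <=
  2 * 2 ^ n * N.
Proof.
move=> V0 Vp pN uxs sz xp; have p0 := prime_gt0 p_prime.
case: n => [|n] in pN sz *.
  move/size0nil: sz => ->; rewrite !expn0 !mul1n sum_nat_const card_ord muln1.
  by rewrite mulnC; clear; lia.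
set P := fun c : 'I_N => all (fun x => poly_hash p n.+1 c x %% V == s) xs.
have -> : \sum_(c < N) P c = #|[set c : 'I_N | P c]|.
  by rewrite -sum1dep_card [RHS]big_mkcond; apply: eq_bigr => c _; case: (P c).
have pn0 : 0 < p ^ n.+1 by rewrite expn_gt0 p0.
have N0 := leq_trans pn0 pN.
have hi (c : 'I_N) : c %/ p ^ n.+1 < (N.-1 %/ p ^ n.+1).+1.
  by rewrite ltnS leq_div2r // -ltnS prednK.
have hv c x : poly_hash p n.+1 c x < p by rewrite /= ltn_mod.
pose f (c : 'I_N) := (Ordinal (hi c),
  [ffun i : 'I_n.+1 => Ordinal (hv c (nth 0 xs i))]).
set R := [set v : 'I_p | v %% V == s].
have sub : f @: [set c | P c] \subset setX setT [set g in ffun_on (mem R)].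
  apply/subsetP => _ /imsetP[c + ->]; rewrite !inE /= => /allP Pc.
  apply/ffun_onP => i; rewrite ffunE inE /=; apply: Pc; apply: mem_nth.
  by rewrite sz.
rewrite -(@card_in_imset _ _ f); last first.
  move=> c c'; rewrite !inE => _ _ [e /ffunP e']; apply: val_inj => /=.
  rewrite (divn_eq c (p ^ n.+1)) (divn_eq c' (p ^ n.+1)) e; congr (_ + _).
  apply: (@poly_hash_inj n.+1 _ _ xs); rewrite ?ltn_mod //.
  move=> x xx; have ix : index x xs < n.+1 by rewrite -sz index_mem.
  have := e' (Ordinal ix); rewrite !ffunE => -[]; rewrite nth_index //.
  by rewrite !(poly_hash_mod _ _ (leqnn _)).
apply: leq_trans (leq_mul (leqnn _) (subset_leq_card sub)) _.
rewrite cardsX cardsT card_ord cardsE card_ffun_on card_ord.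
have cr := count_residues s V0 Vp; rewrite -/R in cr.
have : V ^ n.+1 * #|R| ^ n.+1 <= 2 ^ n.+1 * p ^ n.+1 by rewrite -!expnMn leq_exp2r.
have : p ^ n.+1 * (N.-1 %/ p ^ n.+1).+1 <= 2 * N.
  by rewrite mulnS mulnC; have := leq_divM N.-1 (p ^ n.+1); clear -pN N0; lia.
set a := (_ %/ _).+1; set b := _ ^ _ * #|_| ^ _; set q := p ^ _.
move=> h1 h2; rewrite mulnCA -/b.
apply: (@leq_trans (a * (2 ^ n.+1 * q))); first by rewrite leq_mul2l h2 orbT.
have -> : a * (2 ^ n.+1 * q) = 2 ^ n.+1 * (q * a) by clear; lia.
by rewrite [2 * _]mulnC -mulnA leq_mul2l h1 orbT.
Qed.

End Polynomial.


(** * The expected cost of a query *)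

Lemma pow_self_fact k : k ^ k <= 4 ^ k * k`!.
Proof.
have h : forall j, j <= k -> k ^ j <= (k + k) ^_ j.
  elim=> [|j IH] jk; first by rewrite ffactn0.
  rewrite expnSr ffactnSr; apply: leq_mul; first by apply: IH; apply: ltnW.
  by clear -jk; lia.
apply: leq_trans (h k (leqnn k)) _; rewrite -bin_ffact leq_mul2r; apply/orP; right.
rewrite -[4]/(2 * 2) expnMn -expnD.
have kk : k < (k + k).+1 by rewrite ltnS leq_addr.
have := Pascal 1 1 (k + k); rewrite addn1 => ->.
rewrite (bigD1 (Ordinal kk)) //= !exp1n !muln1.
exact: leq_addr.
Qed.

Lemma bin_mul_fact_le j k : 'C(j, k) * k`! <= j ^ k.
Proof.
rewrite bin_ffact; elim: k => [|k IH]; first by rewrite ffactn0.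
by rewrite expnSr ffactnSr leq_mul // leq_subr.
Qed.

Definition seed_of (w s1 s2 q s3 : nat) : nat -> nat :=
  nth 0 [:: s1 %% 2 ^ w; s1 %/ 2 ^ w; s2 %% 2 ^ w; s2 %/ 2 ^ w; q;
            s3 %% 2 ^ w; s3 %/ 2 ^ w].

Section Seed.
Variable w : nat.
Hypothesis lw : large w.
Local Notation L := (ell w).
Local Notation V := (slots w).
Local Notation Q := (blocks w).
Local Notation S2 := 'I_(2 ^ (2 * w)).
Local Notation S1 := 'I_(2 ^ w).
Local Notation T := (toeplitz w w).

Lemma seed_pair s : s %% 2 ^ w + 2 ^ w * (s %/ 2 ^ w) = s.
Proof. by rewrite addnC mulnC -divn_eq. Qed.

Lemma hash0_seed s1 s2 q s3 x : hash w (seed_of w s1 s2 q s3) 0 x = T x s1.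
Proof. by rewrite /hash /seed_of /= seed_pair. Qed.

Lemma hash5_seed s1 s2 q s3 x : hash w (seed_of w s1 s2 q s3) 5 x = T x s3.
Proof. by rewrite /hash /seed_of /= seed_pair. Qed.

Lemma sig_seed s1 s2 q s3 x :
  sig w (seed_of w s1 s2 q s3) x = T x s2 %% 2 ^ sig_bits w.
Proof. by rewrite /sig /hash /seed_of /= seed_pair. Qed.

Lemma pow2above_universal k x y : pow2above k <= 2 ^ w ->
  x < 2 ^ w -> y < 2 ^ w -> x != y ->
  mean_le (fun s : S2 => pow2above k * (T x s %% pow2above k == T y s %% pow2above k)) 1.
Proof.
rewrite pow2aboveE leq_exp2l // => kw xw yw xy.
exact: toeplitz_universal.
Qed.

Lemma size_count_mem (U : eqType) (s : seq U) (P : pred U) : count P s = \sum_(x <- s) P x.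
Proof. by rewrite -sum1_count big_mkcond; apply: eq_bigr => x _; case: (P x). Qed.

Lemma collisions_mean k (Y : seq nat) x : pow2above k <= 2 ^ w -> x < 2 ^ w ->
  uniq Y -> (forall y, y \in Y -> y < 2 ^ w) ->
  mean_le (fun s : S2 => pow2above k *
    count (fun y => T y s %% pow2above k == T x s %% pow2above k) Y)
    (pow2above k * (x \in Y) + size Y).
Proof.
move=> kw xw uY Yw; set D := pow2above k.
apply: (@mean_le_trans _ _ (fun s : S2 => D * (x \in Y) +
   \sum_(y <- Y | (y \in Y) && (y != x)) D * (T y s %% D == T x s %% D))
   (D * (x \in Y) + \sum_(y <- Y | (y \in Y) && (y != x)) 1) _).
- move=> s; rewrite size_count_mem big_distrr /= -big_seq_cond.
  rewrite (bigID (pred1 x)) /= leq_add2r.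
  case: (boolP (x \in Y)) => xY; last first.
    rewrite big_seq_cond big_pred0 // => y.
    by case: eqP => [-> | _]; rewrite ?(negbTE xY) ?andbF.
  rewrite (big_rem _ xY) /= !eqxx big_seq_cond big_pred0 ?addn0 // => y.
  by case: (y =P x) => [-> | _]; rewrite ?mem_rem_uniqF ?andbF.
- rewrite leq_add2l sum1_count; exact: count_size.
apply: mean_leD; first exact: mean_le_const.
apply: mean_le_sum => y /andP[yY yx]; apply: pow2above_universal => //.
exact: Yw.
Qed.

Lemma slot_seed s1 s2 q s3 x : slot w (seed_of w s1 s2 q s3) x =
  poly_hash (modulus w) L q (T x s2 %% 2 ^ sig_bits w) %% V.
Proof. by rewrite /slot sig_seed. Qed.

Lemma exists_subset (U : finType) (B : {set U}) k : k <= #|B| ->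
  exists2 A : {set U}, #|A| == k & A \subset B.
Proof.
move=> kB; exists [set x in take k (enum B)].
  rewrite cardsE; apply/eqP; rewrite (card_uniqP _) ?take_uniq ?enum_uniq //.
  by rewrite size_take -cardE; case: ltngtP kB.
by apply/subsetP => x; rewrite inE => /mem_take; rewrite mem_enum.
Qed.

Lemma subsets_bound l : 32 * l <= Q -> w * (V * 'C(l, L) * 2 ^ L) <= V ^ L.
Proof.
move=> lQ; have f0 := fact_gt0 L; have L16 := ell_ge16 lw.
have h1 : 'C(l, L) * 8 ^ L <= V ^ L.
  rewrite -(leq_pmul2r (fact_gt0 L)) -(leq_pmul2r (_ : 0 < 4 ^ L)) ?expn_gt0 //.
  apply: (@leq_trans ((32 * l) ^ L)).
    have -> : 'C(l, L) * 8 ^ L * L`! * 4 ^ L = 32 ^ L * ('C(l, L) * L`!).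
      by rewrite -[32]/(4 * 8) expnMn; clear; lia.
    by rewrite expnMn leq_mul2l bin_mul_fact_le orbT.
  apply: (@leq_trans ((V * L) ^ L)); first by rewrite leq_exp2r //; apply: leq_trans L16.
  rewrite expnMn -mulnA leq_mul2l; apply/orP; right.
  by apply: leq_trans (pow_self_fact L) _; rewrite mulnC.
rewrite mulnC in h1; apply: leq_trans h1; have lt := lt_w_ell w; have ltV := slots_lt lw.
have -> : 8 ^ L = 2 ^ L * (2 ^ L * 2 ^ L) by rewrite -!expnMn.
have -> : w * (V * 'C(l, L) * 2 ^ L) = w * (V * 2 ^ L) * 'C(l, L) by clear; lia.
rewrite leq_mul2r; apply/orP; right; apply: leq_mul; first exact: ltnW.
by rewrite leq_mul2r ltnW ?orbT //; apply: ltn_trans ltV _.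
Qed.

Lemma overflow_mean s1 s2 Z : uniq [seq T y s2 %% 2 ^ sig_bits w | y <- Z] ->
  32 * size Z <= Q ->
  mean_le (fun q : S1 => w * full w (seed_of w s1 s2 q 0) Z) 2.
Proof.
set sg := fun y => _; move=> usg ZQ.
have L16 := ell_ge16 lw.
pose xs (A : {set 'I_(size Z)}) :=
  [seq sg (nth 0 Z i) | i : 'I_(size Z) <- enum A].
pose P (s : nat) A (q : nat) :=
  all (fun x => poly_hash (modulus w) L q x %% V == s) (xs A).
apply: (@mean_le_trans _ _ (fun q : S1 =>
  w * (\sum_(s <- iota 0 V) \sum_(A : {set 'I_(size Z)} | #|A| == L) P s A q)) 2 2) => //.
  move=> q; rewrite leq_mul2l; apply/orP; right.
  case: (boolP (full _ _ _)) => // /hasP[s sV big].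
  set B := [set i : 'I_(size Z) | slot w (seed_of w s1 s2 q 0) (nth 0 Z i) == s].
  have BE : #|B| = size (in_slot w (seed_of w s1 s2 q 0) Z s).
    rewrite /in_slot size_filter size_count_mem (big_nth 0) big_mkord -sum1_card.
    by rewrite big_mkcond; apply: eq_bigr => i _; rewrite inE; case: eqP.
  rewrite -BE in big; have [A cA AB] := exists_subset (ltnW big).
  rewrite (big_rem s) //= (bigD1 A) //=.
  suff -> : P s A q by [].
  apply/allP => _ /mapP[i + ->]; rewrite mem_enum => /(subsetP AB).
  by rewrite inE slot_seed.
apply: (@mean_le_div _ (V ^ L)); first by rewrite expn_gt0 slots_gt0.
pose c := w * (V * 'C(size Z, L) * (2 * 2 ^ L)).
apply: (@mean_le_trans _ _ (fun q : S1 => w * (\sum_(s <- iota 0 V)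
   \sum_(A : {set 'I_(size Z)} | #|A| == L) V ^ L * P s A q)) c).
- move=> q; rewrite mulnCA leq_mul2l; apply/orP; right; rewrite big_distrr.
  by apply: leq_sum => s _; rewrite big_distrr.
- by have := subsets_bound ZQ; rewrite /c; clear; lia.
apply: mean_leM.
have -> : V * 'C(size Z, L) * (2 * 2 ^ L) = \sum_(s <- iota 0 V)
   \sum_(A : {set 'I_(size Z)} | #|A| == L) 2 * 2 ^ L.
  rewrite big_const_seq count_predT size_iota iter_addn_0 sum_nat_cond_const.
  have := card_draws 'I_(size Z) L; rewrite card_ord cardsE => ->.
  by clear; lia.
apply: mean_le_sum => s _; apply: mean_le_sum => A /eqP cA.
have := @poly_hash_count _ (modulus_prime w) (2 ^ w) L V s (xs A) (slots_gt0 lw)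
  (slots_le_modulus lw) (modulus_pow lw).
rewrite /mean_le -big_distrr card_ord; apply.
- rewrite map_inj_in_uniq ?enum_uniq // => i j _ _ /eqP e; apply/val_inj/eqP.
  rewrite -(nth_uniq 0 _ _ usg) ?size_map ?ltn_ord //.
  by rewrite !(nth_map 0) ?ltn_ord.
- by rewrite size_map -cardE.
- apply/allP => _ /mapP[i _ ->]; apply: ltn_trans (modulus_gt w).
  by rewrite ltn_mod expn_gt0.
Qed.

Lemma mean_leD_cancel (A : finType) (f : A -> nat) c k :
  mean_le (fun a => f a + k) (c + k) -> mean_le f c.
Proof.
by rewrite /mean_le big_split sum_nat_const mulnDl [#|_| * k]mulnC leq_add2r.
Qed.

Lemma sum_iota_delta W a (g : nat -> nat) : a < W ->
  \sum_(v <- iota 0 W) (a == v) * g v = g a.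
Proof.
move=> aW; rewrite (bigD1_seq a) ?mem_iota ?iota_uniq //= eqxx mul1n big1 ?addn0 //.
by move=> v; rewrite eq_sym => /negbTE->.
Qed.

Lemma blocks_le_size (Z : seq nat) : 32 * size Z <= Q -> size Z <= w.
Proof. by have := blocks_lt lw; clear; lia. Qed.

Lemma full_light s1 Z : uniq Z -> (forall x, x \in Z -> x < 2 ^ w) ->
  32 * size Z <= Q ->
  mean_le (fun a : S2 * S1 => w * full w (seed_of w s1 a.1 a.2 0) Z) 3.
Proof.
move=> uZ Zw ZQ.
pose sg s2 y := T y s2 %% 2 ^ sig_bits w.
pose coll s2 := ~~ uniq [seq sg s2 y | y <- Z].
apply: (@mean_le_pair _ _ (fun (s2 : S2) (q : S1) => w * full w (seed_of w s1 s2 q 0) Z)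
  (fun s2 => w * coll s2 + 2)).
  move=> s2; case c : (coll s2).
    apply: (@mean_le_trans _ _ (fun=> w) w) => //; last exact: mean_le_const.
      by move=> q; case: full; rewrite ?muln1 ?muln0.
    by rewrite muln1 leq_addr.
  by rewrite muln0; apply: overflow_mean => //; apply: negbFE c.
apply: (@mean_leD _ _ _ 1); last exact: mean_le_const.
set D := 2 ^ sig_bits w.
have rw : sig_bits w <= w.
  by rewrite /sig_bits; have := ell_cube lw; have := ell_ge16 lw; nia.
apply: (@mean_le_div _ D); first by rewrite expn_gt0.
apply: (@mean_le_trans _ _ (fun s2 : S2 => w * \sum_(x <- Z | x \in Z)
   \sum_(y <- Z | (y \in Z) && (x != y)) D * (T x s2 == T y s2 %[mod D]))
  (w * \sum_(x <- Z | x \in Z) \sum_(y <- Z | (y \in Z) && (x != y)) 1)).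
- move=> s2; rewrite mulnCA leq_mul2l; apply/orP; right.
  case: (boolP (coll s2)) => [c | _]; last by rewrite muln0.
  under eq_bigr do rewrite -big_distrr; rewrite -big_distrr leq_mul2l lt0n.
  apply/orP; right; apply: contra c => /eqP z.
  rewrite map_inj_in_uniq // => x y xZ yZ e; apply/eqP/negPn/negP => ne.
  move/eqP: z; apply/negP; rewrite sum_nat_seq_neq0; apply/hasP; exists x => //.
  rewrite xZ sum_nat_seq_neq0; apply/hasP; exists y => //.
  by rewrite yZ ne /=; move: e; rewrite /sg => ->; rewrite eqxx.
- apply: (@leq_trans (w * (w * w))).
    rewrite leq_mul2l; apply/orP; right.
    apply: (@leq_trans (\sum_(x <- Z) w)).
      rewrite -big_seq; apply: leq_sum => x _; rewrite sum1_count.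
      exact: leq_trans (count_size _ _) (blocks_le_size ZQ).
    by rewrite big_const_seq count_predT iter_addn_0 leq_mul2l blocks_le_size // orbT.
  have lt := ltnW (lt_w_ell w); apply: (@leq_trans (2 ^ L * (2 ^ L * 2 ^ L))).
    by rewrite !leq_mul.
  by rewrite muln1 -!expnD leq_exp2l // /sig_bits; clear; lia.
apply: mean_leM; apply: mean_le_sum => x xZ; apply: mean_le_sum => y /andP[yZ xy].
by apply: toeplitz_universal => //; apply: Zw.
Qed.

Section Buckets.
Variables (j : nat) (Y : seq nat).
Local Notation W := (pow2above j).
Local Notation n := (size Y).
Hypotheses (Ww : W <= 2 ^ w) (uY : uniq Y) (Yw : forall y, y \in Y -> y < 2 ^ w).
Hypothesis nW : 64 * n <= W * Q.

Definition load s1 v := count (fun y => T y s1 %% W == v) Y.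

Lemma sum_load s1 : \sum_(v <- iota 0 W) load s1 v = n.
Proof.
under eq_bigr => v _ do rewrite /load size_count_mem.
rewrite exchange_big -[RHS]sum1_size; apply: eq_bigr => y _ /=.
under eq_bigr => v _ do rewrite -[nat_of_bool _]muln1.
by rewrite (sum_iota_delta (fun=> 1)) // ltn_mod pow2above_gt0.
Qed.

Lemma sum_load_sq s1 : \sum_(v <- iota 0 W) load s1 v * load s1 v =
  \sum_(x <- Y) count (fun y => T y s1 %% W == T x s1 %% W) Y.
Proof.
under eq_bigr => v _ do rewrite {1}/load size_count_mem big_distrl.
rewrite exchange_big; apply: eq_bigr => y _ /=.
by rewrite (sum_iota_delta (load s1)) // ltn_mod pow2above_gt0.
Qed.

Lemma heavy_ineq A W0 Q0 n0 l : A = W0 * l -> 64 * n0 <= W0 * Q0 ->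
  Q0 * (W0 * W0) * ((Q0 < 32 * l) * l) + 256 * (A * n0) <= 128 * (A * A) + 128 * (n0 * n0).
Proof.
move=> AE h; case: ltnP => [bad | _]; last first.
  rewrite mul0n muln0 add0n; case: (leqP A n0) => [/subnKC <- | /ltnW/subnKC <-];
    by set d := _ - _; clear; nia.
have h1 : W0 * Q0 <= 32 * A by rewrite AE; clear -bad; nia.
have h2 : 2 * n0 <= A by clear -h h1; lia.
have -> : Q0 * (W0 * W0) * (1 * l) = (W0 * Q0) * A by rewrite AE; clear; lia.
have h3 : W0 * Q0 * A <= 32 * (A * A) by clear -h1; nia.
apply: leq_trans (leq_add h3 (leqnn _)) _.
by clear -h2; rewrite -(subnKC h2); set d := _ - _; nia.
Qed.

(* Chebyshev: a heavy bucket is loaded at least twice as much as the mean. *)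
Lemma heavy_mean : mean_le (fun s1 : S2 =>
  \sum_(v <- iota 0 W) (Q < 32 * load s1 v) * load s1 v) (2 * W).
Proof.
have W0 : 0 < W := pow2above_gt0 j; have Q0 := blocks_gt0 lw.
apply: (@mean_le_div _ (Q * (W * W))); first by rewrite muln_gt0 Q0 muln_gt0 W0.
apply: (@mean_leD_cancel _ _ _ (256 * (W * (n * n)))).
apply: (@mean_le_trans _ _ (fun s1 : S2 => 128 * W * (W *
   \sum_(x <- Y) count (fun y => T y s1 %% W == T x s1 %% W) Y) + 128 * (W * (n * n)))
  (128 * W * (\sum_(x <- Y | x \in Y) (W * (x \in Y) + n)) + 128 * (W * (n * n)))).
- move=> s1; rewrite -sum_load_sq.
  have le : \sum_(v <- iota 0 W) (Q * (W * W) * ((Q < 32 * load s1 v) * load s1 v) +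
      256 * n * W * load s1 v) <=
      \sum_(v <- iota 0 W) (128 * (W * W) * (load s1 v * load s1 v) + 128 * (n * n)).
    apply: leq_sum => v _.
    have := @heavy_ineq (W * load s1 v) W Q n (load s1 v) erefl nW.
    set B := _ * (_ * load s1 v); set l := load s1 v.
    have -> : 256 * n * W * l = 256 * (W * l * n) by clear; lia.
    by have -> : 128 * (W * W) * (l * l) = 128 * (W * l * (W * l)) by clear; lia.
  rewrite big_split [X in _ <= X]big_split in le.
  have e1 : \sum_(v <- iota 0 W) Q * (W * W) * ((Q < 32 * load s1 v) * load s1 v) =
    Q * (W * W) * \sum_(v <- iota 0 W) (Q < 32 * load s1 v) * load s1 v.
    by rewrite big_distrr.
  have e2 : \sum_(v <- iota 0 W) 256 * n * W * load s1 v = 256 * n * W * n.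
    by rewrite -big_distrr /= sum_load.
  have e3 : \sum_(v <- iota 0 W) 128 * (W * W) * (load s1 v * load s1 v) =
    128 * (W * W) * \sum_(v <- iota 0 W) load s1 v * load s1 v.
    by rewrite big_distrr.
  have e4 : \sum_(v <- iota 0 W) 128 * (n * n) = 128 * (n * n) * W.
    by rewrite big_const_seq count_predT size_iota iter_addn_0.
  rewrite /= e1 e2 e3 e4 in le; move: le; clear.
  set B := _ * (W * W) * \sum_(v <- _) _; set C := \sum_(v <- _) _ * _.
  have -> : 256 * n * W * n = 256 * (W * (n * n)) by lia.
  have -> : 128 * (W * W) * C = 128 * W * (W * C) by lia.
  by have -> : 128 * (n * n) * W = 128 * (W * (n * n)) by lia.
- have -> : \sum_(x <- Y | x \in Y) (W * (x \in Y) + n) = n * (W + n).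
    rewrite (eq_bigr (fun=> W + n)) => [|x ->]; last by rewrite muln1.
    by rewrite -big_seq big_const_seq count_predT iter_addn_0 mulnC.
  by clear -nW; nia.
apply: mean_leD; last exact: mean_le_const.
apply: mean_leM.
apply: (@mean_le_trans _ _ (fun s1 : S2 => \sum_(x <- Y | x \in Y)
  W * count (fun y => T y s1 %% W == T x s1 %% W) Y) _ _ _ (leqnn _)).
  by move=> s1; rewrite big_seq big_distrr.
by apply: mean_le_sum => x xY; apply: collisions_mean => //; apply: Yw.
Qed.

Lemma full_mean : mean_le (fun a : S2 * (S2 * S1) => \sum_(v <- iota 0 W)
   full w (seed_of w a.1 a.2.1 a.2.2 0) [seq y <- Y | T y a.1 %% W == v] *
   (Q + load a.1 v)) (72 * W).
Proof.
apply: (@mean_le_pair _ _ (fun (s1 : S2) (a : S2 * S1) => \sum_(v <- iota 0 W)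
   full w (seed_of w s1 a.1 a.2 0) [seq y <- Y | T y s1 %% W == v] *
   (Q + load s1 v)) (fun s1 => \sum_(v <- iota 0 W)
     (33 * ((Q < 32 * load s1 v) * load s1 v) + 6))).
  move=> s1; apply: mean_le_sum => v _.
  set Z := [seq y <- Y | _]; have sZ : size Z = load s1 v by rewrite size_filter.
  case: ltnP => h.
    apply: (@mean_le_trans _ _ (fun=> Q + load s1 v) (Q + load s1 v)).
    - by move=> a; case: full; rewrite ?mul1n ?mul0n.
    - by clear -h; lia.
    - exact: mean_le_const.
  apply: (@mean_le_trans _ _ (fun a : S2 * S1 =>
    2 * (w * full w (seed_of w s1 a.1 a.2 0) Z)) (2 * 3)).
  - move=> a; case: full; rewrite ?muln1 ?muln0 ?mul1n ?mul0n //.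
    by have := blocks_lt lw; clear -h; lia.
  - by rewrite muln0.
  apply: mean_leM; apply: full_light.
  - exact: filter_uniq.
  - by move=> x; rewrite mem_filter => /andP[_]; apply: Yw.
  - by rewrite sZ.
apply: (@mean_le_trans _ _ (fun s1 : S2 => 33 *
  \sum_(v <- iota 0 W) (Q < 32 * load s1 v) * load s1 v + 6 * W) (33 * (2 * W) + 6 * W)).
- move=> s1; rewrite big_split big_distrr big_const_seq count_predT size_iota.
  by rewrite iter_addn_0.
- by clear; lia.
apply: mean_leD; last exact: mean_le_const.
exact: mean_leM heavy_mean.
Qed.

End Buckets.

End Seed.


Section Expected.
Variables (w m : nat) (X : nat -> seq nat).
Hypothesis lw : large w.
Hypothesis m0 : 0 < m.
Hypothesis uX : forall i, i < m -> uniq (X i).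
Hypothesis Xw : forall i x, i < m -> x \in X i -> x < 2 ^ w.
Hypothesis Pw : forall i, i < m -> total_size w (set_size X i) <= 2 ^ w.
Variable b : nat.
Hypothesis bm : b < m.
Hypothesis b_min : forall i, i < m -> set_size X b <= set_size X i.

Local Notation n := (set_size X).
Local Notation W := (set_buckets w X).
Local Notation Q := (blocks w).
Local Notation S2 := 'I_(2 ^ (2 * w)).
Local Notation S1 := 'I_(2 ^ w).
Local Notation T := (toeplitz w w).
Local Notation bk rho := (set_bucket w rho X).
Local Notation seed := (seed_of w).
Local Notation passing rho := (fun x => all (fun i => passes w rho X b i x) (iota 0 m)).

Lemma bucket_late s1 s2 q s3 i u : bk (seed s1 s2 q s3) i u = bk (seed s1 s2 q 0) i u.
Proof. by []. Qed.

Lemma full_late s1 s2 q s3 Z : full w (seed s1 s2 q s3) Z = full w (seed s1 s2 q 0) Z.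
Proof. by []. Qed.

Lemma set_total_size i : i < m -> W i <= 2 ^ w /\ classes (n i) <= 2 ^ w.
Proof.
move=> im; have := Pw im; rewrite /total_size /heads_at /elements_at /header.
by rewrite -/(W i); clear; lia.
Qed.

Lemma set_size_W i : 64 * n i <= W i * Q.
Proof.
rewrite -ltnS; apply: leq_trans (leqnSn _).
by rewrite -ltn_divLR ?blocks_gt0 // pow2above_gt.
Qed.

Section Late.
Variables s1 s2 q : nat.
Local Notation r0 := (seed s1 s2 q 0).
Local Notation r3 := (seed s1 s2 q).

Lemma chain_mean i x : i < m -> x < 2 ^ w ->
  mean_le (fun s3 : S2 => chain w (r3 s3) X i x) 2.
Proof.
move=> im xw; have [_ Cw] := set_total_size im.
apply: (@mean_le_div _ (classes (n i))); first exact: pow2above_gt0.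
have h := @collisions_mean w (n i) (X i) x Cw xw (uX im) (fun y => @Xw i y im).
apply: mean_le_trans h.
- move=> s3; rewrite leq_mul2l; apply/orP; right; rewrite /chain.
  by under eq_count => y do rewrite !hash5_seed.
- by have := pow2above_gt (n i); rewrite /set_size -/(classes _); case: (x \in X i); lia.
Qed.

Definition verify_mean := 20 + 26 * m.
Definition slow_mean u := 4 + 30 * size (bk r0 b u).
Definition filter_mean i u := 10 + if huge w X b i then slow_mean u else
  \sum_(v <- iota 0 (W i) | v %% W b == u) (8 + full w r0 (bk r0 i v) * slow_mean u).
Definition bucket_mean u := 20 +
  if full w r0 (bk r0 b u) then size (bk r0 b u) * verify_mean else
  \sum_(i <- iota 0 m) (4 + filter_mean i u) +
  count (passing r0) (bk r0 b u) * verify_mean.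
Definition query_mean := 40 + 10 * m + \sum_(u <- iota 0 (W b)) (4 + bucket_mean u).

Lemma verify_cost_mean x : x < 2 ^ w ->
  mean_le (fun s3 : S2 => 8 + verify_cost w (r3 s3) m X x) verify_mean.
Proof.
move=> xw; have -> : verify_mean = 8 + (12 + \sum_(i <- iota 0 m | i \in iota 0 m) (16 + 5 * 2)).
  by rewrite -big_seq big_const_seq count_predT size_iota iter_addn_0 /verify_mean; clear; lia.
apply: mean_leD; first exact: mean_le_const.
apply: mean_leD; first exact: mean_le_const.
apply: (@mean_le_trans _ _ (fun s3 : S2 => \sum_(i <- iota 0 m | i \in iota 0 m)
  (16 + 5 * chain w (r3 s3) X i x)) _ _ _ (leqnn _)).
  by move=> s3; rewrite -big_seq.
apply: mean_le_sum => i; rewrite mem_iota => im.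
apply: mean_leD; first exact: mean_le_const.
by apply: mean_leM; apply: chain_mean.
Qed.

Lemma bucket_bound u x : x \in bk r0 b u -> x < 2 ^ w.
Proof. by rewrite mem_filter => /andP[_]; apply: Xw. Qed.

Lemma slow_cost_mean i u : i < m ->
  mean_le (fun s3 : S2 => slow_cost w (r3 s3) X b i u) (slow_mean u).
Proof.
move=> im; apply: mean_leD; first exact: mean_le_const.
have -> : 30 * size (bk r0 b u) = \sum_(x <- bk r0 b u | x \in bk r0 b u) (20 + 5 * 2).
  by rewrite -big_seq big_const_seq count_predT iter_addn_0.
apply: (@mean_le_trans _ _ (fun s3 : S2 => \sum_(x <- bk r0 b u | x \in bk r0 b u)
  (20 + 5 * chain w (r3 s3) X i x)) _ _ _ (leqnn _)).
  by move=> s3; rewrite -big_seq bucket_late.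
apply: mean_le_sum => x /bucket_bound xw.
apply: mean_leD; first exact: mean_le_const.
by apply: mean_leM; apply: chain_mean.
Qed.

Lemma filter_cost_mean i u : i < m ->
  mean_le (fun s3 : S2 => filter_cost w (r3 s3) X b i u) (filter_mean i u).
Proof.
move=> im; apply: mean_leD; first exact: mean_le_const.
case: (huge w X b i); first exact: slow_cost_mean.
apply: (@mean_le_trans _ _ (fun s3 : S2 => \sum_(v <- iota 0 (W i) | v %% W b == u)
  (8 + full w r0 (bk r0 i v) * slow_cost w (r3 s3) X b i u)) _ _ _ (leqnn _)).
  by move=> s3; under eq_bigr => v _ do rewrite full_late bucket_late.
apply: mean_le_sum => v _; apply: mean_leD; first exact: mean_le_const.
by apply: mean_leM; apply: slow_cost_mean.
Qed.

Lemma bucket_cost_mean u :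
  mean_le (fun s3 : S2 => bucket_cost w (r3 s3) m X b u) (bucket_mean u).
Proof.
apply: mean_leD; first exact: mean_le_const.
apply: (@mean_le_trans _ _ (fun s3 : S2 =>
  if full w r0 (bk r0 b u) then
    \sum_(x <- bk r0 b u | x \in bk r0 b u) (8 + verify_cost w (r3 s3) m X x)
  else \sum_(i <- iota 0 m | i \in iota 0 m) (4 + filter_cost w (r3 s3) X b i u) +
    \sum_(x <- bk r0 b u | (x \in bk r0 b u) && passing r0 x)
      (8 + verify_cost w (r3 s3) m X x)) _ _ _ (leqnn _)).
  move=> s3; rewrite full_late bucket_late -!big_seq -big_seq_cond.
  exact: leqnn.
case: (full w r0 (bk r0 b u)).
  have -> : size (bk r0 b u) * verify_mean =
      \sum_(x <- bk r0 b u | x \in bk r0 b u) verify_mean.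
    by rewrite -big_seq big_const_seq count_predT iter_addn_0 mulnC.
  by apply: mean_le_sum => x /bucket_bound; apply: verify_cost_mean.
apply: mean_leD.
  rewrite big_seq; apply: mean_le_sum => i; rewrite mem_iota => im.
  by apply: mean_leD; [apply: mean_le_const | apply: filter_cost_mean].
have -> : count (passing r0) (bk r0 b u) * verify_mean =
    \sum_(x <- bk r0 b u | (x \in bk r0 b u) && passing r0 x) verify_mean.
  by rewrite -big_seq_cond big_const_seq iter_addn_0 mulnC.
by apply: mean_le_sum => x /andP[/bucket_bound xw _]; apply: verify_cost_mean.
Qed.

Lemma query_cost_mean :
  mean_le (fun s3 : S2 => query_cost w (r3 s3) m X b) query_mean.
Proof.
apply: mean_leD; first exact: mean_le_const.
apply: mean_le_sum => u _; apply: mean_leD; first exact: mean_le_const.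
exact: bucket_cost_mean.
Qed.

End Late.

Lemma sum_load_set s1 s2 q i u :
  size (bk (seed s1 s2 q 0) i u) = load w ((64 * n i) %/ Q) (X i) s1 u.
Proof. by rewrite /set_bucket size_filter; apply: eq_count => y; rewrite hash0_seed. Qed.

Lemma sum_classes (f : nat -> nat) (F : nat -> nat -> nat) W0 (s : seq nat) :
  (forall v, f v < W0) ->
  \sum_(u <- iota 0 W0) \sum_(v <- s | f v == u) F v u = \sum_(v <- s) F v (f v).
Proof.
move=> fW; under eq_bigr do rewrite big_mkcond.
rewrite exchange_big; apply: eq_bigr => v _ /=.
rewrite -(sum_iota_delta (fun u => F v u) (fW v)); apply: eq_bigr => u _.
by case: eqP; rewrite ?mul1n ?mul0n.
Qed.

Lemma sum_periodic (g : nat -> nat) W0 K : 0 < W0 ->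
  \sum_(v <- iota 0 (W0 * K)) g (v %% W0) = K * \sum_(u <- iota 0 W0) g u.
Proof.
move=> W00; have iotaE k : iota 0 k = index_iota 0 k by rewrite /index_iota subn0.
rewrite !iotaE !big_mkord -(sum_pair_digits W0 K (fun v => g (v %% W0))).
rewrite -[K in RHS]card_ord -sum_nat_const; apply: eq_bigr => k _.
by apply: eq_bigr => a _; rewrite addnC mulnC modnMDl modn_small.
Qed.

Definition full_sum i (a : S2 * (S2 * S1)) := \sum_(v <- iota 0 (W i))
  full w (seed a.1 a.2.1 a.2.2 0) (bk (seed a.1 a.2.1 a.2.2 0) i v) *
  (Q + size (bk (seed a.1 a.2.1 a.2.2 0) i v)).

Definition heavy_sum (s1 : nat) := \sum_(u <- iota 0 (W b))
  (Q < 32 * load w ((64 * n b) %/ Q) (X b) s1 u) * load w ((64 * n b) %/ Q) (X b) s1 u.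

Lemma full_sum_mean i : i < m -> mean_le (full_sum i) (72 * W i).
Proof.
move=> im; have [Ww _] := set_total_size im.
apply: mean_le_trans (full_mean lw Ww (uX im) (fun y => @Xw i y im) (set_size_W i)) => //.
move=> a; apply: leq_sum => v _; rewrite sum_load_set.
rewrite leq_mul2r; apply/orP; right; rewrite /set_bucket /bucket.
by under eq_filter => y do rewrite hash0_seed.
Qed.

Lemma heavy_sum_mean : mean_le (fun s1 : S2 => heavy_sum s1) (2 * W b).
Proof.
have [Ww _] := set_total_size bm.
exact: (heavy_mean lw Ww (uX bm) (fun y => @Xw b y bm) (set_size_W b)).
Qed.

Definition filter_sum i (a : S2 * (S2 * S1)) :=
  if huge w X b i then 4 * W b + 30 * n b else
  8 * W i + (34 * full_sum i a + 30 * (W i %/ W b * heavy_sum a.1)).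

Lemma sum_bucket_size s1 s2 q : \sum_(u <- iota 0 (W b)) size (bk (seed s1 s2 q 0) b u) = n b.
Proof. by under eq_bigr do rewrite sum_load_set; rewrite sum_load. Qed.

Lemma sum_filter_mean i (a : S2 * (S2 * S1)) : i < m ->
  \sum_(u <- iota 0 (W b)) filter_mean a.1 a.2.1 a.2.2 i u <= 10 * W b + filter_sum i a.
Proof.
move=> im; rewrite /filter_mean /filter_sum big_split.
rewrite big_const_seq count_predT size_iota iter_addn_0 leq_add2l.
have Wb0 : 0 < W b := pow2above_gt0 _.
case: (huge w X b i).
  rewrite /slow_mean big_split big_const_seq count_predT size_iota iter_addn_0.
  by rewrite -big_distrr /= sum_bucket_size.
rewrite (@sum_classes (fun v => v %% W b) (fun v u => 8 + full w (seed a.1 a.2.1 a.2.2 0)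
   (bk (seed a.1 a.2.1 a.2.2 0) i v) * slow_mean a.1 a.2.1 a.2.2 u)); last by move=> v; rewrite ltn_mod.
set g := fun u => (Q < 32 * load w ((64 * n b) %/ Q) (X b) a.1 u) * load w ((64 * n b) %/ Q) (X b) a.1 u.
apply: (@leq_trans (\sum_(v <- iota 0 (W i)) (8 + (34 * (
  full w (seed a.1 a.2.1 a.2.2 0) (bk (seed a.1 a.2.1 a.2.2 0) i v) *
  (Q + size (bk (seed a.1 a.2.1 a.2.2 0) i v))) + 30 * g (v %% W b))))).
  apply: leq_sum => v _; rewrite leq_add2l.
  rewrite /slow_mean sum_load_set /g; set l := load _ _ _ _ _.
  have Q0 := blocks_gt0 lw; case: full; rewrite ?mul1n ?mul0n //.
  by case: ltnP => h; clear -h Q0; lia.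
rewrite big_split big_const_seq count_predT size_iota iter_addn_0 leq_add2l.
rewrite big_split -!big_distrr /= leq_add2l leq_mul2l -/(heavy_sum a.1) /=.
rewrite -{1}(divnK (W_dvd w b_min im)) mulnC sum_periodic //.
Qed.

Lemma set_buckets_gt0 i : 0 < W i. Proof. exact: pow2above_gt0. Qed.

Lemma filter_sum_mean i : i < m -> mean_le (filter_sum i) (2600 * W i).
Proof.
move=> im; rewrite /filter_sum; case h : (huge w X b i).
  apply: (@mean_le_trans _ _ (fun=> 4 * W b + 30 * n b) (4 * W b + 30 * n b)) => //.
    have := W_le_min w b_min im; move: h; rewrite /huge leq_divRL ?set_buckets_gt0 // => h.
    have : 64 * n b <= w * W b.
      apply: leq_trans (set_size_W b) _; rewrite mulnC leq_mul2r.
      by rewrite (ltnW (blocks_lt lw)) orbT.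
    by clear -h; lia.
  exact: mean_le_const.
apply: (@mean_le_trans _ _ (fun a => 8 * W i + (34 * full_sum i a + 30 * (W i %/ W b * heavy_sum a.1)))
  (8 * W i + (34 * (72 * W i) + 30 * (W i %/ W b * (2 * W b))))) => //.
  have -> : W i %/ W b * (2 * W b) = 2 * (W i %/ W b * W b) by clear; lia.
  by rewrite divnK ?(W_dvd w b_min) //; clear; lia.
apply: mean_leD; first exact: mean_le_const.
apply: mean_leD; first by apply: mean_leM; apply: full_sum_mean.
apply: mean_leM; apply: mean_leM.
by apply: (@mean_le_fst _ _ (fun s1 : S2 => heavy_sum s1)); apply: heavy_sum_mean.
Qed.

Lemma passing_mean x : x \in X b -> ~~ inter m X x ->
  mean_le (fun a : S2 * (S2 * S1) => w * passing (seed a.1 a.2.1 a.2.2 0) x) 1.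
Proof.
move=> xX /allPn[i]; rewrite mem_iota add0n => /andP[_ im] nx.
case h : (huge w X b i).
  apply: (@mean_le_trans _ _ (fun=> 0) 0) => //; last exact: mean_le_const.
  move=> a; rewrite -[_ <= 0]/(_) leqn0 muln_eq0 eqb0; apply/orP; right.
  by apply/allPn; exists i; rewrite ?mem_iota // /passes (negbTE nx) h.
set R := 2 ^ sig_bits w; have [Wbw _] := set_total_size bm.
have Wb0 := set_buckets_gt0 b.
have rw : sig_bits w <= w.
  by rewrite /sig_bits; have := ell_cube lw; have := ell_ge16 lw; nia.
have xw := Xw bm xX.
apply: (@mean_le_div _ (W b * R)); first by rewrite muln_gt0 Wb0 expn_gt0.
apply: (@mean_le_trans _ _ (fun a : S2 * (S2 * S1) => w *
  \sum_(y <- X i | (y \in X i) && (y != x)) (W b * (T y a.1 %% W b == T x a.1 %% W b) *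
    (R * (T y a.2.1 == T x a.2.1 %[mod R]))))
  (w * \sum_(y <- X i | (y \in X i) && (y != x)) 1)).
- move=> a; rewrite mulnCA leq_mul2l; apply/orP; right.
  case: (boolP (passing _ x)) => [/allP/(_ i) | _]; last by rewrite muln0.
  rewrite mem_iota add0n im => /(_ isT); rewrite /passes (negbTE nx) h /=.
  case/hasP => y yX /and3P[yx]; rewrite !hash0_seed !sig_seed => e1 e2.
  rewrite (big_rem _ yX) /= yX yx e1 -/R in e2 *; rewrite e2 !muln1.
  exact: leq_addr.
- rewrite sum1_count muln1; apply: leq_trans (leq_mul (leqnn w) (count_size _ _)) _.
  have := set_size_W i; rewrite -/(n i) => hn.
  have : W i < w * W b by rewrite -ltn_divLR // ltnNge -/(huge w X b i) h.
  have Qw := blocks_lt lw.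
  have wR : w * (w * w) <= R.
    have lt := ltnW (lt_w_ell w); apply: (@leq_trans (2 ^ ell w * (2 ^ ell w * 2 ^ ell w))).
      by rewrite !leq_mul.
    by rewrite -!expnD leq_exp2l // /sig_bits; clear; lia.
  move=> hW; rewrite mulnC; apply: (@leq_trans (W b * (w * (w * w)))).
    have : n i <= W b * w * w.
      apply: (@leq_trans (W i * Q)); first by apply: leq_trans hn; rewrite leq_pmull.
      by rewrite [W b * w]mulnC leq_mul // ltnW.
    by clear; nia.
  by rewrite leq_mul2l wR orbT.
apply: mean_leM; apply: mean_le_sum => y /andP[yX yx]; have yw := Xw im yX.
apply: (@mean_le_pair _ _ (fun (s1 : S2) (a : S2 * S1) =>
   W b * (T y s1 %% W b == T x s1 %% W b) * (R * (T y a.1 == T x a.1 %[mod R])))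
  (fun s1 => W b * (T y s1 %% W b == T x s1 %% W b) * 1)).
  move=> s1; apply: mean_leM.
  apply: (@mean_le_fst _ _ (fun s2 : S2 => R * (T y s2 == T x s2 %[mod R]))).
  exact: toeplitz_universal.
apply: mean_le_trans (pow2above_universal Wbw yw xw yx) => // s1.
by rewrite muln1.
Qed.

Lemma count_passing_mean : mean_le (fun a : S2 * (S2 * S1) =>
    count (passing (seed a.1 a.2.1 a.2.2 0)) (X b))
  (count (inter m X) (X b) + W b).
Proof.
apply: (@mean_le_div _ w); first exact: w_gt0.
apply: (@mean_le_trans _ _ (fun a : S2 * (S2 * S1) => w * count (inter m X) (X b) +
  \sum_(x <- X b | (x \in X b) && ~~ inter m X x) w * passing (seed a.1 a.2.1 a.2.2 0) x)
  (w * count (inter m X) (X b) + \sum_(x <- X b | (x \in X b) && ~~ inter m X x) 1)).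
- move=> a; rewrite -big_distrr -mulnDr leq_mul2l; apply/orP; right.
  rewrite !size_count_mem (bigID (inter m X)) /= -big_seq_cond; apply: leq_add => //.
  rewrite big_mkcond; apply: leq_sum => x _.
  by case: (inter m X x) => //; case: all.
- rewrite mulnDr leq_add2l sum1_count; apply: leq_trans (count_size _ _) _.
  have := set_size_W b; rewrite -/(n b); have := blocks_lt lw; clear; nia.
apply: mean_leD; first exact: mean_le_const.
by apply: mean_le_sum => x /andP[xX ix]; apply: passing_mean.
Qed.

Definition total_buckets := \sum_(i <- iota 0 m) W i.

Lemma query_mean_mean : mean_le (fun a : S2 * (S2 * S1) => query_mean a.1 a.2.1 a.2.2)
  (50 * m + 2 * 3000 * total_buckets + 46 * (m * count (inter m X) (X b))).
Proof.
set k := count (inter m X) (X b).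
apply: (@mean_le_trans _ _ (fun a : S2 * (S2 * S1) => 40 + 10 * m + 24 * W b +
   (verify_mean * full_sum b a + (\sum_(i <- iota 0 m | i \in iota 0 m) (14 * W b + filter_sum i a) +
    verify_mean * count (passing (seed a.1 a.2.1 a.2.2 0)) (X b))))
  (40 + 10 * m + 24 * W b + (verify_mean * (72 * W b) +
   (\sum_(i <- iota 0 m | i \in iota 0 m) (14 * W b + 2600 * W i) + verify_mean * (k + W b))))).
- move=> [s1 [s2 q]] /=; rewrite /query_mean -[X in _ <= X]addnA leq_add2l.
  set a := (s1, (s2, q)).
  rewrite /bucket_mean; set r := seed s1 s2 q 0.
  apply: (@leq_trans (\sum_(u <- iota 0 (W b)) (24 +
    (verify_mean * (full w r (bk r b u) * (Q + size (bk r b u))) +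
     (\sum_(i <- iota 0 m) (4 + filter_mean s1 s2 q i u) +
      verify_mean * count (passing r) (bk r b u)))))).
    apply: leq_sum => u _; rewrite addnA leq_add2l.
    case: full; rewrite ?mul1n ?mul0n ?muln0 ?add0n.
      apply: leq_trans (leq_addr _ _); rewrite mulnC leq_mul2l leq_addl; exact: orbT.
    by rewrite [count _ _ * _]mulnC.
  rewrite big_split big_const_seq count_predT size_iota iter_addn_0 leq_add2l.
  rewrite big_split -big_distrr /= leq_add2l big_split -big_distrr /=.
  apply: leq_add.
    rewrite exchange_big [X in X <= _]big_seq; apply: leq_sum => i.
    rewrite mem_iota => im; rewrite big_split big_const_seq count_predT size_iota iter_addn_0.
    by have := @sum_filter_mean i a im; rewrite /=; clear; lia.
  rewrite leq_mul2l; apply/orP; right.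
  under eq_bigr => u _ do rewrite size_count_mem /set_bucket /bucket big_filter.
  rewrite (@sum_classes (fun x => hash w r 0 x %% W b) (fun x u => passing r x : nat)).
    by rewrite size_count_mem.
  by move=> x; rewrite ltn_mod set_buckets_gt0.
- rewrite -big_seq big_split big_const_seq count_predT size_iota iter_addn_0.
  rewrite -big_distrr /= -/total_buckets.
  have le : m * W b <= total_buckets.
    rewrite -[m](size_iota 0) -[size _]count_predT mulnC -iter_addn_0 -big_const_seq.
    rewrite /total_buckets big_seq [X in _ <= X]big_seq; apply: leq_sum => i.
    by rewrite mem_iota => im; exact: (W_le_min w b_min im).
  have v46 : verify_mean <= 46 * m by rewrite /verify_mean; clear -m0; lia.
  have h1 := leq_mul v46 (leqnn (W b)); have h2 := leq_mul v46 (leqnn k).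
  have h3 : W b <= m * W b by rewrite leq_pmull.
  by clear -h1 h2 h3 le m0; lia.
apply: mean_leD; first exact: mean_le_const.
apply: mean_leD; first by apply: mean_leM; apply: full_sum_mean.
apply: mean_leD; last by apply: mean_leM; apply: count_passing_mean.
apply: mean_le_sum => i; rewrite mem_iota => im.
by apply: mean_leD; [apply: mean_le_const | apply: filter_sum_mean].
Qed.

End Expected.


(** * Putting the two programs on the machine *)

Definition vals w (D : seq (word w)) : seq nat := map val D.

Lemma nth_vals w (D : seq (word w)) k : nth 0 (vals D) k = nth (trunc w 0) D k.
Proof.
case: (ltnP k (size D)) => h; first by rewrite (nth_map (trunc w 0)).
by rewrite !nth_default ?size_map //= mod0n.
Qed.

Lemma val_trunc w x : x < 2 ^ w -> trunc w x = x :> nat.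
Proof. exact: modn_small. Qed.

Definition pre_program : program := comp 0 pre_cmd.
Definition query_program : program := comp 0 query_cmd.

Lemma halts_in_unique w P (st : state w) t t' s s' :
  halts_in P st t s -> halts_in P st t' s' -> s = s'.
Proof.
move=> [<- h1 m1] [<- h2 m2]; case: (ltngtP t t') => [lt | lt | -> //].
  by move: (m2 _ lt); rewrite h1.
by move: (m1 _ lt); rewrite h2.
Qed.

Lemma total_size_le w n : large w -> n + 7 + total_size w n <= 2000 * n.+1.
Proof.
move=> lw; have := buckets_le lw n; have := pow2above_le n.
rewrite /total_size /heads_at /elements_at /header /classes; clear; lia.
Qed.

Lemma pre_program_correct w (rho : seed w 7) (X : seq (word w)) :
  large w -> 2000 * (size X).+1 <= 2 ^ w -> uniq X ->
  let st := pre_start rho X in let n := size X in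
  exists t st', [/\ halts_in pre_program st t st',
    confined pre_program st (n + 7) (total_size w n),
    reg st' 0 = total_size w n :> nat, reg st' 1 = n + 7 :> nat &
    represents w (nth 0 (vals rho)) (vals X)
      (fun k => Defs.mem st' (trunc w (n + 7 + k)))].
Proof.
move=> lw nw uX st n.
have l99 := large_99 lw.
have tot : n + 7 + total_size w n <= 2 ^ w by apply: leq_trans (total_size_le n lw) nw.
have n7 : n + 7 < 2 ^ w.
  by apply: leq_trans tot; rewrite -ltn_subLR ?leq_addr // subnn.
pose M0 := nth 0 (vals (rho ++ X)).
pose r0 := fun k => nat_of_ord (reg st k).
have szr : size (vals rho) = 7 by rewrite size_map size_tuple.
have szX : size (vals X) = n by rewrite size_map.
have catE : vals (rho ++ X) = vals rho ++ vals X by rewrite /vals map_cat.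
have ag : agree st r0 M0.
  by split=> // a; rewrite /M0 nth_vals.
have nw' : 2000 * (size (vals X)).+1 <= 2 ^ w by rewrite szX.
have uX' : uniq (vals X) by rewrite map_inj_uniq //; apply: val_inj.
have Xw x : x \in vals X -> x < 2 ^ w by move=> /mapP[y _ ->]; apply: ltn_ord.
have rw k : k < 7 -> nth 0 (vals rho) k < 2 ^ w by move=> _; rewrite nth_vals; apply: ltn_ord.
have M0r k : k < 7 -> M0 k = nth 0 (vals rho) k.
  by move=> k7; rewrite /M0 catE nth_cat szr k7.
have M0X j : j < size (vals X) -> M0 (7 + j) = nth 0 (vals X) j.
  by move=> _; rewrite /M0 catE nth_cat szr ltnNge leq_addr addKn.
have M0z a : size (vals X) + 7 <= a -> M0 a = 0.
  by move=> na; rewrite /M0 nth_default // size_map size_cat size_tuple addnC -(size_map val).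
have r00 : r0 0 = size (vals X).
  by rewrite szX /r0 /st /pre_start /= modn_small // (leq_ltn_trans _ n7) // leq_addr.
have [t [r' [M' [h]]]] := wp_pre lw nw' uX' Xw rw M0r M0X M0z r00.
rewrite szX in h * => -[e0 e1 rep].
have [T [st' [ha _ [ar am] co]]] := compile_correct (isT : wf pre_cmd) h (erefl : pc st = 0) ag.
exists T, st'; split=> //.
- by rewrite ar.
- by rewrite ar.
- apply: represents_ext rep => k; rewrite szX => kt.
  by rewrite am val_trunc // (leq_trans _ tot) // ltn_add2l.
Qed.

Lemma pre_program_linear c : 2000 <= c -> (forall w, c <= 2 ^ w -> large w) ->
  linear_space_preprocessing 7 c pre_program.
Proof.
move=> c2 cl w rho S X w0 cw pX.
have szX : size X = #|S| by rewrite (perm_size pX) cardE.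
have lw : large w by apply: cl; apply: leq_trans cw; rewrite leq_pmulr // addn1.
have nw : 2000 * (size X).+1 <= 2 ^ w.
  by apply: leq_trans cw; rewrite szX addn1 leq_mul2r c2 orbT.
have uX : uniq X by rewrite (perm_uniq pX) enum_uniq.
have [t [st' [h co e0 e1 _]]] := pre_program_correct rho lw nw uX.
have tc : size X + 7 + total_size w (size X) <= c * (#|S| + 1).
  apply: leq_trans (total_size_le _ lw) _.
  by rewrite szX addn1 leq_mul2r c2 orbT.
split.
  move=> t' a na; apply: co; apply: contra na => /andP[_ lt].
  by rewrite add0n; apply: leq_trans lt tc.
exists t, st', [seq Defs.mem st' (trunc w (size X + 7 + k)) | k <- iota 0 (total_size w (size X))].
split=> //.
  split; first by rewrite e0 size_map size_iota.
  split; rewrite e1 size_map size_iota; first exact: leq_trans tc cw.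
  move=> i hi; rewrite (nth_map 0) ?size_iota // nth_iota //.
by rewrite e1 size_map size_iota.
Qed.

Lemma preprocessed_represents w (rho : seed w 7) (S : {set word w}) D : large w ->
  2000 * #|S|.+1 <= 2 ^ w -> preprocessed pre_program rho S D ->
  exists X, [/\ perm_eq X (enum S), size D = total_size w (size X) &
    represents w (nth 0 (vals rho)) (vals X) (nth 0 (vals D))].
Proof.
move=> lw nw [X [t [st [pX h [o0 [o1 o2]]]]]].
have szX : size X = #|S| by rewrite (perm_size pX) cardE.
have uX : uniq X by rewrite (perm_uniq pX) enum_uniq.
rewrite -szX in nw.
have [t' [st' [h' _ e0 e1 rep]]] := pre_program_correct rho lw nw uX.
have stE := halts_in_unique h h'; rewrite -stE in e0 e1 rep.
have sD : size D = total_size w (size X) by rewrite -o0 e0.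
exists X; split=> //.
apply: represents_ext rep => k; rewrite size_map -sD => kD.
by rewrite nth_vals -o2 // e1.
Qed.

Lemma perm_query_cost w rho m X X' b : b < m ->
  (forall i, i < m -> perm_eq (X i) (X' i)) ->
  query_cost w rho m X b = query_cost w rho m X' b.
Proof.
move=> bm pX.
have nE i : i < m -> set_size X i = set_size X' i by move=> /pX/perm_size.
have WE i : i < m -> set_buckets w X i = set_buckets w X' i.
  by move=> im; rewrite /set_buckets nE.
have bE i u : i < m -> perm_eq (set_bucket w rho X i u) (set_bucket w rho X' i u).
  by move=> im; rewrite /set_bucket WE // perm_filter // pX.
have fE Z Z' : perm_eq Z Z' -> full w rho Z = full w rho Z'.
  move=> pZ; apply: eq_has => s; congr (_ < _).
  by apply: perm_size; apply: perm_filter.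
have cE i x : i < m -> chain w rho X i x = chain w rho X' i x.
  by move=> im; rewrite /chain /set_classes nE //; apply/permP/pX.
have hE i : i < m -> huge w X b i = huge w X' b i.
  by move=> im; rewrite /huge !WE.
have pE i x : i < m -> passes w rho X b i x = passes w rho X' b i x.
  move=> im; rewrite /passes (perm_mem (pX _ im)) hE // WE //.
  by congr (_ || _ && _); apply: perm_has; apply: pX.
have vE x : verify_cost w rho m X x = verify_cost w rho m X' x.
  congr (_ + _); rewrite big_seq [RHS]big_seq; apply: eq_bigr => i.
  by rewrite mem_iota => im; rewrite cE.
have sE i u : i < m -> slow_cost w rho X b i u = slow_cost w rho X' b i u.
  move=> im; congr (_ + _); rewrite (perm_big _ (bE _ _ bm)) /=.
  by apply: eq_bigr => x _; rewrite cE.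
rewrite /query_cost WE //; congr (_ + _); apply: eq_bigr => u _; congr (_ + (_ + _)).
rewrite (fE _ _ (bE _ u bm)); case: full.
  by rewrite (perm_big _ (bE _ _ bm)) /=; apply: eq_bigr => x _; rewrite vE.
congr (_ + _).
  rewrite big_seq [RHS]big_seq; apply: eq_bigr => i; rewrite mem_iota => im.
  rewrite /filter_cost hE // sE // WE // (WE b) //; congr (_ + (_ + _)); case: ifP => // _.
  by apply: eq_bigr => v _; rewrite (fE _ _ (bE i v im)).
rewrite (perm_big _ (bE _ _ bm)) /=; apply: eq_big => [x | x _]; last by rewrite vE.
by apply: eq_in_all => i; rewrite mem_iota => im; rewrite pE.
Qed.

Section Run.
Variables (w m : nat) (S : 'I_m -> {set word w}) (rho : seed w 7) (len : nat) (q : query w).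
Hypothesis lw : large w.
Hypothesis m0 : 0 < m.
Hypothesis Sw : forall i, 2000 * #|S i|.+1 <= 2 ^ w.
Hypothesis mlen : m < len.
Hypothesis Slen : forall i, #|S i| <= len.
Hypothesis hq : query_for pre_program rho len S q.

Definition listed (X : 'I_m -> seq (word w)) (i : nat) : seq nat :=
  if insub i is Some j then vals (X j) else [::].

Lemma listedE X (i : 'I_m) : listed X i = vals (X i).
Proof. by rewrite /listed valK. Qed.

Lemma query_run b : (b < m)%N ->
  (forall i, i < m -> set_size (listed (fun i => enum (S i))) b <=
     set_size (listed (fun i => enum (S i))) i) ->
  (forall i, i < b -> set_size (listed (fun i => enum (S i))) b <
     set_size (listed (fun i => enum (S i))) i) ->
  exists t st' L, [/\ halts_in query_program (query_start m q) t st',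
    t <= (size query_program).+1 *
      query_cost w (nth 0 (vals rho)) m (listed (fun i => enum (S i))) b,
    confined query_program (query_start m q) (work_at q) len,
    output st' L & perm_eq L (enum (\bigcap_(i < m) S i))].
Proof.
move=> bm bmin bfirst.
have [p [D [hD [[hs1 hs2] ha] [[hr1 hr2] _] wl]]] := hq.
have ex i : exists X, [/\ perm_eq X (enum (S i)), size (D i) = total_size w (size X) &
    represents w (nth 0 (vals rho)) (vals X) (nth 0 (vals (D i)))].
  by have [pr _ _] := hD i; apply: preprocessed_represents (Sw i) pr.
have [X hX] := fin_all_exists ex.
pose Xn := listed X; pose P i := if insub i is Some j then nat_of_ord (p j) else 0.
have PE (i : 'I_m) : P i = p i by rewrite /P valK.
have XE (i : 'I_m) : Xn i = vals (X i) by apply: listedE.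
have nE (i : 'I_m) : set_size Xn i = #|S i|.
  by rewrite /set_size XE size_map; have [pX _ _] := hX i; rewrite (perm_size pX) cardE.
have lift (T : nat -> Prop) : (forall i : 'I_m, T i) -> forall i, i < m -> T i.
  by move=> h i im; apply: (h (Ordinal im)).
have nE' : forall i, i < m -> set_size (listed (fun i => enum (S i))) i = set_size Xn i.
  by apply: lift => i; rewrite nE /set_size listedE size_map cardE.
have tE (i : 'I_m) : size (D i) = total_size w (set_size Xn i).
  by have [_ -> _] := hX i; rewrite /set_size XE size_map.
have szH : size [seq p i | i <- enum 'I_m] = m by rewrite size_map size_enum_ord.
rewrite szH in hs1 hs2.
have uX : forall i, i < m -> uniq (Xn i).
  apply: lift => i; rewrite XE map_inj_uniq; last exact: val_inj.
  by have [pX _ _] := hX i; rewrite (perm_uniq pX) enum_uniq.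
have Hw : forall i, i < m -> handles_at q + i < 2 ^ w.
  by move=> i im; apply: leq_trans hs1; rewrite ltn_add2l.
have Hout : forall i, i < m -> ~~ (work_at q <= handles_at q + i < work_at q + len).
  by move=> i im; case/orP: ha => h; apply/negP => /andP[h1 h2]; clear -h h1 h2 im; lia.
have Pw : forall i, i < m -> P i + total_size w (set_size Xn i) <= 2 ^ w.
  by apply: lift => i; rewrite PE -tE; have [_ [h _] _] := hD i.
have Pout : forall i k, i < m -> k < total_size w (set_size Xn i) ->
    ~~ (work_at q <= P i + k < work_at q + len).
  move=> i k im; move: i im k; apply: lift => i k; rewrite PE -tE => hk.
  have [_ _ h] := hD i.
  by case/orP: h => h; apply/negP => /andP[h1 h2]; clear -h h1 h2 hk; lia.
have bfit : set_size Xn b <= len.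
  by have := nE (Ordinal bm); rewrite /= => ->; apply: Slen.
have mw : m < 2 ^ w.
  by apply: leq_trans mlen _; apply: leq_trans wl; apply: leq_addl.
pose st := query_start m q.
pose M0 a := nat_of_ord (qmem q (trunc w a)).
pose r0 k := nat_of_ord (reg st k).
have ag : agree st r0 M0.
  by split=> // a; rewrite /M0; congr (nat_of_ord (qmem q _)); apply: val_inj; rewrite /= modn_small.
have okM : mem_ok w (nth 0 (vals rho)) m Xn P (handles_at q) M0.
  split.
    apply: lift => i; rewrite /M0 hs2 //.
    by rewrite PE (nth_map i) ?size_enum_ord // nth_ord_enum.
  apply: lift => i; have [_ _ rep] := hX i; rewrite -XE in rep.
  apply: represents_ext rep => k; rewrite -/(set_size Xn i) -tE => hk.
  have [_ [_ hst] _] := hD i.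
  by rewrite /M0 PE hst // nth_vals.
have bmin' : forall i, i < m -> set_size Xn b <= set_size Xn i.
  by move=> i im; rewrite -!nE' //; apply: bmin.
have bfirst' : forall i, i < b -> set_size Xn b < set_size Xn i.
  by move=> i ib; rewrite -!nE' ?(ltn_trans ib bm) //; apply: bfirst.
have e0 : r0 0 = m by rewrite /r0 /= modn_small.
have [t [r' [M' [h [tle [e1 [O [o0 o1 o2 o3]]]]]]]] := wp_query lw m0 mw uX Hw Hout Pw Pout wl bm bfit
  bmin' bfirst' okM e0 erefl erefl.
have [T [st' [hh Tle [ar am] co]]] := compile_correct (isT : wf query_cmd) h (erefl : pc st = 0) ag.
have Osub x : x \in O -> x \in Xn b by rewrite o3 => /andP[].
have Ow x : x \in O -> x < 2 ^ w.
  move/Osub; have := XE (Ordinal bm); rewrite /= => ->.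
  by case/mapP => y _ ->; apply: ltn_ord.
have szO : size O <= len.
  by apply: leq_trans bfit; apply: uniq_leq_size.
have qE : query_cost w (nth 0 (vals rho)) m (listed (fun i => enum (S i))) b =
    query_cost w (nth 0 (vals rho)) m Xn b.
  apply: perm_query_cost => //; apply: lift => i.
  rewrite XE listedE perm_sym; apply: perm_map; by have [] := hX i.
exists T, st', [seq trunc w x | x <- O]; split=> //.
- by rewrite qE; apply: leq_trans Tle _; rewrite leq_mul2l tle orbT.
- split; first by rewrite ar // o0 size_map.
  split; rewrite ar // e1 size_map; first by apply: leq_trans wl; rewrite leq_add2l.
  move=> i hi; apply: val_inj; rewrite (nth_map 0) //= am val_trunc.
    by rewrite o1 // modn_small // Ow // mem_nth.
  by apply: leq_trans wl; rewrite ltn_add2l; apply: leq_trans hi szO.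
- apply: uniq_perm; rewrite ?enum_uniq //.
    rewrite map_inj_in_uniq // => x y /Ow xw /Ow yw /(congr1 val) /=.
    by rewrite !modn_small.
  move=> x; rewrite mem_enum.
  have -> : (x \in [seq trunc w y | y <- O]) = (val x \in O).
    apply/mapP/idP => [[y yO ->] | xO]; first by rewrite /= modn_small ?Ow.
    by exists (val x) => //; apply: val_inj; rewrite /= modn_small.
  have memX (i : 'I_m) : (val x \in Xn i) = (x \in S i).
    rewrite XE mem_map; last exact: val_inj.
    by have [pX _ _] := hX i; rewrite (perm_mem pX) mem_enum.
  rewrite o3; apply/andP/bigcapP => [[_ /allP al] i _ | al].
    by rewrite -memX; apply: al; rewrite mem_iota /=.
  have all_i : forall i, i < m -> val x \in Xn i by apply: lift => i; rewrite memX al.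
  split; first exact: all_i.
  by apply/allP => i; rewrite mem_iota => im; apply: all_i.
Qed.

End Run.


(** * Expectation over the seed *)

Section Tuple.
Variable w : nat.
Local Notation S2 := 'I_(2 ^ (2 * w)).
Local Notation S1 := 'I_(2 ^ w).

Definition seed_tuple (a : S2 * (S2 * S1) * S2) : seed w 7 :=
  [tuple trunc w a.1.1; trunc w (a.1.1 %/ 2 ^ w);
         trunc w a.1.2.1; trunc w (a.1.2.1 %/ 2 ^ w); a.1.2.2;
         trunc w a.2; trunc w (a.2 %/ 2 ^ w)].

Lemma high_word (s : S2) : trunc w (s %/ 2 ^ w) = s %/ 2 ^ w :> nat.
Proof.
rewrite val_trunc // ltn_divLR ?expn_gt0 // -expnD addnn -mul2n.
exact: ltn_ord.
Qed.

Lemma seed_tupleE a :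
  nth 0 (vals (seed_tuple a)) = seed_of w a.1.1 a.1.2.1 a.1.2.2 a.2.
Proof. by rewrite /seed_of -(high_word a.1.1) -(high_word a.1.2.1) -(high_word a.2). Qed.

Lemma seed_tuple_bij : bijective seed_tuple.
Proof.
apply: inj_card_bij.
  have inj2 (s s' : S2) : s %% 2 ^ w = s' %% 2 ^ w -> s %/ 2 ^ w = s' %/ 2 ^ w -> s = s'.
    by move=> e1 e2; apply: val_inj; rewrite /= (divn_eq s (2 ^ w)) (divn_eq s' (2 ^ w)) e1 e2.
  move=> a a' /(congr1 (fun t : seed w 7 => nth 0 (vals t))); rewrite !seed_tupleE.
  case: a a' => [[s1 [s2 q]] s3] [[s1' [s2' q']] s3'] e.
  have {}e k := congr1 (fun f => f k) e.
  rewrite (inj2 s1 s1' (e 0) (e 1)) (inj2 s2 s2' (e 2) (e 3)) (inj2 s3 s3' (e 5) (e 6)).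
  by rewrite (val_inj (e 4 : val q = val q')).
rewrite card_tuple !card_prod !card_ord -!expnM -!expnD leq_exp2l //; lia.
Qed.

Lemma mean_seed (f : (nat -> nat) -> nat) c :
  mean_le (fun a : S2 * (S2 * S1) * S2 => f (seed_of w a.1.1 a.1.2.1 a.1.2.2 a.2)) c ->
  mean_le (fun rho : seed w 7 => f (nth 0 (vals rho))) c.
Proof.
rewrite /mean_le (bij_eq_card seed_tuple_bij) => h.
rewrite (reindex seed_tuple) /=; last exact: onW_bij seed_tuple_bij.
by under eq_bigr => a _ do rewrite seed_tupleE.
Qed.

End Tuple.

Section Bound.
Variables (w m : nat) (X : nat -> seq nat).
Hypothesis lw : large w.

Lemma buckets_mul k : w * buckets w k <= w + 1280 * (ell w * ell w) * k.
Proof.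
have := pow2above_le ((64 * k) %/ blocks w); rewrite -/(buckets w k) => h.
have h2 : w * ((64 * k) %/ blocks w) <= 640 * (ell w * ell w) * k.
  apply: leq_trans (leq_mul (blocks_ge lw) (leqnn _)) _.
  have := leq_divM (64 * k) (blocks w); set q := _ %/ _; set L := ell w * ell w.
  by clear; nia.
have := leq_mul (leqnn w) h; rewrite -muln2; set q := _ %/ _ in h2 *.
by clear -h2; lia.
Qed.

Lemma total_buckets_mul :
  w * total_buckets w m X <= w * m + 1280 * (ell w * ell w) * \sum_(i <- iota 0 m) size (X i).
Proof.
rewrite /total_buckets !big_distrr /=.
apply: leq_trans (_ : \sum_(i <- iota 0 m) (w + 1280 * (ell w * ell w) * size (X i)) <= _).
  by apply: leq_sum => i _; apply: buckets_mul.
by rewrite big_split big_const_seq count_predT size_iota iter_addn_0.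
Qed.

End Bound.

Section Log.
Variable R : realType.
Import Order.TTheory GRing.Theory Num.Theory.
Local Open Scope ring_scope.

Lemma ln2_ge : 1 / 2 <= ln 2 :> R.
Proof.
have h : ln (1 + (- (1 / 2))) <= - (1 / 2) :> R by apply: le_ln1Dx; lra.
have e : 1 + (- (1 / 2)) = 2^-1 :> R by lra.
by rewrite e lnV ?posrE // in h; lra.
Qed.

Lemma ell_ln w : large w -> (ell w)%:R <= 4 * ln w%:R :> R.
Proof.
move=> lw; have h := ell_log lw; have l16 := ell_ge16 lw; have w0 := w_gt0 lw.
have h1 : ln ((2 ^ (ell w).-1)%N%:R) <= ln w%:R :> R.
  by rewrite ler_ln ?posrE ?ltr0n ?expn_gt0 // ler_nat.
rewrite natrX lnXn // in h1.
have h2 := ln2_ge; have h3 : (ell w)%:R <= 2 * ((ell w).-1)%:R :> R.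
  by rewrite -natrM ler_nat; lia.
have h4 : ((ell w).-1)%:R * (1 / 2) <= (ell w).-1%:R * ln 2 :> R by apply: ler_wpM2l.
rewrite -[ln _ *+ _]mulr_natl in h1; lra.
Qed.

Lemma cost_bound (m TB k n w L : nat) (l : R) : (0 < w)%N -> L%:R <= 4 * l ->
  (w * TB <= w * m + 1280 * (L * L) * n)%N ->
  (50 * m + 2 * 3000 * TB + 46 * (m * k))%N%:R <=
    (2 * 3000 * (5 * 4096))%N%:R * (n%:R * l ^+ 2 / w%:R + (k * m)%N%:R + m%:R).
Proof.
move=> w0 Ll h.
have w0' : 0 < w%:R :> R by rewrite ltr0n.
have n0 : 0 <= n%:R :> R by [].
have L2 : L%:R * L%:R <= 16 * l ^+ 2 :> R.
  have := ler_pM (ler0n R L) (ler0n R L) Ll Ll; rewrite expr2; lra.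
set a := n%:R * l ^+ 2 / w%:R.
have a0 : 0 <= a by rewrite divr_ge0 // mulr_ge0 // sqr_ge0.
have aE : a * w%:R = n%:R * l ^+ 2 by rewrite divfK // gt_eqF.
have TBle : TB%:R <= m%:R + 20480%:R * a.
  rewrite -(ler_pM2l w0') mulrDr; move: h; rewrite -(ler_nat R) natrD !natrM => h.
  apply: le_trans h _; rewrite lerD2l.
  have -> : w%:R * (20480%:R * a) = 20480%:R * (a * w%:R) by ring.
  rewrite aE; have := ler_wpM2r n0 L2; nra.
have mk0 : 0 <= (k * m)%N%:R :> R by [].
have mm0 : 0 <= m%:R :> R by [].
rewrite (natrD _ (50 * m + _)) (natrD _ (50 * m)) (natrM _ 50) (natrM _ (2 * 3000) TB).
rewrite (natrM _ 46) (mulnC m) (natrM _ 2 3000) (natrM _ (2 * 3000) (5 * 4096)).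
rewrite (natrM _ 2 3000) (natrM _ 5 4096); lra.
Qed.

End Log.

Lemma first_minimum (f : nat -> nat) m : 0 < m ->
  exists b, [/\ b < m, forall i, i < m -> f b <= f i & forall i, i < b -> f b < f i].
Proof.
move=> m0; pose P b := (b < m) && all (fun i => f b <= f i) (iota 0 m).
have ex : exists b, P b.
  case: (@arg_minnP _ (Ordinal m0) xpredT (fun i : 'I_m => f i) isT) => i _ h.
  exists i; rewrite /P ltn_ord; apply/allP => j; rewrite mem_iota => jm.
  exact: (h (Ordinal jm)).
case: (ex_minnP ex) => b /andP[bm /allP al] least; exists b.
have mn i : i < m -> f b <= f i by move=> im; apply: al; rewrite mem_iota.
split=> // i ib; rewrite ltnNge; apply/negP => le.
have : P i.
  rewrite /P (ltn_trans ib bm); apply/allP => j; rewrite mem_iota => jm.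
  exact: leq_trans le (mn _ jm).
by move/least; rewrite leqNgt ib.
Qed.

Import Order.TTheory GRing.Theory Num.Theory.

Theorem theorem2 (R : realType) :
  exists (pre qry : program) (s c : nat),
    linear_space_preprocessing s c pre /\
    forall (w m : nat) (S : 'I_m -> {set word w}) (q : seed w s -> query w),
      let n := \sum_(i < m) #|S i| in
      let I := (\bigcap_(i < m) S i)%SET in
      let k := #|I| in
      0 < w -> 0 < m ->
      (forall rho, query_for pre rho (c * (n + m)) S (q rho)) ->
      exists T : seed w s -> nat,
        (forall rho : seed w s,
           let st := query_start m (q rho) in
           confined qry st (work_at (q rho)) (c * (n + m)) /\
           exists (st' : state w) (L : seq (word w)),
             [/\ halts_in qry st (T rho) st', output st' L &
                 perm_eq L (enum I)]) /\
        (expectation R T <=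
           c%:R * (n%:R * ln w%:R ^+ 2 / w%:R + (k * m)%:R + m%:R))%R.
Proof.
have [w1 w1l] := large_eventually.
pose K := (size query_program).+1.
have [c [c2 c3 c4]] : exists c, [/\ 2000 <= c, 2 ^ w1 <= c &
    K * (2 * 3000 * (5 * 4096)) <= c].
  set D := K * _; exists (2000 + 2 ^ w1 + D); split.
  - by rewrite -addnA leq_addr.
  - by rewrite addnAC leq_addl.
  - exact: leq_addl.
have cl w : c <= 2 ^ w -> large w.
  by move=> h; apply: w1l; rewrite -(@leq_exp2l 2) //; apply: leq_trans c3 h.
exists pre_program, query_program, 7, c; split; first exact: pre_program_linear.
move=> w m S q n I k w0 m0 hq.
have Sn i : #|S i| <= n by rewrite /n (bigD1 i) //= leq_addr.
have nm : 0 < n + m by rewrite addn_gt0 m0 orbT.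
have cnm : c * (n + m) <= 2 ^ w.
  have [p [D [_ _ _ h]]] := hq [tuple of nseq 7 (trunc w 0)].
  exact: leq_trans (leq_addl _ _) h.
have lw : large w by apply: cl; apply: leq_trans cnm; rewrite leq_pmulr.
have Snm i : #|S i| < n + m.
  by apply: leq_ltn_trans (Sn i) _; rewrite -[X in X < _]addn0 ltn_add2l.
have Sw i : 2000 * #|S i|.+1 <= 2 ^ w by apply: leq_trans cnm; apply: leq_mul.
have c0 : 0 < c by apply: leq_trans c2.
have Slen i : #|S i| <= c * (n + m).
  by apply: leq_trans (ltnW (Snm i)) _; rewrite leq_pmull.
have mlen : m < c * (n + m).
  by apply: (@leq_trans (2 * (n + m))); [clear -m0; lia | rewrite leq_mul2r (leq_trans _ c2) ?orbT].
pose X := listed (fun i => enum (S i)).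
have XE (i : 'I_m) : X i = vals (enum (S i)) by apply: listedE.
have lift (P : nat -> Prop) : (forall i : 'I_m, P i) -> forall i, i < m -> P i.
  by move=> h i im; apply: (h (Ordinal im)).
have nE (i : 'I_m) : set_size X i = #|S i| by rewrite /set_size XE size_map cardE.
have [b [bm bmin bfirst]] := first_minimum (set_size X) m0.
have [T hT] := fin_all_exists (fun rho =>
  query_run lw m0 Sw mlen Slen (hq rho) bm bmin bfirst).
exists T; split=> [rho st | ].
  by have [st' [L [h1 _ h2 h3 h4]]] := hT rho; split=> //; exists st', L.
pose B := 50 * m + 2 * 3000 * total_buckets w m X + 46 * (m * count (inter m X) (X b)).
have uX : forall i, i < m -> uniq (X i).
  by apply: lift => i; rewrite XE map_inj_uniq ?enum_uniq //; apply: val_inj.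
have Xw : forall i x, i < m -> x \in X i -> x < 2 ^ w.
  move=> i x im; move: i im x; apply: lift => i x; rewrite XE => /mapP[y _ ->].
  exact: ltn_ord.
have Pw : forall i, i < m -> total_size w (set_size X i) <= 2 ^ w.
  apply: lift => i; apply: leq_trans (Sw i); rewrite -nE.
  by apply: leq_trans (total_size_le _ lw); apply: leq_addl.
have mean : mean_le (fun rho : seed w 7 => query_cost w (nth 0 (vals rho)) m X b) B.
  apply: (@mean_seed w (fun rho => query_cost w rho m X b)).
  apply: (@mean_le_pair _ _ (fun (a : 'I_(2 ^ (2 * w)) * ('I_(2 ^ (2 * w)) * 'I_(2 ^ w)))
     (s3 : 'I_(2 ^ (2 * w))) => query_cost w (seed_of w a.1 a.2.1 a.2.2 s3) m X b)
     (fun a => query_mean w m X b a.1 a.2.1 a.2.2)).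
    by move=> a; apply: query_cost_mean.
  exact: query_mean_mean.
have kE : count (inter m X) (X b) = k.
  have -> : X b = vals (enum (S (Ordinal bm))) by rewrite -(XE (Ordinal bm)).
  rewrite count_map -size_filter /k cardE; apply: perm_size.
  apply: uniq_perm; [by apply: filter_uniq; apply: enum_uniq | exact: enum_uniq |] => x.
  rewrite mem_filter !mem_enum /=.
  have xE (i : 'I_m) : (val x \in X i) = (x \in S i).
    by rewrite XE mem_map ?mem_enum //; apply: val_inj.
  apply/andP/bigcapP => [[/allP al _] i _ | al].
    by rewrite -xE; apply: al; rewrite mem_iota /=.
  split; last exact: al.
  apply/allP => i; rewrite mem_iota => im.
  by have := xE (Ordinal im); rewrite al.
have sE : \sum_(i <- iota 0 m) size (X i) = n.
  have -> : iota 0 m = index_iota 0 m by rewrite /index_iota subn0.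
  by rewrite big_mkord; apply: eq_bigr => i _; rewrite XE size_map cardE.
have sumT : \sum_(rho : 7.-tuple (word w)) T rho <= K * B * #|{: 7.-tuple (word w)}|.
  rewrite -mulnA; apply: (@leq_trans (K * \sum_(rho : 7.-tuple (word w)) query_cost w (nth 0 (vals rho)) m X b)).
    by rewrite big_distrr; apply: leq_sum => rho _; have [st' [L [_ h _ _ _]]] := hT rho.
  by rewrite leq_mul2l mean orbT.
have sw0 : 0 < #|{: 7.-tuple (word w)}| by rewrite card_tuple card_ord !expn_gt0.
have TB := total_buckets_mul m X lw; rewrite sE in TB.
have bound := @cost_bound R m (total_buckets w m X) k n w (ell w) _ (w_gt0 lw) (ell_ln R lw) TB.
rewrite -kE -/B kE in bound.
rewrite /expectation ler_pdivrMr ?ltr0n //.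
rewrite -natr_sum; apply: (@le_trans _ _ ((K * B * #|{: 7.-tuple (word w)}|)%N%:R)%R).
  by rewrite ler_nat.
rewrite natrM ler_wpM2r // natrM.
apply: (@le_trans _ _ (K%:R * ((2 * 3000 * (5 * 4096))%N%:R *
  (n%:R * ln w%:R ^+ 2 / w%:R + (k * m)%:R + m%:R)))%R).
  by rewrite ler_wpM2l.
rewrite mulrA -natrM ler_wpM2r ?ler_nat //.
by rewrite !addr_ge0 // divr_ge0 // mulr_ge0 // sqr_ge0.
Qed.
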